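(* Let $f\in\mathrm{Homeo}_0(\mathbb T^2)$ be semiconjugate to an irrational rotation $R_\rho$ of $\mathbb S^1$ via a semiconjugacy $h:\mathbb T^2\to\mathbb S^1$ such that every fibre $h^{-1}\{\xi\}$ is an essential annular continuum, and suppose there is a set $\Omega\subset\mathbb S^1$ of positive Lebesgue measure such that $h^{-1}\{\xi\}$ is compactly generated for all $\xi\in\Omega$. Then $f$ has a unique rotation vector, i.e. for a lift $F:\mathbb R^2\to\mathbb R^2$ of $f$ the rotation set $\rho(F)$ is a single point.
   Context: $\mathrm{Homeo}_0(\mathbb T^2)$: homeomorphisms of $\mathbb T^2$ homotopic to the identity; $\pi:\mathbb R^2\to\mathbb T^2$ the projection. The rotation set of a lift $F$ is $\rho(F)=\{\rho\in\mathbb R^2:\exists z_i\in\mathbb R^2, n_i\nearrow\infty,\ \lim_i (F^{n_i}(z_i)-z_i)/n_i=\rho\}$. A semiconjugacy from $f$ to $R_\rho(x)=x+\rho$ is a continuous surjection $h$ with $h\circ f=R_\rho\circ h$. An essential annular continuum $A\subset\mathbb T^2$ is a continuum whose complement is homeomorphic to the open annulus $\mathbb S^1\times\mathbb R$ (with $A$ not contractible in the sense that it separates the torus into no disk component; equivalently it is an essential annular continuum of an embedded open annulus whose essential loops are essential in $\mathbb T^2$). The complement of $A$ contains essential simple closed curves, all of one homotopy type, called the homotopy type of $A$; $A$ is horizontal if this type is $(1,0)$. Let $T(x,y)=(x+1,y)$. A horizontal essential annular continuum $A$ is compactly generated if, for a connected component $\hat A$ of $\pi^{-1}(A)$, there is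 a compact connected $G_0\subset\hat A$ with $\hat A=\bigcup_{n\in\mathbb Z}T^n(G_0)$; an essential annular continuum of arbitrary homotopy type is compactly generated if some homeomorphism of $\mathbb T^2$ maps it to a compactly generated horizontal one. *)

(* Defs.v *)
From Stdlib Require Import Reals Lra List.
Open Scope R_scope.

Record Top := mkTop { pt :> Type; is_open : (pt -> Prop) -> Prop }.

Definition continuous {X Y : Top} (f : pt X -> pt Y) : Prop :=
  forall V : pt Y -> Prop, is_open Y V -> is_open X (fun x => V (f x)).

Definition homeomorphism {X Y : Top} (f : pt X -> pt Y) : Prop :=
  continuous f /\
  exists g : pt Y -> pt X, continuous g /\ (forall x, g (f x) = x) /\ (forall y, f (g y) = y).

Definition subspace (X : Top) (S : pt X -> Prop) : Top :=
  mkTop {x : pt X | S x}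
    (fun W => exists U, is_open X U /\ forall p, W p <-> U (proj1_sig p)).

Definition prod_top (X Y : Top) : Top :=
  mkTop (pt X * pt Y)%type
    (fun W => forall p, W p -> exists U V, is_open X U /\ is_open Y V /\
       U (fst p) /\ V (snd p) /\ forall a b, U a -> V b -> W (a, b)).

Definition compact_space (X : Top) : Prop :=
  forall (I : Type) (U : I -> pt X -> Prop),
    (forall i, is_open X (U i)) -> (forall x, exists i, U i x) ->
    exists l : list I, forall x, exists i, In i l /\ U i x.

Definition connected_space (X : Top) : Prop :=
  forall U V : pt X -> Prop, is_open X U -> is_open X V ->
    (forall x, U x \/ V x) -> (forall x, ~ (U x /\ V x)) ->
    (forall x, U x) \/ (forall x, V x).

Definition compact_set (X : Top) (S : pt X -> Prop) := compact_space (subspace X S).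
Definition connected_set (X : Top) (S : pt X -> Prop) := connected_space (subspace X S).
Definition continuum (X : Top) (S : pt X -> Prop) :=
  (exists x, S x) /\ compact_set X S /\ connected_set X S.


Definition R_open (U : R -> Prop) : Prop :=
  forall x, U x -> exists e, 0 < e /\ forall y, Rabs (y - x) < e -> U y.
Definition R_top : Top := mkTop R R_open.

Definition R2_open (U : R * R -> Prop) : Prop :=
  forall z, U z -> exists e, 0 < e /\ forall w,
    Rabs (fst w - fst z) < e -> Rabs (snd w - snd z) < e -> U w.
Definition R2_top : Top := mkTop (R * R)%type R2_open.

Definition I01 : Top := subspace R_top (fun t => 0 <= t <= 1).

Definition homotopic {X Y : Top} (g0 g1 : pt X -> pt Y) : Prop :=
  exists H : pt (prod_top I01 X) -> pt Y, continuous H /\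
    forall (t : pt I01) (x : pt X),
      (proj1_sig t = 0 -> H (t, x) = g0 x) /\ (proj1_sig t = 1 -> H (t, x) = g1 x).

(* the circle S^1 = R/Z, points represented in [0,1) *)
Definition S1 : Type := {t : R | 0 <= t < 1}.
Lemma frac_in (t : R) : 0 <= frac_part t < 1.
Proof. destruct (base_fp t); lra. Qed.
Definition piS (t : R) : S1 := exist _ (frac_part t) (frac_in t).
Definition S1_top : Top := mkTop S1 (fun U => R_open (fun t => U (piS t))).

(* the torus T^2 = R^2/Z^2 with the quotient topology; pi : R^2 -> T^2 *)
Definition T2 : Type := (S1 * S1)%type.
Definition piT (z : R * R) : T2 := (piS (fst z), piS (snd z)).
Definition T2_top : Top := mkTop T2 (fun U => R2_open (fun z => U (piT z))).

Definition rotS (rho : R) (s : S1) : S1 := piS (proj1_sig s + rho).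

Definition irrational (r : R) : Prop :=
  forall p q : Z, q <> 0%Z -> r <> IZR p / IZR q.

Definition complement_top (A : T2 -> Prop) : Top := subspace T2_top (fun x => ~ A x).
Definition annulus_top : Top := prod_top S1_top R_top.

Definition core_loop (A : T2 -> Prop) (phi : pt annulus_top -> pt (complement_top A))
  : S1 -> T2 := fun s => proj1_sig (phi (s, 0)).

Definition contractible_loop (g : S1 -> T2) : Prop :=
  exists c : T2, homotopic (X := S1_top) (Y := T2_top) g (fun _ => c).

(* A is a continuum whose complement is homeomorphic to the open annulus,
   with essential loops of the annulus essential in T^2 *)
Definition essential_annular_continuum (A : T2 -> Prop) : Prop :=
  continuum T2_top A /\
  exists phi : pt annulus_top -> pt (complement_top A),
    homeomorphism phi /\ ~ contractible_loop (core_loop A phi).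

Definition gamma0 (s : S1) : T2 := (s, piS 0).
Definition gamma0_rev (s : S1) : T2 := (piS (- proj1_sig s), piS 0).

Definition horizontal (A : T2 -> Prop) : Prop :=
  essential_annular_continuum A /\
  exists phi : pt annulus_top -> pt (complement_top A),
    homeomorphism phi /\
    (homotopic (X := S1_top) (Y := T2_top) (core_loop A phi) gamma0 \/
     homotopic (X := S1_top) (Y := T2_top) (core_loop A phi) gamma0_rev).

Definition lift_set (A : T2 -> Prop) : R * R -> Prop := fun z => A (piT z).

Definition conn_component (S C : R * R -> Prop) : Prop :=
  (exists z, C z) /\ (forall z, C z -> S z) /\ connected_set R2_top C /\
  forall D : R * R -> Prop, (forall z, C z -> D z) -> (forall z, D z -> S z) ->
    connected_set R2_top D -> forall z, D z -> C z.

Definition cg_horizontal (A : T2 -> Prop) : Prop :=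
  horizontal A /\
  exists C : R * R -> Prop, conn_component (lift_set A) C /\
  exists G0 : R * R -> Prop,
    (forall z, G0 z -> C z) /\ compact_set R2_top G0 /\ connected_set R2_top G0 /\
    forall z, C z <-> exists n : Z, G0 (fst z - IZR n, snd z).

Definition image (g : T2 -> T2) (A : T2 -> Prop) : T2 -> Prop :=
  fun y => exists x, A x /\ g x = y.

Definition compactly_generated (A : T2 -> Prop) : Prop :=
  exists Phi : T2 -> T2, homeomorphism (X := T2_top) (Y := T2_top) Phi /\
    cg_horizontal (image Phi A).

(* OM_le A r  <->  Lebesgue outer measure of A is <= r *)
Definition OM_le (A : R -> Prop) (r : R) : Prop :=
  forall eps, 0 < eps -> exists a b : nat -> R,
    (forall n, a n <= b n) /\
    (forall x, A x -> exists n, a n < x < b n) /\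
    (forall N, sum_f_R0 (fun n => b n - a n) N <= r + eps).

Definition lebesgue_measurable (A : R -> Prop) : Prop :=
  forall (E : R -> Prop) (r : R), OM_le E r ->
    exists r1 r2, OM_le (fun x => E x /\ A x) r1 /\
                  OM_le (fun x => E x /\ ~ A x) r2 /\ r1 + r2 <= r.

Definition positive_measure_S1 (Omega : S1 -> Prop) : Prop :=
  let A := fun t => 0 <= t < 1 /\ Omega (piS t) in
  lebesgue_measurable A /\ ~ OM_le A 0.

Definition rotation_set (F : R * R -> R * R) (v : R * R) : Prop :=
  exists (z : nat -> R * R) (n : nat -> nat),
    (forall i, (n i < n (S i))%nat) /\
    Un_cv (fun i => (fst (Nat.iter (n i) F (z i)) - fst (z i)) / INR (n i)) (fst v) /\
    Un_cv (fun i => (snd (Nat.iter (n i) F (z i)) - snd (z i)) / INR (n i)) (snd v).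

(* Main.v *)
Require Import Defs.
From Stdlib Require Import Reals Lra Lia Bool ZArith Znumtheory Relations.
From Stdlib Require Import Classical ClassicalChoice ClassicalDescription ProofIrrelevance
  FunctionalExtensionality PropExtensionality.
From Stdlib Require Cantor.
From mathcomp Require all_boot all_order all_algebra.
From mathcomp Require all_classical all_reals all_analysis measurable_realfun.
From mathcomp Require Rstruct Rstruct_topology.
Open Scope R_scope.

(** Lift [h] to a height function [H] on the plane, normalised by a change of basis of [Z^2] so that
    [H (x + 1, y) = H (x, y)] and [H (x, y + 1) = H (x, y) + 1]; of the fibres of [h] only the
    connectedness is needed for this. All but countably many levels [c] are regular, that is, not
    values of local extrema of [H]. Every point [p] of a regular level is joined to the bottom inside
    [H < c] and to the top inside [H > c]: climb along the connected level of a nearby point and then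
    vertically. A chain along the level from far left to far right must cross this curve, hence
    passes near [p].

    It follows that on a regular compactly generated level any two nearby points are joined by
    chains of bounded width [M], and that the horizontal displacement of [F^N] varies by [O(M)] only
    between nearby points of [H = c] whenever [c] and [c + N rho] both have this property. The levels
    of width [M] form a G_delta set, of positive measure for some [M], so it is recurrent under
    the rotation. If the maximal and the minimal drift of [F] differed, equidistribution would show
    that for large [N] both are almost attained over time [N] in most fibres, in particular in a
    fibre at which the displacement of [F^N] varies by [O(M)] only, a contradiction. *)

(** Fibres are arbitrary continua and need not contain arcs, so the plane topology is done with
    finite [d]-chains at every scale [d]: connectedness yields chains, and the crossing of two
    chains is a parity count on a finite grid instead of the Jordan curve theorem. A chain may leave
    its level by less than [d]; this tolerance makes [narrow] an open condition on the level,
    whereas compact generation itself has no evident measurability. [Omega] enters only through its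
    outer measure not being zero.

    Extremal levels are set aside because a local maximum or minimum of [H] cannot be approached
    from both sides of its level, so that a chain along the level could bypass it.

    The order of choices is decisive. No width serves all of [Omega], so [M] is fixed first, and [N]
    afterwards, so large that [N] times the drift gap beats the bound in terms of [M]. Returns to
    the levels of width [M] have measure bounded below independently of [N], for suitable
    arbitrarily large [N], whereas the levels that miss an extremal drift by a fixed amount have
    measure tending to 0; so all conditions meet in one fibre. *)

Definition close (e : R) (z w : R * R) : Prop :=
  Rabs (fst w - fst z) < e /\ Rabs (snd w - snd z) < e.

Lemma close_refl e z : 0 < e -> close e z z.
Proof. intros He; split; rewrite Rminus_diag, Rabs_R0; exact He. Qed.

Lemma close_sym e z w : close e z w -> close e w z.
Proof. intros [H1 H2]; split; rewrite Rabs_minus_sym; assumption. Qed.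

Lemma close_trans e e' z w u : close e z w -> close e' w u -> close (e + e') z u.
Proof.
  intros [H1 H2] [H3 H4]; split.
  - replace (fst u - fst z) with ((fst u - fst w) + (fst w - fst z)) by ring.
    eapply Rle_lt_trans; [apply Rabs_triang | lra].
  - replace (snd u - snd z) with ((snd u - snd w) + (snd w - snd z)) by ring.
    eapply Rle_lt_trans; [apply Rabs_triang | lra].
Qed.

Lemma close_mono e e' z w : e <= e' -> close e z w -> close e' z w.
Proof. intros He [H1 H2]; split; lra. Qed.

Lemma close_slack d z w : close d z w ->
  exists e, 0 < e /\ forall u, close e w u -> close d z u.
Proof.
  intros [H1 H2]. set (e := Rmin (d - Rabs (fst w - fst z)) (d - Rabs (snd w - snd z))).
  pose proof (Rmin_l (d - Rabs (fst w - fst z)) (d - Rabs (snd w - snd z))) as M1.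
  pose proof (Rmin_r (d - Rabs (fst w - fst z)) (d - Rabs (snd w - snd z))) as M2.
  exists e; split; [apply Rmin_glb_lt; lra|]; intros u [U1 U2]. fold e in M1, M2.
  apply Rabs_def2 in U1, U2. revert M1 M2 H1 H2.
  split; apply Rabs_def1; unfold Rabs in *; repeat destruct Rcase_abs; lra.
Qed.

(** * Chains *)

Inductive chain (d : R) (P : R * R -> Prop) : R * R -> R * R -> Prop :=
| chain_refl z : P z -> chain d P z z
| chain_step z w u : P z -> close d z w -> chain d P w u -> chain d P z u.

Lemma chain_left d P z w : chain d P z w -> P z.
Proof. intros [? H | ? ? ? H]; exact H. Qed.

Lemma chain_right d P z w : chain d P z w -> P w.
Proof. induction 1; assumption. Qed.

Lemma chain_trans d P z w u : chain d P z w -> chain d P w u -> chain d P z u.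
Proof. induction 1; eauto using chain_step. Qed.

Lemma chain_sym d P z w : chain d P z w -> chain d P w z.
Proof.
  induction 1 as [z Hz | z w u Hz Hc Hwu IH]; [now apply chain_refl |].
  apply chain_trans with w; [exact IH |].
  apply chain_step with z; [now apply chain_left in Hwu | now apply close_sym |].
  now apply chain_refl.
Qed.

Lemma chain_map d d' (P Q : R * R -> Prop) (g : R * R -> R * R) z w :
  (forall u, P u -> Q (g u)) ->
  (forall u v, P u -> P v -> close d u v -> close d' (g u) (g v)) ->
  chain d P z w -> chain d' Q (g z) (g w).
Proof.
  intros HPQ Hg; induction 1 as [z Hz | z w u Hz Hc Hwu IH].
  - now apply chain_refl, HPQ.
  - apply chain_step with (g w); auto.
    apply Hg; auto. now apply chain_left in Hwu.
Qed.

Lemma chain_mono d d' (P Q : R * R -> Prop) z w :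
  d <= d' -> (forall u, P u -> Q u) -> chain d P z w -> chain d' Q z w.
Proof.
  intros Hd HPQ H. apply (chain_map d d' P Q (fun u => u)); auto.
  intros u v _ _; now apply close_mono.
Qed.

Lemma chain_bounded d P z w : chain d P z w ->
  exists X, chain d (fun u => P u /\ Rabs (fst u) < X) z w.
Proof.
  induction 1 as [z Hz | z w u Hz Hc Hwu [X IH]].
  - exists (Rabs (fst z) + 1); apply chain_refl; split; [assumption | lra].
  - exists (Rmax X (Rabs (fst z) + 1)); apply chain_step with w; [|assumption|].
    + split; [assumption|]. pose proof (Rmax_r X (Rabs (fst z) + 1)); lra.
    + revert IH; apply chain_mono; [lra|].
      intros v [Hv1 Hv2]; split; [assumption|].
      pose proof (Rmax_l X (Rabs (fst z) + 1)); lra.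
Qed.

Lemma chain_sequence d P z w : chain d P z w ->
  exists (n : nat) (e : nat -> R * R), e O = z /\ e n = w /\
    (forall i, (i <= n)%nat -> P (e i)) /\
    (forall i, (i < n)%nat -> close d (e i) (e (S i))).
Proof.
  induction 1 as [z Hz | z w u Hz Hc Hwu (n & e & H0 & Hn & HP & Hd)].
  - exists O, (fun _ => z); repeat split; intros; lia || assumption.
  - exists (S n), (fun i => match i with O => z | S i => e i end).
    split; [reflexivity|]; split; [assumption|]; split.
    + intros [|i] Hi; [assumption | apply HP; lia].
    + intros [|i] Hi; [now rewrite H0 | apply Hd; lia].
Qed.

(** * Two crossing chains *)

Inductive label := L0 | L1 | L2.

(** The doors of Sperner's parity argument. *)
Definition edge12 (a b : label) : bool :=
  match a, b with L1, L2 => true | L2, L1 => true | _, _ => false end.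

Definition trichromatic (a b c d : label) : Prop :=
  (a = L0 \/ b = L0 \/ c = L0 \/ d = L0) /\
  (a = L1 \/ b = L1 \/ c = L1 \/ d = L1) /\
  (a = L2 \/ b = L2 \/ c = L2 \/ d = L2).

(** The four edges form a closed cycle; if at most two labels occur on it, the label changes an even
    number of times. *)
Lemma cell_parity a b c d : ~ trichromatic a b c d ->
  xorb (xorb (edge12 a b) (edge12 c d)) (xorb (edge12 a c) (edge12 b d)) = false.
Proof.
  unfold trichromatic; intros H.
  destruct a, b, c, d; try reflexivity; exfalso; apply H; intuition.
Qed.

Section Sperner.
Variable (lab : nat -> nat -> label).

Fixpoint column (i l : nat) : bool :=
  match l with O => false | S l => xorb (column i l) (edge12 (lab i l) (lab i (S l))) end.

(** Summing [cell_parity] over the strip between two neighbouring columns cancels all inner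
    horizontal edges and leaves the two at its ends. *)
Lemma column_step i l :
  (forall j, (j < l)%nat ->
     ~ trichromatic (lab i j) (lab (S i) j) (lab i (S j)) (lab (S i) (S j))) ->
  column (S i) l = xorb (column i l)
    (xorb (edge12 (lab i O) (lab (S i) O)) (edge12 (lab i l) (lab (S i) l))).
Proof.
  induction l as [|l IH]; intros H; simpl.
  - now rewrite xorb_nilpotent.
  - rewrite IH by (intros j Hj; apply H; lia).
    specialize (H l ltac:(lia)); apply cell_parity in H. revert H.
    generalize (edge12 (lab i l) (lab (S i) l)), (edge12 (lab i (S l)) (lab (S i) (S l))),
      (edge12 (lab i l) (lab i (S l))), (edge12 (lab (S i) l) (lab (S i) (S l))),
      (edge12 (lab i 0) (lab (S i) 0)), (column i l).
    intros [] [] [] [] [] []; simpl; congruence.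
Qed.

Lemma column_left l : (forall j, (j <= l)%nat -> lab O j = L0) -> column O l = false.
Proof.
  induction l as [|l IH]; intros H; simpl; [reflexivity|].
  rewrite IH by (intros; apply H; lia). rewrite (H l) by lia. reflexivity.
Qed.

Lemma column_right i l : (forall j, (j <= l)%nat -> lab i j <> L0) -> lab i O = L1 ->
  column i l = match lab i l with L2 => true | _ => false end.
Proof.
  intros H H0; induction l as [|l IH]; simpl; [now rewrite H0|].
  rewrite IH by (intros; apply H; lia).
  pose proof (H l ltac:(lia)); pose proof (H (S l) ltac:(lia)).
  destruct (lab i l), (lab i (S l)); simpl; congruence.
Qed.

(* Without a trichromatic cell, the parity of the number of 1-2 edges is the same in all columns;
   but it is even on the left side and odd on the right side. *)
Lemma sperner_grid (m l : nat) :
  (forall j, (j <= l)%nat -> lab O j = L0) ->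
  (forall j, (j <= l)%nat -> lab m j <> L0) -> lab m O = L1 -> lab m l = L2 ->
  (forall i, (i <= m)%nat -> lab i O <> L2) -> (forall i, (i <= m)%nat -> lab i l <> L1) ->
  exists i j, (i < m)%nat /\ (j < l)%nat /\
    trichromatic (lab i j) (lab (S i) j) (lab i (S j)) (lab (S i) (S j)).
Proof.
  intros Hleft Hright Hm0 Hml Hbot Htop.
  destruct (Classical_Prop.classic (exists i j, (i < m)%nat /\ (j < l)%nat /\
    trichromatic (lab i j) (lab (S i) j) (lab i (S j)) (lab (S i) (S j)))) as [H|H];
    [exact H | exfalso].
  assert (Hcol : forall i, (i <= m)%nat -> column i l = false).
  { induction i as [|i IH]; intros Hi; [now apply column_left|].
    rewrite column_step, IH by
      (try lia; intros j Hj Ht; apply H; exists i, j; repeat split; lia || apply Ht).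
    pose proof (Hbot i ltac:(lia)); pose proof (Hbot (S i) ltac:(lia)).
    pose proof (Htop i ltac:(lia)); pose proof (Htop (S i) ltac:(lia)).
    destruct (lab i 0), (lab (S i) 0), (lab i l), (lab (S i) l); simpl; congruence. }
  pose proof (Hcol m (le_n m)) as Hc.
  rewrite (column_right m l Hright Hm0), Hml in Hc. discriminate.
Qed.
End Sperner.

(** A discrete crossing theorem. The two position hypotheses determine the labels on the boundary of
    the grid of index pairs, as [sperner_grid] requires. *)
Lemma chains_cross d (P Q : R * R -> Prop) z w p q :
  chain d P z w -> chain d Q p q ->
  (forall v, Q v -> fst z < fst v < fst w) -> (forall v, P v -> snd p < snd v < snd q) ->
  exists a b, P a /\ Q b /\ close (2 * d) a b.
Proof.
  intros HP HQ Hx Hy.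
  destruct (chain_sequence _ _ _ _ HP) as (m & e & He0 & Hem & HeP & Hed).
  destruct (chain_sequence _ _ _ _ HQ) as (l & g & Hg0 & Hgl & HgQ & Hgd).
  (* Label [(i, j)] by the direction of [e i - g j]: in a trichromatic cell this vector is small. *)
  set (u := fun i j => fst (e i) - fst (g j)).
  set (v := fun i j => snd (e i) - snd (g j)).
  set (lab := fun i j => if Rlt_dec (u i j) 0 then L0 else if Rlt_dec 0 (v i j) then L1 else L2).
  assert (H0 : forall i j, lab i j = L0 -> u i j < 0).
  { intros i j; unfold lab; destruct (Rlt_dec (u i j) 0); [auto|].
    destruct (Rlt_dec 0 (v i j)); discriminate. }
  assert (H1 : forall i j, lab i j = L1 -> 0 <= u i j /\ 0 < v i j).
  { intros i j; unfold lab; destruct (Rlt_dec (u i j) 0); [discriminate|].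
    destruct (Rlt_dec 0 (v i j)); [intros _; lra | discriminate]. }
  assert (H2 : forall i j, lab i j = L2 -> 0 <= u i j /\ v i j <= 0).
  { intros i j; unfold lab; destruct (Rlt_dec (u i j) 0); [discriminate|].
    destruct (Rlt_dec 0 (v i j)); [discriminate | intros _; lra]. }
  assert (Hright : forall j, (j <= l)%nat -> 0 < u m j).
  { intros j Hj; unfold u; rewrite Hem; specialize (Hx _ (HgQ j Hj)); lra. }
  assert (Hbot : forall i, (i <= m)%nat -> 0 < v i O).
  { intros i Hi; unfold v; rewrite Hg0; specialize (Hy _ (HeP i Hi)); lra. }
  assert (Htop : forall i, (i <= m)%nat -> v i l < 0).
  { intros i Hi; unfold v; rewrite Hgl; specialize (Hy _ (HeP i Hi)); lra. }
  destruct (sperner_grid lab m l) as (i & j & Hi & Hj & T0 & T1 & T2).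
  - intros j Hj; unfold lab. destruct (Rlt_dec (u 0%nat j) 0) as [_|n]; [reflexivity|].
    exfalso; apply n; unfold u; rewrite He0; specialize (Hx _ (HgQ j Hj)); lra.
  - intros j Hj E; specialize (H0 _ _ E); specialize (Hright j Hj); lra.
  - unfold lab; specialize (Hright 0%nat (Nat.le_0_l _)); specialize (Hbot m (le_n _)).
    destruct (Rlt_dec (u m 0%nat) 0); [lra|]. destruct (Rlt_dec 0 (v m 0%nat)); [reflexivity|lra].
  - unfold lab; specialize (Hright l (le_n _)); specialize (Htop m (le_n _)).
    destruct (Rlt_dec (u m l) 0); [lra|]. destruct (Rlt_dec 0 (v m l)); [lra|reflexivity].
  - intros i Hi E; specialize (H2 _ _ E); specialize (Hbot i Hi); lra.
  - intros i Hi E; specialize (H1 _ _ E); specialize (Htop i Hi); lra.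
  (* Inside one cell each index moves by at most one, so the difference vector changes by less than
     [d + d]; as all three labels occur there, both its coordinates are that small. *)
  - assert (Hosc : forall i' j' i'' j'',
      (i' = i \/ i' = S i) -> (j' = j \/ j' = S j) ->
      (i'' = i \/ i'' = S i) -> (j'' = j \/ j'' = S j) ->
      Rabs (u i' j' - u i'' j'') < 2 * d /\ Rabs (v i' j' - v i'' j'') < 2 * d).
    { assert (Hd : 0 < d).
      { destruct (Hed i Hi) as [A _]; pose proof (Rabs_pos (fst (e (S i)) - fst (e i))); lra. }
      destruct (Hed i Hi) as [A1 A2]; destruct (Hgd j Hj) as [B1 B2].
      apply Rabs_def2 in A1, A2, B1, B2; unfold u, v.
      intros i' j' i'' j'' [-> | ->] [-> | ->] [-> | ->] [-> | ->];
        split; apply Rabs_def1; lra. }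
    assert (V : forall a, lab i j = a \/ lab (S i) j = a \/ lab i (S j) = a \/ lab (S i) (S j) = a ->
      exists i' j', (i' = i \/ i' = S i) /\ (j' = j \/ j' = S j) /\ lab i' j' = a).
    { intros a [E | [E | [E | E]]]; [exists i, j | exists (S i), j | exists i, (S j) | exists (S i), (S j)];
        auto. }
    destruct (V _ T0) as (i0 & j0 & Hi0 & Hj0 & E0%H0).
    destruct (V _ T1) as (i1 & j1 & Hi1 & Hj1 & E1%H1).
    destruct (V _ T2) as (i2 & j2 & Hi2 & Hj2 & E2%H2).
    exists (e i0), (g j0).
    split; [apply HeP; lia|]; split; [apply HgQ; lia|].
    destruct (Hosc _ _ _ _ Hi0 Hj0 Hi1 Hj1) as [A1 A2]; destruct (Hosc _ _ _ _ Hi0 Hj0 Hi2 Hj2) as [B1 B2].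
    apply Rabs_def2 in A1, A2, B1, B2.
    split; rewrite Rabs_minus_sym; apply Rabs_def1; fold (u i0 j0); fold (v i0 j0); lra.
Qed.

(** * Compactness of rectangles *)

(** Heine-Borel, by the supremum of the points up to which one radius suffices. The number [e] is
    both the radius of the neighbourhood and the parameter of [Q]; monotonicity allows passing to
    the smaller of two radii. *)
Lemma segment_uniform (a b : R) (Q : R -> R -> Prop) :
  (forall t e e', e' <= e -> Q t e -> Q t e') ->
  (forall t, a <= t <= b -> exists e, 0 < e /\ forall t', Rabs (t' - t) < e -> Q t' e) ->
  exists e, 0 < e /\ forall t, a <= t <= b -> Q t e.
Proof.
  intros Hmono Hloc.
  destruct (Rlt_le_dec b a) as [Hba | Hab]; [exists 1; split; [lra | intros; lra]|].
  set (E := fun x => a <= x <= b /\ exists e, 0 < e /\ forall t, a <= t <= x -> Q t e).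
  destruct (Hloc a) as (e0 & He0 & Ha); [lra|].
  assert (Ea : E a).
  { split; [lra|]; exists e0; split; [assumption|]; intros t Ht; apply Ha.
    replace (t - a) with 0 by lra; now rewrite Rabs_R0. }
  destruct (completeness E) as [s [Hub Hlub]].
  { exists b; intros x [Hx _]; lra. }
  { now exists a. }
  assert (Has : a <= s) by (now apply Hub).
  assert (Hsb : s <= b) by (apply Hlub; intros x [Hx _]; lra).
  destruct (Hloc s) as (e & He & Hs); [lra|].
  assert (Hx : exists x, E x /\ s - e < x).
  { apply Classical_Prop.NNPP; intros Hn.
    assert (s <= s - e); [|lra]. apply Hlub; intros x Hx.
    destruct (Rle_or_lt x (s - e)) as [|Hlt]; [assumption|]. exfalso; apply Hn; eauto. }
  destruct Hx as (x & (Hxab & ex & Hex & HQx) & Hxs).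
  assert (HE : forall y, a <= y <= b -> y < s + e -> exists e', 0 < e' /\ forall t, a <= t <= y -> Q t e').
  { intros y Hy Hys; exists (Rmin e ex); split; [now apply Rmin_glb_lt|].
    intros t Ht; destruct (Rle_or_lt t x) as [Htx | Htx].
    - apply Hmono with ex; [apply Rmin_r | apply HQx; lra].
    - apply Hmono with e; [apply Rmin_l | apply Hs, Rabs_def1; lra]. }
  destruct (Rlt_le_dec b (s + e)) as [Hb | Hb].
  - destruct (HE b) as (e' & He' & H); [lra | lra |]. now exists e'.
  - assert (s + e / 2 <= s); [|lra]. apply Hub. split; [lra|]. apply HE; lra.
Qed.

Definition in_box (a b c d : R) (z : R * R) : Prop := a <= fst z <= b /\ c <= snd z <= d.

(** The tube argument: [segment_uniform] in the second coordinate gives a radius valid on a vertical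
    strip about each [t], and is then applied in the first coordinate. *)
Lemma box_uniform (a b c d : R) (Q : R * R -> R -> Prop) :
  (forall z e e', e' <= e -> Q z e -> Q z e') ->
  (forall z, in_box a b c d z -> exists e, 0 < e /\ forall w, close e z w -> Q w e) ->
  exists e, 0 < e /\ forall z, in_box a b c d z -> Q z e.
Proof.
  intros Hmono Hloc.
  destruct (segment_uniform a b (fun t e => forall s, c <= s <= d -> Q (t, s) e)) as (e & He & H).
  - intros t e e' Hee H s Hs; eauto.
  - intros t Ht.
    destruct (segment_uniform c d (fun s e => forall t', Rabs (t' - t) < e -> Q (t', s) e)) as (e & He & H).
    + intros s e e' Hee H t' Ht'; apply Hmono with e; [assumption | apply H; lra].
    + intros s Hs; destruct (Hloc (t, s)) as (e & He & H); [now split|].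
      exists e; split; [assumption|]; intros s' Hs' t' Ht'; apply H; now split.
    + exists e; split; [assumption|]; intros t' Ht' s Hs; now apply H.
  - exists e; split; [assumption|]; intros [t s] [Ht Hs]; now apply H.
Qed.

(** * Lifting to the universal cover *)

Definition cont_fun (g : R * R -> R) : Prop :=
  forall z e, 0 < e -> exists d, 0 < d /\ forall w, close d z w -> Rabs (g w - g z) < e.

Definition cont_map (g : R * R -> R * R) : Prop :=
  forall z e, 0 < e -> exists d, 0 < d /\ forall w, close d z w -> close e (g z) (g w).

Lemma cont_map_fst g : cont_map g -> cont_fun (fun z => fst (g z)).
Proof.
  intros Hg z e He; destruct (Hg z e He) as (d & Hd & A); exists d; split; [assumption|].
  intros w Hw; now destruct (A w Hw).
Qed.

Lemma cont_map_snd g : cont_map g -> cont_fun (fun z => snd (g z)).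
Proof.
  intros Hg z e He; destruct (Hg z e He) as (d & Hd & A); exists d; split; [assumption|].
  intros w Hw; now destruct (A w Hw).
Qed.

Definition is_int (t : R) : Prop := exists k : Z, t = IZR k.

Lemma is_int_plus s t : is_int s -> is_int t -> is_int (s + t).
Proof. intros [k ->] [l ->]; exists (k + l)%Z; now rewrite plus_IZR. Qed.

Lemma is_int_opp s : is_int s -> is_int (- s).
Proof. intros [k ->]; exists (- k)%Z; now rewrite opp_IZR. Qed.

Lemma is_int_minus s t : is_int s -> is_int t -> is_int (s - t).
Proof. intros Hs Ht; apply is_int_plus; [|apply is_int_opp]; assumption. Qed.

Lemma is_int_IZR k : is_int (IZR k).
Proof. now exists k. Qed.

Lemma is_int_small t : is_int t -> Rabs t < 1 -> t = 0.
Proof.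
  intros [k ->] H. rewrite <- abs_IZR in H. apply lt_IZR in H.
  now replace k with 0%Z by lia.
Qed.

Lemma is_int_eq s t : is_int (s - t) -> Rabs (s - t) < 1 -> s = t.
Proof. intros H1 H2; pose proof (is_int_small _ H1 H2); lra. Qed.

(** Continuity modulo the integers, satisfied by the representative in [[0, 1)] of a continuous
    circle-valued map, which itself may jump. *)
Definition modcont (g : R * R -> R) : Prop :=
  forall z e, 0 < e -> exists d, 0 < d /\ forall w, close d z w ->
    exists k : Z, Rabs (g w - g z - IZR k) < e.

Lemma modcont_uniform g : modcont g -> forall r e, 0 < e ->
  exists d, 0 < d /\ forall z w, in_box (-r) r (-r) r z -> close d z w ->
    exists k : Z, Rabs (g w - g z - IZR k) < e.
Proof.
  intros Hg r e He.
  destruct (box_uniform (-r) r (-r) r (fun z d => forall w, close d z w ->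
    exists k : Z, Rabs (g w - g z - IZR k) < e)) as (d & Hd & H).
  - intros z d d' Hdd H w Hw; apply H; now apply close_mono with d'.
  - intros z Hz; destruct (Hg z (e / 2)) as (d & Hd & H); [lra|].
    exists (d / 2); split; [lra|]; intros z' Hz' w Hw.
    destruct (H z') as [k Hk]; [apply close_mono with (d / 2); [lra | assumption]|].
    destruct (H w) as [l Hl].
    { replace d with (d / 2 + d / 2) by lra; eapply close_trans; eassumption. }
    exists (l - k)%Z; rewrite minus_IZR. apply Rabs_def2 in Hk, Hl. apply Rabs_def1; lra.
  - exists d; split; [assumption|]; intros z w Hz; now apply H.
Qed.

(** The representative of [t] modulo 1 in [[-1/2, 1/2)], continuous at the values near integers that
    occur below. *)
Definition centred (t : R) : R := frac_part (t + 1 / 2) - 1 / 2.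

Lemma centred_int t : is_int (t - centred t).
Proof. exists (Int_part (t + 1 / 2)); unfold centred, frac_part; lra. Qed.

Lemma centred_eq t k : Rabs (t - IZR k) < 1 / 2 -> centred t = t - IZR k.
Proof.
  intros H. apply is_int_eq.
  - replace (centred t - (t - IZR k)) with (IZR k - (t - centred t)) by ring.
    apply is_int_minus; [apply is_int_IZR | apply centred_int].
  - destruct (base_fp (t + 1 / 2)); unfold centred. apply Rabs_def2 in H.
    apply Rabs_def1; lra.
Qed.

Definition scale (a : R) (z : R * R) : R * R := (a * fst z, a * snd z).

Lemma close_scale a d z w : 0 <= a <= 1 -> close d z w -> close d (scale a z) (scale a w).
Proof.
  intros Ha [H1 H2]; unfold scale; split; simpl.
  - replace (a * fst w - a * fst z) with (a * (fst w - fst z)) by ring.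
    rewrite Rabs_mult, (Rabs_pos_eq a) by lra.
    pose proof (Rabs_pos (fst w - fst z)); nra.
  - replace (a * snd w - a * snd z) with (a * (snd w - snd z)) by ring.
    rewrite Rabs_mult, (Rabs_pos_eq a) by lra.
    pose proof (Rabs_pos (snd w - snd z)); nra.
Qed.

Lemma scale_continuous z d : 0 < d -> exists e, 0 < e /\ forall t t', Rabs (t' - t) < e ->
  close d (scale t z) (scale t' z).
Proof.
  intros Hd. pose proof (Rabs_pos (fst z)) as A1; pose proof (Rabs_pos (snd z)) as A2.
  set (M := Rabs (fst z) + Rabs (snd z) + 1).
  assert (HM : 0 < M) by (unfold M; lra).
  assert (E : d / M * M = d) by (field; lra). unfold M at 2 in E.
  exists (d / M); split; [now apply Rdiv_lt_0_compat|]; intros t t' Htt.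
  pose proof (Rabs_pos (t' - t)).
  unfold scale; split; simpl; rewrite <- Rmult_minus_distr_r, Rabs_mult; nra.
Qed.

(** The ray from the origin towards [z] is sampled at multiples of [s], and the small
    representatives of the increments of [g] are added up. For samples close enough together this is
    the increment of a continuous lift along the ray. *)
Fixpoint winding (g : R * R -> R) (s : R) (n : nat) (z : R * R) : R :=
  match n with
  | O => 0
  | S n => winding g s n z +
      centred (g (scale (INR (S n) * s) z) - g (scale (INR n * s) z))
  end.

Lemma winding_int g s n z :
  is_int (g (scale (INR n * s) z) - g (scale 0 z) - winding g s n z).
Proof.
  induction n as [|n IH].
  - replace (INR 0 * s) with 0 by (simpl; ring). exists 0%Z; simpl; ring.
  - cbn [winding].
    pose proof (centred_int (g (scale (INR (S n) * s) z) - g (scale (INR n * s) z))) as H.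
    pose proof (is_int_plus _ _ IH H) as [k Hk]; exists k; lra.
Qed.

Lemma winding_cont g s n z : modcont g -> 0 <= s -> INR n * s <= 1 ->
  (forall j, (j < n)%nat -> exists k : Z,
     Rabs (g (scale (INR (S j) * s) z) - g (scale (INR j * s) z) - IZR k) < 1 / 4) ->
  forall e, 0 < e -> exists d, 0 < d /\ forall w, close d z w ->
    Rabs (winding g s n w - winding g s n z) < e.
Proof.
  intros Hg Hs; induction n as [|n IH]; intros Hn Hstep e He.
  - exists 1; split; [lra|]; intros w _; simpl; rewrite Rminus_diag, Rabs_R0; lra.
  - assert (Hn' : 0 <= INR n * s <= INR (S n) * s).
    { rewrite S_INR; pose proof (pos_INR n); split; nra. }
    destruct IH with (e := e / 2) as (d0 & Hd0 & H0);
      [lra | intros; apply Hstep; lia | lra |].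
    (* [1 / 16] keeps the perturbed increment within [1 / 4 + 2 / 16 < 1 / 2] of an integer, where
       [centred] subtracts a fixed integer; two errors [e / 4] complete the [e / 2] of the
       induction. *)
    set (m := Rmin (e / 4) (1 / 16)).
    assert (Hm : 0 < m /\ m <= e / 4 /\ m <= 1 / 16).
    { split; [apply Rmin_glb_lt; lra|]. split; [apply Rmin_l | apply Rmin_r]. }
    destruct (Hg (scale (INR n * s) z) m) as (d1 & Hd1 & H1); [lra|].
    destruct (Hg (scale (INR (S n) * s) z) m) as (d2 & Hd2 & H2); [lra|].
    exists (Rmin d0 (Rmin d1 d2)); split; [repeat apply Rmin_glb_lt; assumption|].
    intros w Hw.
    specialize (H0 w (close_mono _ _ _ _ (Rmin_l _ _) Hw)).
    assert (Hw' : close (Rmin d1 d2) z w) by (eapply close_mono; [apply Rmin_r | exact Hw]).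
    destruct (H1 (scale (INR n * s) w)) as [k1 Hk1].
    { apply close_scale; [lra|]; eapply close_mono; [apply Rmin_l | exact Hw']. }
    destruct (H2 (scale (INR (S n) * s) w)) as [k2 Hk2].
    { apply close_scale; [lra|]; eapply close_mono; [apply Rmin_r | exact Hw']. }
    destruct (Hstep n) as [k Hk]; [lia|].
    cbn [winding].
    rewrite (centred_eq (g (scale (INR (S n) * s) z) - _) k) by lra.
    apply Rabs_def2 in H0, Hk1, Hk2, Hk.
    rewrite (centred_eq _ (k + k2 - k1)) by
      (rewrite minus_IZR, plus_IZR; apply Rabs_def1; lra).
    rewrite minus_IZR, plus_IZR. apply Rabs_def1; lra.
Qed.

Lemma int_valued_constant (p : R -> R) :
  (forall t, 0 <= t <= 1 -> is_int (p t - p 0)) ->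
  (forall t, 0 <= t <= 1 -> exists d, 0 < d /\ forall t', 0 <= t' <= 1 ->
     Rabs (t' - t) < d -> Rabs (p t' - p t) < 1 / 2) ->
  forall t, 0 <= t <= 1 -> p t = p 0.
Proof.
  intros Hint Hc.
  destruct (segment_uniform 0 1 (fun t d => forall t', 0 <= t' <= 1 -> 0 <= t <= 1 ->
     Rabs (t' - t) < d -> Rabs (p t' - p t) < 1)) as (d & Hd & H).
  - intros t d d' Hdd H t' Ht' Ht Htt; apply H; auto; lra.
  - intros t Ht; destruct (Hc t Ht) as (d & Hd & H).
    exists (d / 2); split; [lra|]; intros t' Htt' s Hs Ht' Hst.
    assert (H1 : Rabs (p s - p t) < 1 / 2).
    { apply H; [assumption|]; apply Rabs_def2 in Htt', Hst; apply Rabs_def1; lra. }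
    assert (H2 : Rabs (p t' - p t) < 1 / 2) by (apply H; lra).
    apply Rabs_def2 in H1, H2; apply Rabs_def1; lra.
  - assert (Hstep : forall n t, 0 <= t <= 1 -> t <= INR n * (d / 2) -> p t = p 0).
    { induction n as [|n IH]; intros t Ht Htn.
      - simpl in Htn; now replace t with 0 by lra.
      - rewrite S_INR in Htn.
        destruct (Rle_or_lt t (d / 2)) as [Hsmall | Hbig].
        + apply is_int_eq; [now apply Hint|]. apply H; try lra. apply Rabs_def1; lra.
        + rewrite <- (IH (t - d / 2)) by lra. apply is_int_eq.
          * replace (p t - p (t - d / 2)) with ((p t - p 0) - (p (t - d / 2) - p 0)) by ring.
            apply is_int_minus; apply Hint; lra.
          * apply H; try lra. apply Rabs_def1; lra. }
    intros t Ht. destruct (INR_archimed (d / 2) 1) as [n Hn]; [lra|].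
    apply (Hstep n); lra.
Qed.

Lemma in_box_scale r a z : 0 <= a <= 1 -> in_box (-r) r (-r) r z -> in_box (-r) r (-r) r (scale a z).
Proof.
  intros Ha [H1 H2]; assert (0 <= r) by lra; unfold scale; split; simpl; split; nra.
Qed.

Lemma scale_0 z : scale 0 z = (0, 0).
Proof. unfold scale; f_equal; ring. Qed.

Lemma scale_1 z : scale 1 z = z.
Proof. destruct z; unfold scale; simpl; f_equal; ring. Qed.

(** The sampling step depends on the size of the box, so the lift is built box by box; the
    normalisation at the origin will make the pieces agree. *)
Lemma local_lift g r : modcont g -> exists G : R * R -> R,
  G (0, 0) = 0 /\
  forall z, in_box (-r) r (-r) r z ->
    is_int (G z + g (0, 0) - g z) /\
    forall e, 0 < e -> exists d, 0 < d /\ forall w, close d z w -> Rabs (G w - G z) < e.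
Proof.
  intros Hg.
  destruct (modcont_uniform g Hg r (1 / 4)) as (d & Hd & H); [lra|].
  destruct (INR_archimed d (Rabs r + 1)) as [n Hn]; [lra|].
  assert (Hn0 : 0 < INR n).
  { destruct n; [simpl in Hn; pose proof (Rabs_pos r); lra | apply lt_0_INR; lia]. }
  assert (Hs : 0 < / INR n) by now apply Rinv_0_lt_compat.
  assert (Hns : INR n * / INR n = 1) by (field; lra).
  exists (winding g (/ INR n) n); split.
  { assert (E : forall m, winding g (/ INR n) m (0, 0) = 0).
    { induction m as [|m IH]; cbn [winding]; [reflexivity|].
      rewrite IH; unfold scale; cbn [fst snd]; rewrite !Rmult_0_r.
      rewrite Rminus_diag, (centred_eq 0 0); [lra|]. rewrite Rminus_diag, Rabs_R0; lra. }
    apply E. }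
  intros z Hz.
  split.
  - pose proof (winding_int g (/ INR n) n z) as W.
    rewrite Hns, scale_0, scale_1 in W. apply is_int_opp in W as [k Hk]; exists k; lra.
  - apply winding_cont; [assumption | lra | lra |].
    intros j Hj.
    assert (Hj1 : INR (S j) <= INR n) by (apply le_INR; lia).
    assert (Hj2 : 0 <= INR j) by apply pos_INR.
    assert (Hja : 0 <= INR j * / INR n <= 1).
    { rewrite S_INR in Hj1; split; [nra|]. rewrite <- Hns; apply Rmult_le_compat_r; lra. }
    apply H; [now apply in_box_scale|].
    destruct Hz as [[Z1 Z2] [Z3 Z4]].
    assert (Hr : r * / INR n < d).
    { apply Rmult_lt_reg_r with (INR n); [assumption|].
      rewrite Rmult_assoc, Rinv_l by lra. pose proof (Rle_abs r); lra. }
    rewrite S_INR.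
    unfold scale; split; simpl; rewrite <- Rmult_minus_distr_r;
      replace ((INR j + 1) * / INR n - INR j * / INR n) with (/ INR n) by ring;
      apply Rabs_def1; nra.
Qed.

Lemma lift_exists g : modcont g ->
  exists G, cont_fun G /\ forall z, is_int (G z - g z).
Proof.
  intros Hg.
  destruct (choice (fun (r : nat) (G : R * R -> R) => G (0, 0) = 0 /\
    forall z, in_box (- INR r) (INR r) (- INR r) (INR r) z ->
    is_int (G z + g (0, 0) - g z) /\
    forall e, 0 < e -> exists d, 0 < d /\ forall w, close d z w -> Rabs (G w - G z) < e))
    as [G HG]; [intros r; now apply local_lift|].
  (* The difference of two such lifts is an integer, constant along the ray from the origin to [z],
     and it vanishes at the origin. *)
  assert (Hagree : forall r r' z, in_box (- INR r) (INR r) (- INR r) (INR r) z ->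
    in_box (- INR r') (INR r') (- INR r') (INR r') z -> G r z = G r' z).
  { intros r r' z Hz Hz'.
    pose (p := fun t => G r (scale t z) - G r' (scale t z)).
    assert (E : p 1 = p 0).
    { apply int_valued_constant; [| |lra].
      - intros t Ht; unfold p; rewrite scale_0.
        destruct (HG r) as [A1 A2]; destruct (HG r') as [B1 B2]. rewrite A1, B1.
        destruct (A2 (scale t z)) as [A _]; [now apply in_box_scale|].
        destruct (B2 (scale t z)) as [B _]; [now apply in_box_scale|].
        destruct (is_int_minus _ _ A B) as [k Hk]; exists k; lra.
      - intros t Ht.
        destruct (HG r) as [A1 A2]; destruct (HG r') as [B1 B2].
        destruct (A2 (scale t z)) as [_ A]; [now apply in_box_scale|].
        destruct (B2 (scale t z)) as [_ B]; [now apply in_box_scale|].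
        destruct (A (1 / 4)) as (d1 & Hd1 & C1); [lra|].
        destruct (B (1 / 4)) as (d2 & Hd2 & C2); [lra|].
        destruct (scale_continuous z (Rmin d1 d2)) as (e & He & Hs); [now apply Rmin_glb_lt|].
        exists e; split; [assumption|]; intros t' Ht' Htt.
        assert (Hc : close (Rmin d1 d2) (scale t z) (scale t' z)) by now apply Hs.
        specialize (C1 _ (close_mono _ _ _ _ (Rmin_l _ _) Hc)).
        specialize (C2 _ (close_mono _ _ _ _ (Rmin_r _ _) Hc)).
        unfold p; apply Rabs_def2 in C1, C2; apply Rabs_def1; lra. }
    unfold p in E; rewrite scale_0, scale_1 in E.
    destruct (HG r) as [A1 _]; destruct (HG r') as [B1 _]; lra. }
  pose (radius := fun z : R * R => Z.to_nat (up (Rabs (fst z) + Rabs (snd z)))).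
  assert (Hrad : forall (r : nat) z, Rabs (fst z) <= INR r -> Rabs (snd z) <= INR r ->
    in_box (- INR r) (INR r) (- INR r) (INR r) z).
  { intros r z H1 H2. pose proof (Rle_abs (fst z)); pose proof (Rle_abs (snd z)).
    pose proof (Rle_abs (- fst z)); pose proof (Rle_abs (- snd z)).
    rewrite Rabs_Ropp in *. split; lra. }
  assert (Hradius : forall z, in_box (- INR (radius z)) (INR (radius z)) (- INR (radius z)) (INR (radius z)) z).
  { intros z. pose proof (Rabs_pos (fst z)); pose proof (Rabs_pos (snd z)).
    destruct (archimed (Rabs (fst z) + Rabs (snd z))) as [U _].
    assert (Hup : (0 <= up (Rabs (fst z) + Rabs (snd z)))%Z) by (apply le_IZR; lra).
    apply Hrad; unfold radius; rewrite INR_IZR_INZ, Z2Nat.id by assumption; lra. }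
  exists (fun z => G (radius z) z + g (0, 0)); split.
  - intros z e He.
    destruct (INR_archimed 1 (Rabs (fst z) + Rabs (snd z) + 1)) as [r Hr]; [lra|].
    rewrite Rmult_1_r in Hr.
    pose proof (Rabs_pos (fst z)); pose proof (Rabs_pos (snd z)).
    assert (Hz : in_box (- INR r) (INR r) (- INR r) (INR r) z) by (apply Hrad; lra).
    destruct (HG r) as [_ A]; destruct (A z Hz) as [_ C]; destruct (C e He) as (d & Hd & D).
    exists (Rmin d 1); split; [apply Rmin_glb_lt; lra|]; intros w Hw.
    assert (Hwr : in_box (- INR r) (INR r) (- INR r) (INR r) w).
    { destruct (close_mono _ _ _ _ (Rmin_r d 1) Hw) as [W1 W2].
      pose proof (Rabs_triang_inv (fst w) (fst z)); pose proof (Rabs_triang_inv (snd w) (snd z)).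
      apply Hrad; lra. }
    rewrite (Hagree _ r w), (Hagree _ r z) by auto.
    replace (G r w + g (0, 0) - (G r z + g (0, 0))) with (G r w - G r z) by ring.
    apply D; eapply close_mono; [apply Rmin_l | exact Hw].
  - intros z. destruct (HG (radius z)) as [_ A]; now destruct (A z (Hradius z)) as [I _].
Qed.

(** * The circle and the torus *)

Lemma S1_eq (s s' : S1) : proj1_sig s = proj1_sig s' -> s = s'.
Proof.
  destruct s as [t Ht], s' as [t' Ht']; simpl; intros ->. f_equal; apply proof_irrelevance.
Qed.

Lemma frac_part_int t : is_int (t - frac_part t).
Proof. exists (Int_part t); unfold frac_part; ring. Qed.

Lemma piS_eq t s : piS t = piS s <-> is_int (t - s).
Proof.
  split.
  - intros H; apply (f_equal (@proj1_sig _ _)) in H; simpl in H.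
    destruct (is_int_minus _ _ (frac_part_int t) (frac_part_int s)) as [k Hk]; exists k; lra.
  - intros H; apply S1_eq; simpl. apply is_int_eq.
    + pose proof (is_int_minus _ _ H (is_int_minus _ _ (frac_part_int t) (frac_part_int s))) as [k Hk].
      exists k; lra.
    + destruct (base_fp t), (base_fp s); apply Rabs_def1; lra.
Qed.

Lemma piS_proj s : piS (proj1_sig s) = s.
Proof.
  apply S1_eq; simpl. destruct s as [t Ht]; simpl. apply is_int_eq.
  - destruct (frac_part_int t) as [k Hk]; exists (- k)%Z; rewrite opp_IZR; lra.
  - destruct (base_fp t); apply Rabs_def1; lra.
Qed.

Lemma proj_piS t : is_int (proj1_sig (piS t) - t).
Proof. simpl; destruct (frac_part_int t) as [k Hk]; exists (- k)%Z; rewrite opp_IZR; lra. Qed.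

Definition int_vec (z : R * R) : Prop := is_int (fst z) /\ is_int (snd z).

Definition vadd (z w : R * R) : R * R := (fst z + fst w, snd z + snd w).
Definition vsub (z w : R * R) : R * R := (fst z - fst w, snd z - snd w).

Lemma piT_eq z w : piT z = piT w <-> int_vec (vsub z w).
Proof.
  unfold piT, int_vec, vsub; simpl; split.
  - intros H; injection H as H1 H2. 
    split; apply piS_eq; apply S1_eq; assumption.
  - intros [H1%piS_eq H2%piS_eq]; now rewrite H1, H2.
Qed.

Lemma piT_surj x : exists z, piT z = x.
Proof.
  destruct x as [s s']; exists (proj1_sig s, proj1_sig s').
  unfold piT; simpl; now rewrite !piS_proj.
Qed.

Lemma continuous_cont_map F : continuous (X := R2_top) (Y := R2_top) F <-> cont_map F.
Proof.
  split.
  - intros HF z e He.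
    destruct (HF (fun w => close e (F z) w)) with (z := z) as (d & Hd & H).
    + intros w Hw. destruct (close_slack _ _ _ Hw) as (d & Hd & H).
      exists d; split; [assumption|]; intros u U1 U2; now apply H.
    + now apply close_refl.
    + exists d; split; [assumption|]; intros w [Hw1 Hw2]; now apply H.
  - intros HF V HV z Hz. destruct (HV _ Hz) as (e & He & HVe).
    destruct (HF z e He) as (d & Hd & H). exists d; split; [assumption|].
    intros w H1 H2; destruct (H w) as [C1 C2]; [now split|]. now apply HVe.
Qed.

Definition arc (t0 e : R) : S1 -> Prop := fun s => exists t, piS t = s /\ Rabs (t - t0) < e.

Lemma arc_open t0 e : is_open S1_top (arc t0 e).
Proof.
  intros t (t1 & E & Ht1). exists (e - Rabs (t1 - t0)); split; [lra|].
  intros t' Ht'. exists (t1 + (t' - t)); split.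
  - apply piS_eq; apply piS_eq in E as [k Hk]; exists k; lra.
  - replace (t1 + (t' - t) - t0) with ((t' - t) + (t1 - t0)) by ring.
    eapply Rle_lt_trans; [apply Rabs_triang | lra].
Qed.

Lemma modcont_of_continuous (q : R * R -> S1) :
  continuous (X := R2_top) (Y := S1_top) q -> modcont (fun z => proj1_sig (q z)).
Proof.
  intros Hq z e He.
  destruct (Hq (arc (proj1_sig (q z)) e) (arc_open _ _) z) as (d & Hd & H).
  - exists (proj1_sig (q z)); split; [apply piS_proj | rewrite Rminus_diag, Rabs_R0; assumption].
  - exists d; split; [assumption|]; intros w [W1 W2].
    destruct (H w W1 W2) as (t & Et & Ht).
    rewrite <- (piS_proj (q w)) in Et; apply piS_eq in Et as [k Hk].
    exists (- k)%Z; rewrite opp_IZR.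
    replace (proj1_sig (q w) - proj1_sig (q z) - - IZR k) with (t - proj1_sig (q z)) by lra.
    exact Ht.
Qed.

Lemma lift_circle (q : R * R -> S1) : continuous (X := R2_top) (Y := S1_top) q ->
  exists G, cont_fun G /\ forall z, piS (G z) = q z.
Proof.
  intros Hq; destruct (lift_exists _ (modcont_of_continuous q Hq)) as (G & HG & E).
  exists G; split; [assumption|]; intros z. rewrite <- (piS_proj (q z)); now apply piS_eq.
Qed.

Lemma continuous_fst_T2 : continuous (X := T2_top) (Y := S1_top) fst.
Proof.
  intros V HV z Hz. destruct (HV _ Hz) as (e & He & H).
  exists e; split; [assumption|]; intros w W1 _; now apply H.
Qed.

Lemma continuous_snd_T2 : continuous (X := T2_top) (Y := S1_top) snd.
Proof.
  intros V HV z Hz. destruct (HV _ Hz) as (e & He & H).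
  exists e; split; [assumption|]; intros w _ W2; now apply H.
Qed.

Lemma continuous_piT : continuous (X := R2_top) (Y := T2_top) piT.
Proof. intros V HV; exact HV. Qed.

Lemma continuous_comp {X Y Z : Top} (f : X -> Y) (g : Y -> Z) :
  continuous f -> continuous g -> continuous (fun x => g (f x)).
Proof. intros Hf Hg V HV; exact (Hf _ (Hg _ HV)). Qed.

Lemma lift_torus (q : R * R -> T2) : continuous (X := R2_top) (Y := T2_top) q ->
  exists G, cont_map G /\ forall z, piT (G z) = q z.
Proof.
  intros Hq.
  destruct (lift_circle (fun z => fst (q z))) as (G1 & C1 & E1).
  { exact (continuous_comp (X := R2_top) (Y := T2_top) (Z := S1_top) q fst Hq continuous_fst_T2). }
  destruct (lift_circle (fun z => snd (q z))) as (G2 & C2 & E2).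
  { exact (continuous_comp (X := R2_top) (Y := T2_top) (Z := S1_top) q snd Hq continuous_snd_T2). }
  exists (fun z => (G1 z, G2 z)); split.
  - intros z e He. destruct (C1 z e He) as (d1 & Hd1 & H1); destruct (C2 z e He) as (d2 & Hd2 & H2).
    exists (Rmin d1 d2); split; [now apply Rmin_glb_lt|]; intros w Hw; split; simpl.
    + apply H1; eapply close_mono; [apply Rmin_l | exact Hw].
    + apply H2; eapply close_mono; [apply Rmin_r | exact Hw].
  - intros z; unfold piT; simpl; rewrite E1, E2; now destruct (q z).
Qed.

Lemma int_valued_constant2 (p : R * R -> R) : cont_fun p -> (forall z, is_int (p z)) ->
  forall z w, p z = p w.
Proof.
  intros Hp Hi z w.
  set (v := (fst z - fst w, snd z - snd w)).
  pose (path := fun t => (fst w + fst (scale t v), snd w + snd (scale t v))).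
  assert (E : p (path 1) = p (path 0)).
  { apply (int_valued_constant (fun t => p (path t))); [| |lra].
    - intros t _; now apply is_int_minus.
    - intros t _. destruct (Hp (path t) (1 / 2)) as (d & Hd & H); [lra|].
      destruct (scale_continuous v d Hd) as (e & He & Hs).
      exists e; split; [assumption|]; intros t' _ Htt; apply H.
      destruct (Hs t t' Htt) as [S1 S2]. split; cbn [fst snd path].
      + now replace (_ - _) with (fst (scale t' v) - fst (scale t v)) by ring.
      + now replace (_ - _) with (snd (scale t' v) - snd (scale t v)) by ring. }
  unfold path in E; rewrite scale_0, scale_1 in E. unfold v in E; cbn [fst snd] in E.
  rewrite !Rplus_0_r, !Rplus_minus in E.
  now destruct z, w.
Qed.

(** * Level sets of a height function on the plane *)

Definition tr (k : Z) (z : R * R) : R * R := (fst z + IZR k, snd z).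

Lemma tr_tr k l z : tr k (tr l z) = tr (l + k) z.
Proof. unfold tr; simpl; rewrite plus_IZR; f_equal; ring. Qed.

Lemma tr_0 z : tr 0 z = z.
Proof. destruct z; unfold tr; simpl; f_equal; ring. Qed.

Lemma close_tr k d z w : close d z w -> close d (tr k z) (tr k w).
Proof.
  intros [H1 H2]; unfold tr; split; simpl; [|assumption].
  now replace (fst w + IZR k - (fst z + IZR k)) with (fst w - fst z) by ring.
Qed.

Lemma segment_chain d P z w : 0 < d ->
  (forall t, 0 <= t <= 1 -> P (fst z + t * (fst w - fst z), snd z + t * (snd w - snd z))) ->
  chain d P z w.
Proof.
  intros Hd HP.
  pose proof (Rabs_pos (fst w - fst z)) as A1; pose proof (Rabs_pos (snd w - snd z)) as A2.
  destruct (INR_archimed d (Rabs (fst w - fst z) + Rabs (snd w - snd z))) as [n Hn]; [assumption|].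
  assert (Hn0 : 0 < INR n) by (destruct n; [simpl in Hn; lra | apply lt_0_INR; lia]).
  pose (pt := fun j => (fst z + INR j / INR n * (fst w - fst z), snd z + INR j / INR n * (snd w - snd z))).
  assert (Hpt : forall j, (j <= n)%nat -> P (pt j)).
  { intros j Hj; apply HP. apply le_INR in Hj; pose proof (pos_INR j); split.
    - apply Rmult_le_pos; [assumption|]; left; now apply Rinv_0_lt_compat.
    - apply Rmult_le_reg_r with (INR n); [assumption|]. field_simplify; lra. }
  assert (Hc : forall j, (j <= n)%nat -> chain d P (pt O) (pt j)).
  { induction j as [|j IH]; intros Hj; [apply chain_refl, Hpt; lia|].
    apply chain_trans with (pt j); [apply IH; lia|].
    apply chain_step with (pt (S j)); [apply Hpt; lia | | apply chain_refl, Hpt; lia].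
    assert (Hstep : forall v, Rabs v < INR n * d -> Rabs (/ INR n * v) < d).
    { intros v Hv. rewrite Rabs_mult, (Rabs_pos_eq (/ INR n)) by (left; now apply Rinv_0_lt_compat).
      apply Rmult_lt_reg_l with (INR n); [assumption|].
      rewrite <- Rmult_assoc, Rinv_r by lra. lra. }
    unfold pt; split; cbn [fst snd]; rewrite S_INR.
    - replace (_ - _) with (/ INR n * (fst w - fst z)) by (field; lra). apply Hstep; lra.
    - replace (_ - _) with (/ INR n * (snd w - snd z)) by (field; lra). apply Hstep; lra. }
  specialize (Hc n (le_n n)). unfold pt in Hc.
  replace (INR 0 / INR n) with 0 in Hc by (simpl; field; lra).
  replace (INR n / INR n) with 1 in Hc by (field; lra).
  rewrite !Rmult_0_l, !Rmult_1_l, !Rplus_0_r, !Rplus_minus in Hc. now destruct z, w.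
Qed.

Lemma convex_lt a b e t : 0 <= t <= 1 -> a < e -> b < e -> a + t * (b - a) < e.
Proof. intros Ht Ha Hb; destruct (Rle_or_lt t (1 / 2)); nra. Qed.

Lemma close_segment e p z w t : 0 <= t <= 1 -> close e p z -> close e p w ->
  close e p (fst z + t * (fst w - fst z), snd z + t * (snd w - snd z)).
Proof.
  intros Ht [A1 A2] [B1 B2]. apply Rabs_def2 in A1, A2, B1, B2.
  split; simpl; apply Rabs_def1.
  - pose proof (convex_lt (fst z) (fst w) (fst p + e) t Ht); lra.
  - pose proof (convex_lt (- fst z) (- fst w) (e - fst p) t Ht); lra.
  - pose proof (convex_lt (snd z) (snd w) (snd p + e) t Ht); lra.
  - pose proof (convex_lt (- snd z) (- snd w) (e - snd p) t Ht); lra.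
Qed.

Lemma exists_nat_above (x : R) : exists n : nat, x < INR n.
Proof. destruct (INR_archimed 1 x) as [n Hn]; [lra|]; exists n; lra. Qed.

Lemma exists_int_below (x : R) : exists k : Z, 0 <= x + IZR k < 1.
Proof.
  exists (- Int_part x)%Z; rewrite opp_IZR. destruct (base_fp x) as [H1 H2].
  unfold frac_part in *; lra.
Qed.

(** Integer translations change [p] by constants, so the modulus of continuity found on the unit
    square serves the whole plane. *)
Lemma equivariant_uniform (p : R * R -> R) : cont_fun p ->
  (forall k l : Z, exists s, forall z, p (fst z + IZR k, snd z + IZR l) = p z + s) ->
  forall e, 0 < e -> exists d, 0 < d /\ forall z w, close d z w -> Rabs (p w - p z) < e.
Proof.
  intros Hp Heq e He.
  destruct (box_uniform 0 1 0 1 (fun z d => forall w, close d z w -> Rabs (p w - p z) < e)) as (d & Hd & A).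
  - intros z d d' Hdd B w Hw; apply B; now apply close_mono with d'.
  - intros z _; destruct (Hp z (e / 2)) as (d & Hd & B); [lra|].
    exists (d / 2); split; [lra|]; intros z' Hz' w Hw.
    assert (B1 : Rabs (p z' - p z) < e / 2) by (apply B; apply close_mono with (d / 2); [lra | assumption]).
    assert (B2 : Rabs (p w - p z) < e / 2).
    { apply B; replace d with (d / 2 + d / 2) by lra; eapply close_trans; eassumption. }
    apply Rabs_def2 in B1, B2; apply Rabs_def1; lra.
  - exists d; split; [assumption|]; intros z w [C1 C2].
    destruct (exists_int_below (fst z)) as [k Hk]; destruct (exists_int_below (snd z)) as [l Hl].
    destruct (Heq k l) as [s Hs].
    specialize (A (fst z + IZR k, snd z + IZR l)).
    specialize (A ltac:(split; simpl; lra) (fst w + IZR k, snd w + IZR l)).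
    rewrite !Hs in A. replace (p w - p z) with (p w + s - (p z + s)) by ring.
    apply A; split; simpl.
    + now replace (fst w + IZR k - (fst z + IZR k)) with (fst w - fst z) by ring.
    + now replace (snd w + IZR l - (snd z + IZR l)) with (snd w - snd z) by ring.
Qed.

Definition zperiodic (p : R * R -> R) : Prop :=
  forall z k l, p (fst z + IZR k, snd z + IZR l) = p z.

Lemma zperiodic_bounded p : cont_fun p -> zperiodic p -> exists K, forall z, Rabs (p z) <= K.
Proof.
  intros Hp Hper.
  (* The bound is encoded by its reciprocal [e], so that it fits the shape of [box_uniform]. *)
  destruct (box_uniform 0 1 0 1 (fun z e => 0 < e -> Rabs (p z) * e <= 1)) as (e & He & A).
  - intros z e e' Hee A He'. specialize (A ltac:(lra)). pose proof (Rabs_pos (p z)); nra.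
  - intros z _. destruct (Hp z 1) as (d & Hd & A); [lra|].
    pose proof (Rabs_pos (p z)).
    exists (Rmin d (/ (Rabs (p z) + 1))). split.
    { apply Rmin_glb_lt; [assumption|]. apply Rinv_0_lt_compat; lra. }
    intros w Hw He. specialize (A _ (close_mono _ _ _ _ (Rmin_l _ _) Hw)).
    pose proof (Rabs_triang_inv (p w) (p z)).
    pose proof (Rmin_r d (/ (Rabs (p z) + 1))) as M.
    apply Rle_trans with ((Rabs (p z) + 1) * / (Rabs (p z) + 1)); [|rewrite Rinv_r; lra].
    apply Rmult_le_compat; try apply Rabs_pos; lra.
  - exists (/ e); intros z.
    destruct (exists_int_below (fst z)) as [k Hk]; destruct (exists_int_below (snd z)) as [l Hl].
    specialize (A (fst z + IZR k, snd z + IZR l) ltac:(split; simpl; lra) He).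
    rewrite Hper in A. apply Rmult_le_reg_r with e; [assumption|]. rewrite Rinv_l by lra. exact A.
Qed.

(** What is kept of the semiconjugacy after lifting and change of basis. [height_fibre] is the
    connectedness of a fibre, seen in the plane: a chain in the torus reaches [w] only up to a deck
    transformation, which is horizontal because the level is preserved; [m] may depend on [d]. *)
Record height (H : R * R -> R) : Prop := {
  height_cont : cont_fun H;
  height_x : forall x y, H (x + 1, y) = H (x, y);
  height_y : forall x y, H (x, y + 1) = H (x, y) + 1;
  height_fibre : forall d z w, 0 < d -> H z = H w ->
    exists m, chain d (fun u => H u = H z) z (tr m w) }.

Section Height.
Variable (H : R * R -> R).
Hypothesis (HH : height H).

Lemma height_tr k z : H (tr k z) = H z.
Proof.
  assert (Hn : forall n z, H (tr (Z.of_nat n) z) = H z).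
  { induction n as [|n IH]; intros u; [now rewrite tr_0|].
    rewrite Nat2Z.inj_succ, <- Z.add_1_r, <- (tr_tr 1 (Z.of_nat n)), <- (IH u).
    now apply height_x. }
  destruct (Z_le_gt_dec 0 k) as [Hk | Hk].
  - rewrite <- (Z2Nat.id k) by assumption; apply Hn.
  - rewrite <- (Hn (Z.to_nat (- k)) (tr k z)), tr_tr, Z2Nat.id by lia.
    replace (k + - k)%Z with 0%Z by lia. now rewrite tr_0.
Qed.

Lemma height_up (k : Z) x y : H (x, y + IZR k) = H (x, y) + IZR k.
Proof.
  assert (Hn : forall n x y, H (x, y + INR n) = H (x, y) + INR n).
  { induction n as [|n IH]; intros u v; [simpl; rewrite !Rplus_0_r; reflexivity|].
    rewrite S_INR, <- Rplus_assoc, height_y, IH by assumption; ring. }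
  destruct (Z_le_gt_dec 0 k) as [Hk | Hk].
  - rewrite <- (Z2Nat.id k), <- INR_IZR_INZ by assumption; apply Hn.
  - assert (E : IZR k = - INR (Z.to_nat (- k))).
    { rewrite INR_IZR_INZ, Z2Nat.id, opp_IZR by lia; ring. }
    rewrite E. pose proof (Hn (Z.to_nat (- k)) x (y + - INR (Z.to_nat (- k)))) as A.
    replace (y + - INR (Z.to_nat (- k)) + INR (Z.to_nat (- k))) with y in A by ring. lra.
Qed.

Lemma height_translate (k l : Z) z : H (fst z + IZR k, snd z + IZR l) = H z + IZR l.
Proof. rewrite height_up. apply (f_equal (fun t => t + IZR l)), (height_tr k z). Qed.

Lemma height_uniform e : 0 < e -> exists d, 0 < d /\ forall z w, close d z w -> Rabs (H w - H z) < e.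
Proof.
  apply equivariant_uniform; [apply (height_cont H HH)|].
  intros k l; exists (IZR l); apply height_translate.
Qed.

Lemma height_bounded : exists B, 0 < B /\ forall z, Rabs (H z - snd z) <= B.
Proof.
  destruct (zperiodic_bounded (fun z => H z - snd z)) as [K HK].
  - intros z e He. destruct (height_cont H HH z (e / 2)) as (d & Hd & A); [lra|].
    exists (Rmin d (e / 2)); split; [apply Rmin_glb_lt; lra|]; intros w Hw.
    specialize (A w (close_mono _ _ _ _ (Rmin_l _ _) Hw)).
    destruct (close_mono _ _ _ _ (Rmin_r _ _) Hw) as [_ B].
    apply Rabs_def2 in A, B; apply Rabs_def1; lra.
  - intros z k l. rewrite height_translate; simpl; ring.
  - exists (Rabs K + 1); split; [pose proof (Rabs_pos K); lra|].
    intros z; pose proof (Rle_abs K); specialize (HK z); lra.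
Qed.

Lemma level_strip c : exists Y, forall z, Rabs (H z - c) < 1 -> - Y < snd z < Y.
Proof.
  destruct height_bounded as (B & _ & Hb). exists (Rabs c + 1 + B); intros z Hz.
  specialize (Hb z). apply Rabs_def2 in Hz.
  pose proof (Rle_abs (H z - snd z)); pose proof (Rle_abs (- (H z - snd z))).
  pose proof (Rle_abs c); pose proof (Rle_abs (- c)); rewrite Rabs_Ropp in *. lra.
Qed.

(** Used to show that conditions quantified over the points of a level are open in the level: near a
    point off the level they are vacuous. *)
Lemma level_avoided c z : H z <> c -> exists e, 0 < e /\ forall w c', close e z w ->
  Rabs (c' - c) < e -> H w <> c'.
Proof.
  intros Hz. set (g := Rabs (H z - c)).
  assert (Hg : 0 < g) by (apply Rabs_pos_lt; lra).
  destruct (height_cont H HH z (g / 2)) as (d & Hd & A); [lra|].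
  exists (Rmin d (g / 2)); split; [apply Rmin_glb_lt; lra|]; intros w c' Hw Hc' <-.
  specialize (A w (close_mono _ _ _ _ (Rmin_l _ _) Hw)). pose proof (Rmin_r d (g / 2)).
  pose proof (Rabs_triang (H z - H w) (H w - c)) as Ht.
  replace (H z - H w + (H w - c)) with (H z - c) in Ht by ring.
  rewrite (Rabs_minus_sym (H z) (H w)) in Ht. fold g in Ht; lra.
Qed.

(** The supremum of the heights where [H <= c]. Taking the last crossing makes the vertical ray
    above it usable for climbing. *)
Lemma last_crossing x c : exists y, H (x, y) = c /\ forall y', y < y' -> c < H (x, y').
Proof.
  destruct height_bounded as (B & HB & Hb).
  destruct (completeness (fun y => H (x, y) <= c)) as [s [Hub Hlub]].
  - exists (c + B); intros y Hy; specialize (Hb (x, y)); simpl in Hb.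
    pose proof (Rle_abs (- (H (x, y) - y))); rewrite Rabs_Ropp in *; lra.
  - exists (c - B). specialize (Hb (x, c - B)); simpl in Hb.
    pose proof (Rle_abs (H (x, c - B) - (c - B))); lra.
  - assert (Hs : forall y', s < y' -> c < H (x, y')).
    { intros y' Hy'; destruct (Rlt_le_dec c (H (x, y'))) as [|Hle]; [assumption|].
      specialize (Hub y' Hle); lra. }
    exists s; split; [|assumption].
    apply Rle_antisym; apply Rnot_lt_le; intros Hlt.
    + destruct (height_cont H HH (x, s) (H (x, s) - c)) as (d & Hd & A); [lra|].
      assert (s <= s - d / 2); [|lra].
      apply Hlub; intros y Hy. specialize (Hub y Hy). apply Rnot_lt_le; intros Hys.
      specialize (A (x, y)). simpl in A.
      assert (Hc : close d (x, s) (x, y)).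
      { split; simpl; apply Rabs_def1; lra. }
      specialize (A Hc); apply Rabs_def2 in A; lra.
    + destruct (height_cont H HH (x, s) (c - H (x, s))) as (d & Hd & A); [lra|].
      specialize (Hs (s + d / 2) ltac:(lra)).
      assert (Hc : close d (x, s) (x, s + d / 2)).
      { split; simpl; apply Rabs_def1; lra. }
      specialize (A _ Hc); apply Rabs_def2 in A; lra.
Qed.

Lemma climb q d Y : 0 < d -> exists p, Y < snd p /\ chain d (fun u => H q <= H u) q p.
Proof.
  intros Hd. destruct (last_crossing 0 (H q)) as (y & Hy & Hup).
  destruct (height_fibre H HH d q (0, y) Hd (eq_sym Hy)) as (m & Hc).
  set (y1 := Rmax y Y + 1).
  assert (Hy1 : y < y1 /\ Y < y1) by (unfold y1; pose proof (Rmax_l y Y); pose proof (Rmax_r y Y); lra).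
  exists (tr m (0, y1)); split; [simpl; lra|].
  apply chain_trans with (tr m (0, y)).
  - revert Hc; apply chain_mono; intros; lra.
  - apply segment_chain; [assumption|]; intros t Ht; unfold tr; simpl.
    change (_, _) with (0 + IZR m + t * (0 + IZR m - (0 + IZR m)), y + t * (y1 - y)).
    replace (0 + IZR m + t * (0 + IZR m - (0 + IZR m))) with (0 + IZR m) by ring.
    change (0 + IZR m, y + t * (y1 - y)) with (tr m (0, y + t * (y1 - y))).
    rewrite height_tr. destruct (Rle_lt_or_eq_dec 0 t) as [Hpos | Hz]; [lra | |].
    + left; apply Hup; nra.
    + rewrite <- Hz, Rmult_0_l, Rplus_0_r, Hy; lra.
Qed.
End Height.

Definition flip (z : R * R) : R * R := (fst z, - snd z).

Lemma flip_flip z : flip (flip z) = z.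
Proof. destruct z; unfold flip; simpl; f_equal; ring. Qed.

Lemma close_flip d z w : close d z w -> close d (flip z) (flip w).
Proof.
  intros [H1 H2]; split; simpl; [assumption|].
  replace (- snd w - - snd z) with (- (snd w - snd z)) by ring. now rewrite Rabs_Ropp.
Qed.

(** Reflection exchanges top and bottom, so that [descend] reduces to [climb]. *)
Lemma height_flip H : height H -> height (fun z => - H (flip z)).
Proof.
  intros HH; split.
  - intros z e He; destruct (height_cont H HH (flip z) e He) as (d & Hd & A).
    exists d; split; [assumption|]; intros w Hw. specialize (A _ (close_flip _ _ _ Hw)).
    replace (- H (flip w) - - H (flip z)) with (- (H (flip w) - H (flip z))) by ring.
    now rewrite Rabs_Ropp.
  - intros x y; unfold flip; simpl; now rewrite height_x.
  - intros x y; unfold flip; simpl.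
    pose proof (height_y H HH x (- (y + 1))) as A.
    replace (- (y + 1) + 1) with (- y) in A by ring. lra.
  - intros d z w Hd E.
    destruct (height_fibre H HH d (flip z) (flip w) Hd ltac:(lra)) as [m Hc].
    exists m.
    assert (Hc' : chain d (fun u => - H (flip u) = - H (flip z)) (flip (flip z)) (flip (tr m (flip w)))).
    { revert Hc; apply chain_map.
      - intros u Hu; now rewrite flip_flip, Hu.
      - intros u v _ _; apply close_flip. }
    rewrite flip_flip in Hc'. replace (tr m w) with (flip (tr m (flip w))); [assumption|].
    destruct w; unfold tr, flip; simpl; f_equal; ring.
Qed.

Lemma descend H q d Y : height H -> 0 < d ->
  exists p, snd p < - Y /\ chain d (fun u => H u <= H q) q p.
Proof.
  intros HH Hd.
  destruct (climb _ (height_flip H HH) (flip q) d Y Hd) as (p & Hp & Hc).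
  exists (flip p); split; [simpl; lra|].
  assert (Hc' : chain d (fun u => H u <= H q) (flip (flip q)) (flip p)).
  { revert Hc; apply chain_map.
    - intros u Hu; rewrite flip_flip in Hu; lra.
    - intros u v _ _; apply close_flip. }
  now rewrite flip_flip in Hc'.
Qed.

Definition regular (H : R * R -> R) (c : R) : Prop := forall p, H p = c -> forall r, 0 < r ->
  (exists q, close r p q /\ c < H q) /\ (exists q, close r p q /\ H q < c).

(* The point [p] is joined to [-oo] inside [H < c] and to [+oo] inside [H > c], up to a small
   ball around [p]; a chain near the level [c] going from far left to far right has to cross this
   bottom-to-top chain, which is only possible inside that ball. *)
Lemma regular_level_crossing H c p r : height H -> regular H c -> H p = c -> 0 < r ->
  exists d0, 0 < d0 /\ forall d, 0 < d -> d <= d0 -> exists X, forall (P : R * R -> Prop) z w,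
    chain d (fun u => P u /\ Rabs (H u - c) < d) z w -> fst z <= - X -> X <= fst w ->
    exists u, P u /\ close r p u.
Proof.
  intros HH Hreg Hp Hr.
  destruct (Hreg p Hp (r / 2)) as [(q1 & C1 & Q1) (q2 & C2 & Q2)]; [lra|].
  set (eta := Rmin (H q1 - c) (c - H q2)).
  assert (Heta : 0 < eta /\ eta <= H q1 - c /\ eta <= c - H q2).
  { split; [apply Rmin_glb_lt; lra|]; split; [apply Rmin_l | apply Rmin_r]. }
  destruct (height_uniform H HH (eta / 2)) as (d1 & Hd1 & U); [lra|].
  destruct (level_strip H HH c) as [Y HY].
  (* For [d <= d0]: [2 d <= d1] makes [H] vary by less than [eta / 2] at the crossing,
     [d <= eta / 2] then excludes a crossing outside the ball, [2 d <= r / 2] keeps the crossing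
     within [r] of [p], and [d <= 1] keeps the chain in the strip of height [Y]. *)
  set (d0 := Rmin (Rmin (d1 / 2) (eta / 2)) (Rmin (r / 4) 1)).
  exists d0; split; [repeat apply Rmin_glb_lt; lra|]; intros d Hd Hdd.
  assert (D : d <= d1 / 2 /\ d <= eta / 2 /\ d <= r / 4 /\ d <= 1).
  { pose proof (Rmin_l (Rmin (d1 / 2) (eta / 2)) (Rmin (r / 4) 1)).
    pose proof (Rmin_r (Rmin (d1 / 2) (eta / 2)) (Rmin (r / 4) 1)).
    pose proof (Rmin_l (d1 / 2) (eta / 2)); pose proof (Rmin_r (d1 / 2) (eta / 2)).
    pose proof (Rmin_l (r / 4) 1); pose proof (Rmin_r (r / 4) 1). unfold d0 in Hdd; lra. }
  destruct (climb H HH q1 d Y Hd) as (hi & Hhi & Chi).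
  destruct (descend H q2 d Y HH Hd) as (lo & Hlo & Clo).
  set (Q := fun u => eta <= Rabs (H u - c) \/ close (r / 2) p u).
  assert (Cg : chain d Q lo hi).
  { apply chain_trans with q2; [|apply chain_trans with q1].
    - apply chain_sym; revert Clo; apply chain_mono; [lra|]; intros u Hu; left.
      rewrite Rabs_minus_sym, Rabs_pos_eq; lra.
    - apply segment_chain; [assumption|]; intros t Ht; right; now apply close_segment.
    - revert Chi; apply chain_mono; [lra|]; intros u Hu; left. rewrite Rabs_pos_eq; lra. }
  destruct (chain_bounded _ _ _ _ Cg) as (X & CX).
  exists X; intros P z w Hzw Hz Hw.
  destruct (chains_cross _ _ _ _ _ _ _ Hzw CX) as (a & b & (Pa & Ha) & (Qb & _) & Hab).
  - intros v [_ Hv]; apply Rabs_def2 in Hv; lra.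
  - intros v [_ Hv]. specialize (HY v ltac:(lra)); lra.
  - exists a; split; [assumption|].
    destruct Qb as [Qb | Qb].
    + exfalso. assert (Hab' : close d1 a b) by (apply close_mono with (2 * d); [lra | assumption]).
      specialize (U _ _ Hab'). pose proof (Rabs_triang (H b - H a) (H a - c)).
      replace (H b - H a + (H a - c)) with (H b - c) in * by ring. lra.
    + replace r with (r / 2 + r / 2) by lra. apply close_trans with b; [assumption|].
      apply close_mono with (2 * d); [lra | now apply close_sym].
Qed.

(** * Levels on which nearby points are joined by chains of bounded width *)

(** The endpoints lie on the level, the chain only within [d] of it: for each [d] this is open in
    [c], and the property of interest is its validity for all [d > 0] with the same [M]. *)
Definition narrow (H : R * R -> R) (M : nat) (d c : R) : Prop :=
  forall z w, H z = c -> H w = c -> Rabs (fst w - fst z) <= 1 ->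
    chain d (fun u => Rabs (H u - c) < d /\ Rabs (fst u - fst z) < INR M) z w.

(** Finitely many strict inequalities hold with a common margin; this is what allows a chain to be
    reused at nearby levels. *)
Lemma chain_slack d a b (f g : R * R -> R) z w :
  chain d (fun u => f u < a /\ g u < b) z w ->
  exists e, 0 < e /\ chain d (fun u => f u < a - e /\ g u < b - e) z w.
Proof.
  induction 1 as [z [H1 H2] | z w u [H1 H2] Hc Hwu (e & He & IH)].
  - exists (Rmin (a - f z) (b - g z) / 2).
    assert (Hm : 0 < Rmin (a - f z) (b - g z)) by (apply Rmin_glb_lt; lra).
    pose proof (Rmin_l (a - f z) (b - g z)); pose proof (Rmin_r (a - f z) (b - g z)).
    split; [lra|]; apply chain_refl; lra.
  - set (e' := Rmin (Rmin (a - f z) (b - g z) / 2) e).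
    assert (Hm : 0 < Rmin (a - f z) (b - g z)) by (apply Rmin_glb_lt; lra).
    pose proof (Rmin_l (a - f z) (b - g z)); pose proof (Rmin_r (a - f z) (b - g z)).
    assert (E1 : e' <= Rmin (a - f z) (b - g z) / 2) by apply Rmin_l.
    assert (E2 : e' <= e) by apply Rmin_r.
    exists e'; split; [apply Rmin_glb_lt; lra|].
    apply chain_step with w; [lra | assumption|].
    revert IH; apply chain_mono; [lra|]; intros; lra.
Qed.

Section Narrow.
Variables (H : R * R -> R) (HH : height H).

Lemma narrow_mono M M' d d' c : (M <= M')%nat -> d <= d' -> narrow H M d c -> narrow H M' d' c.
Proof.
  intros HM Hd Hn z w Hz Hw Hzw. apply le_INR in HM.
  specialize (Hn z w Hz Hw Hzw); revert Hn; apply chain_mono; [assumption|].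
  intros u [U1 U2]; lra.
Qed.

Lemma narrow_period M d c (k : Z) : narrow H M d (c + IZR k) <-> narrow H M d c.
Proof.
  assert (A : forall c k, narrow H M d (c + IZR k) -> narrow H M d c).
  { clear c k; intros c k Hn z w Hz Hw Hzw.
    set (up := fun (j : Z) (u : R * R) => (fst u, snd u + IZR j)).
    assert (Hup : forall j u, H (up j u) = H u + IZR j).
    { intros j [u1 u2]; apply (height_up H HH). }
    assert (Hc : chain d (fun u => Rabs (H u - (c + IZR k)) < d /\ Rabs (fst u - fst (up k z)) < INR M)
              (up k z) (up k w)).
    { apply Hn; [now rewrite Hup, Hz | now rewrite Hup, Hw | exact Hzw]. }
    assert (Hc' : chain d (fun u => Rabs (H u - c) < d /\ Rabs (fst u - fst z) < INR M)
              (up (- k)%Z (up k z)) (up (- k)%Z (up k w))).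
    { revert Hc; apply chain_map.
      - intros u [U1 U2]; split; [|exact U2]. rewrite Hup, opp_IZR.
        now replace (H u + - IZR k - c) with (H u - (c + IZR k)) by ring.
      - intros u v _ _ [U1 U2]; split; [exact U1|]; simpl.
        now replace (snd v + IZR (- k) - (snd u + IZR (- k))) with (snd v - snd u) by ring. }
    assert (E : forall u, up (- k)%Z (up k u) = u).
    { intros [u1 u2]; unfold up; simpl; rewrite opp_IZR; f_equal; ring. }
    now rewrite !E in Hc'. }
  split; [apply A|]. intros Hn; apply A with (k := (- k)%Z).
  rewrite opp_IZR. now replace (c + IZR k + - IZR k) with c by ring.
Qed.

Lemma narrow_translate M d c z w : narrow H M d c -> H z = c -> H w = c ->
  Rabs (fst w - fst z) <= 1 -> forall k,
  chain d (fun u => Rabs (H u - c) < d /\ Rabs (fst u - fst (tr k z)) < INR M) (tr k z) (tr k w).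
Proof.
  intros Hn Hz Hw Hzw k; apply Hn.
  - now rewrite height_tr.
  - now rewrite height_tr.
  - simpl. now replace (fst w + IZR k - (fst z + IZR k)) with (fst w - fst z) by ring.
Qed.

(** The condition of [narrow] for a single pair of points, uniformly over the levels near [c], with
    the radius as a parameter for [box_uniform]. *)
Definition narrow_pair (M : nat) (d c e : R) (z w : R * R) : Prop :=
  forall c', Rabs (c' - c) < e -> H z = c' -> H w = c' -> Rabs (fst w - fst z) <= 1 ->
    chain d (fun u => Rabs (H u - c') < d /\ Rabs (fst u - fst z) < INR M) z w.

(** If one point is off the level, or the points are more than 1 apart horizontally, the condition
    is vacuous nearby. Otherwise the chain from [z] to [w], taken with slack, is prolonged by one
    step at each end; [2 <= M] makes room for [w'], at horizontal distance at most 1 from [z']. *)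
Lemma narrow_pair_open M d c z w : (2 <= M)%nat -> 0 < d -> narrow H M d c ->
  exists e, 0 < e /\ forall z' w', close e z z' -> close e w w' -> narrow_pair M d c e z' w'.
Proof.
  intros HM Hd Hn. apply le_INR in HM; simpl in HM.
  destruct (classic (H z = c)) as [Hz | Hz].
  2:{ destruct (level_avoided H HH c z Hz) as (e & He & A); exists e; split; [assumption|].
      intros z' w' Hz' _ c' Hc' E; exfalso; now apply (A z' c'). }
  destruct (classic (H w = c)) as [Hw | Hw].
  2:{ destruct (level_avoided H HH c w Hw) as (e & He & A); exists e; split; [assumption|].
      intros z' w' _ Hw' c' Hc' _ E; exfalso; now apply (A w' c'). }
  destruct (Rle_lt_dec (Rabs (fst w - fst z)) 1) as [Hzw | Hzw].
  2:{ exists ((Rabs (fst w - fst z) - 1) / 2); split; [lra|].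
      intros z' w' [Hz' _] [Hw' _] c' _ _ _ Hle; exfalso.
      rewrite Rabs_minus_sym in Hw'.
      pose proof (Rabs_triang (fst w - fst w') (fst w' - fst z')).
      pose proof (Rabs_triang (fst w - fst w' + (fst w' - fst z')) (fst z' - fst z)).
      replace (fst w - fst w' + (fst w' - fst z') + (fst z' - fst z)) with (fst w - fst z) in * by ring.
      lra. }
  destruct (chain_slack _ _ _ (fun u => Rabs (H u - c)) (fun u => Rabs (fst u - fst z)) _ _
    (Hn z w Hz Hw Hzw)) as (e & He & Hc).
  set (m := Rmin (Rmin (e / 2) d) (1 / 2)).
  assert (Hm : 0 < m /\ m <= e / 2 /\ m <= d /\ m <= 1 / 2).
  { split; [repeat apply Rmin_glb_lt; lra|].
    pose proof (Rmin_l (Rmin (e / 2) d) (1 / 2)); pose proof (Rmin_r (Rmin (e / 2) d) (1 / 2)).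
    pose proof (Rmin_l (e / 2) d); pose proof (Rmin_r (e / 2) d); unfold m; lra. }
  exists m; split; [tauto|]; intros z' w' Hz' Hw' c' Hc' Ez' Ew' Hzw'.
  pose proof (chain_left _ _ _ _ Hc) as [L1 L2]; pose proof (chain_right _ _ _ _ Hc) as [R1 R2].
  assert (HP : forall u, Rabs (H u - c) < d - e /\ Rabs (fst u - fst z) < INR M - e ->
    Rabs (H u - c') < d /\ Rabs (fst u - fst z') < INR M).
  { intros u [U1 U2]. destruct Hz' as [Hz' _]. apply Rabs_def2 in U1, U2, Hc', Hz'.
    split; apply Rabs_def1; lra. }
  apply chain_step with z.
  - rewrite Ez', !Rminus_diag, Rabs_R0; lra.
  - apply close_sym; apply close_mono with m; [lra | assumption].
  - apply chain_trans with w.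
    + revert Hc; apply chain_mono; [lra | exact HP].
    + apply chain_step with w'; [now apply HP | apply close_mono with m; [lra | assumption] |].
      apply chain_refl. split; [rewrite Ew', Rminus_diag, Rabs_R0; lra | lra].
Qed.

Lemma narrow_open M d : (2 <= M)%nat -> 0 < d -> R_open (narrow H M d).
Proof.
  intros HM Hd c Hn.
  destruct (level_strip H HH c) as [Y HY].
  (* By a horizontal translation [z] may be taken over [[0, 1]], and then [w] lies over [[-1, 2]]:
     two compact boxes suffice. *)
  destruct (box_uniform 0 1 (- Y) Y (fun z e => forall w, in_box (-1) 2 (- Y) Y w ->
    narrow_pair M d c e z w)) as (e & He & A).
  - intros z e e' Hee A w Hw c' Hc'; apply (A w Hw); lra.
  - intros z _.
    destruct (box_uniform (-1) 2 (- Y) Y (fun w e => forall z', close e z z' ->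
      narrow_pair M d c e z' w)) as (e & He & A).
    + intros w e e' Hee A z' Hz' c' Hc'. apply (A z'); [now apply close_mono with e' | lra].
    + intros w _. destruct (narrow_pair_open M d c z w HM Hd Hn) as (e & He & A).
      exists e; split; [assumption|]; intros w' Hw' z' Hz'; now apply A.
    + exists e; split; [assumption|]; intros z' Hz' w Hw; now apply A.
  - exists (Rmin e 1); split; [apply Rmin_glb_lt; lra|]; intros c' Hc' z w Hz Hw Hzw.
    pose proof (Rmin_l e 1); pose proof (Rmin_r e 1).
    destruct (exists_int_below (fst z)) as [k Hk].
    assert (Hbox : forall u, H u = c' -> - Y <= snd u <= Y).
    { intros u Hu. assert (Hu1 : Rabs (H u - c) < 1) by (rewrite Hu; lra).
      specialize (HY u Hu1); lra. }
    assert (Hzw' : -1 <= fst w - fst z <= 1).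
    { pose proof (Rle_abs (fst w - fst z)); pose proof (Rle_abs (- (fst w - fst z))).
      rewrite Rabs_Ropp in *; lra. }
    assert (Hc : chain d (fun u => Rabs (H u - c') < d /\ Rabs (fst u - fst (tr k z)) < INR M) (tr k z) (tr k w)).
    { apply (A (tr k z)); try (rewrite height_tr; assumption).
      - split; [simpl; lra | exact (Hbox z Hz)].
      - split; [simpl; lra | exact (Hbox w Hw)].
      - lra.
      - simpl. now replace (fst w + IZR k - (fst z + IZR k)) with (fst w - fst z) by ring. }
    assert (Hc2 : chain d (fun u => Rabs (H u - c') < d /\ Rabs (fst u - fst z) < INR M)
       (tr (- k) (tr k z)) (tr (- k) (tr k w))).
    { revert Hc; apply chain_map.
      - intros u [U1 U2]; rewrite height_tr by assumption; split; [assumption|]. simpl in *.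
        rewrite opp_IZR. now replace (fst u + - IZR k - fst z) with (fst u - (fst z + IZR k)) by ring.
      - intros u v _ _; apply close_tr. }
    rewrite !tr_tr, !Z.add_opp_diag_r, !tr_0 in Hc2. exact Hc2.
Qed.

(** * Compactly generated levels are narrow *)

(** For each [k], either [A k] holds at all scales or it fails at some scale and hence at all
    smaller ones; finitely many [k] have a common threshold. *)
Lemma finite_radius (A : Z -> R -> Prop) (K : nat) :
  (forall k e e', e' <= e -> A k e' -> A k e) ->
  exists e0, 0 < e0 /\ forall k, (Z.abs k <= Z.of_nat K)%Z -> A k e0 -> forall e, 0 < e -> A k e.
Proof.
  intros Hmono.
  assert (Hone : forall k, exists e0, 0 < e0 /\ (A k e0 -> forall e, 0 < e -> A k e)).
  { intros k. destruct (classic (forall e, 0 < e -> A k e)) as [|Hn].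
    - exists 1; split; [lra | auto].
    - apply not_all_ex_not in Hn as [e Hn]. apply imply_to_and in Hn as [He Hn].
      exists e; split; [assumption | intros; contradiction]. }
  induction K as [|K (e0 & He0 & IH)].
  - destruct (Hone 0%Z) as (e0 & He0 & A0); exists e0; split; [assumption|].
    intros k Hk; replace k with 0%Z by lia; assumption.
  - destruct (Hone (Z.of_nat (S K))) as (e1 & He1 & A1).
    destruct (Hone (- Z.of_nat (S K))%Z) as (e2 & He2 & A2).
    exists (Rmin e0 (Rmin e1 e2)); split; [repeat apply Rmin_glb_lt; assumption|].
    intros k Hk HA.
    pose proof (Rmin_l e0 (Rmin e1 e2)); pose proof (Rmin_r e0 (Rmin e1 e2)).
    pose proof (Rmin_l e1 e2); pose proof (Rmin_r e1 e2).
    destruct (Z.eq_dec k (Z.of_nat (S K))) as [-> | N1].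
    { apply A1; eapply Hmono; [|exact HA]; lra. }
    destruct (Z.eq_dec k (- Z.of_nat (S K))) as [-> | N2].
    { apply A2; eapply Hmono; [|exact HA]; lra. }
    apply IH; [lia|]; eapply Hmono; [|exact HA]; lra.
Qed.

(** [C] will be the image in straightened coordinates of a component of the lifted fibre, [G] that
    of its compact generator; the unit translation upstairs becomes the translation by [v].
    Compactness and connectedness of the generator enter as the bound [B] and as chains in [G] at
    every scale. *)
Section Generated.
Variables (c : R) (C G : R * R -> Prop) (v : Z) (B : R).
Hypotheses (Hv : v <> 0%Z) (HCc : forall z, C z -> H z = c)
  (HCchain : forall d z w, 0 < d -> C z -> C w -> chain d C z w)
  (HGchain : forall d z w, 0 < d -> G z -> G w -> chain d G z w)
  (HGB : forall z, G z -> Rabs (fst z) <= B)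
  (HCG : forall z, C z <-> exists n : Z, G (tr (- (n * v)) z)).

Lemma generator_tr n z : G z -> C (tr (n * v) z).
Proof.
  intros Hz; apply HCG; exists n. rewrite tr_tr, Z.add_opp_diag_r, tr_0; exact Hz.
Qed.

Lemma generated_tr n z : C z -> C (tr (n * v) z).
Proof.
  intros [m Hm]%HCG; apply HCG; exists (m + n)%Z. rewrite tr_tr.
  now replace (n * v + - ((m + n) * v))%Z with (- (m * v))%Z by ring.
Qed.

(** The two translates of [G] are at distance zero; in terms of chains, one can pass between them at
    every scale. *)
Definition adjacent (n m : Z) : Prop := forall e, 0 < e ->
  exists g g', G g /\ G g' /\ close e (tr (n * v) g) (tr (m * v) g').

(** Since [G] is bounded and [v] is not zero, only finitely many index differences allow two
    translates within distance 1, so [finite_radius] applies. *)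
Lemma adjacent_of_close : exists e0, 0 < e0 /\ forall n m g g', G g -> G g' ->
  close e0 (tr (n * v) g) (tr (m * v) g') -> adjacent n m.
Proof.
  destruct (exists_nat_above (2 * B + 1)) as [K HK].
  destruct (finite_radius (fun k e => exists g g', G g /\ G g' /\ close e g (tr (k * v) g')) K)
    as (e0 & He0 & A).
  { intros k e e' Hee (g & g' & Hg & Hg' & Hc); exists g, g'; repeat split; try assumption;
      apply (close_mono _ _ _ _ Hee Hc). }
  assert (Hshift : forall n m e g g', close e (tr (n * v) g) (tr (m * v) g') <->
    close e g (tr ((m - n) * v) g')).
  { intros n m e g g'; split; intros Hc.
    - apply (close_tr (- (n * v))) in Hc. rewrite !tr_tr, Z.add_opp_diag_r, tr_0 in Hc.
      now replace ((m - n) * v)%Z with (m * v + - (n * v))%Z by ring.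
    - apply (close_tr (n * v)) in Hc. rewrite tr_tr in Hc.
      now replace ((m - n) * v + n * v)%Z with (m * v)%Z in Hc by ring. }
  exists (Rmin e0 1); split; [apply Rmin_glb_lt; lra|].
  intros n m g g' Hg Hg' Hc. apply Hshift in Hc.
  assert (Hk : (Z.abs (m - n) <= Z.of_nat K)%Z).
  { destruct Hc as [Hc _]; simpl in Hc. pose proof (Rmin_r e0 1).
    pose proof (HGB g Hg) as B1; pose proof (HGB g' Hg') as B2.
    apply le_IZR. rewrite <- INR_IZR_INZ.
    assert (A1 : Rabs (IZR ((m - n) * v)) < 1 + 2 * B).
    { replace (IZR ((m - n) * v)) with ((fst g' + IZR ((m - n) * v) - fst g) + (fst g - fst g')) by ring.
      eapply Rle_lt_trans; [apply Rabs_triang|].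
      pose proof (Rabs_triang (fst g) (- fst g')). rewrite Rabs_Ropp in *.
      unfold Rminus in *; lra. }
    rewrite mult_IZR, Rabs_mult, <- !abs_IZR in A1.
    assert (A2 : 1 <= IZR (Z.abs v)) by (apply IZR_le; lia).
    assert (A3 : 0 <= IZR (Z.abs (m - n))) by (apply IZR_le; lia). nra. }
  intros e He.
  destruct (A (m - n)%Z Hk) with (e := e) as (h & h' & Hh & Hh' & Hhh); [|assumption|].
  - exists g, g'; repeat split; try assumption; apply (close_mono _ _ _ _ (Rmin_l _ _) Hc).
  - exists h, h'; repeat split; try assumption; apply Hshift, Hhh.
Qed.

(** A chain in [C] at a scale as in [adjacent_of_close] projects to a path in the adjacency graph of
    the translates. *)
Lemma chain_index d z w : (forall n m g g', G g -> G g' ->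
    close d (tr (n * v) g) (tr (m * v) g') -> adjacent n m) ->
  chain d C z w -> forall n, G (tr (- (n * v)) z) ->
  exists m, G (tr (- (m * v)) w) /\ clos_refl_trans Z adjacent n m.
Proof.
  intros Had; induction 1 as [z Hz | z w u Hz Hc Hwu IH]; intros n Hn.
  - exists n; split; [assumption | apply rt_refl].
  - destruct (proj1 (HCG w) (chain_left _ _ _ _ Hwu)) as [k Hk].
    destruct (IH k Hk) as (m & Hm & Hkm). exists m; split; [assumption|].
    apply rt_trans with k; [|assumption]. apply rt_step.
    apply (Had n k _ _ Hn Hk). rewrite !tr_tr, !Z.add_opp_diag_l, !tr_0. exact Hc.
Qed.

Lemma generator_chain d n z w : 0 < d -> G (tr (- (n * v)) z) -> G (tr (- (n * v)) w) ->
  chain d (fun u => C u /\ Rabs (fst u - IZR (n * v)) <= B) z w.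
Proof.
  intros Hd Hz Hw.
  assert (E : forall u, tr (n * v) (tr (- (n * v)) u) = u).
  { intros u. now rewrite tr_tr, Z.add_opp_diag_l, tr_0. }
  rewrite <- (E z), <- (E w).
  generalize (HGchain d _ _ Hd Hz Hw); apply chain_map.
  - intros u Hu; split; [now apply generator_tr|]. simpl.
    replace (fst u + IZR (n * v) - IZR (n * v)) with (fst u) by ring. now apply HGB.
  - intros u u' _ _; apply close_tr.
Qed.

(** The order of quantifiers is the point: [W] depends on the path of indices and not on [d]. *)
Lemma path_chain n m : clos_refl_trans Z adjacent n m ->
  exists W, forall d z w, 0 < d -> G (tr (- (n * v)) z) -> G (tr (- (m * v)) w) ->
    chain d (fun u => C u /\ Rabs (fst u) <= W) z w.
Proof.
  assert (Hgen : forall n, exists W, forall d z w, 0 < d -> G (tr (- (n * v)) z) ->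
    G (tr (- (n * v)) w) -> chain d (fun u => C u /\ Rabs (fst u) <= W) z w).
  { intros k; exists (B + Rabs (IZR (k * v))); intros d z w Hd Hz Hw.
    generalize (generator_chain d k z w Hd Hz Hw); apply chain_mono; [lra|].
    intros u [U1 U2]; split; [assumption|].
    replace (fst u) with ((fst u - IZR (k * v)) + IZR (k * v)) by ring.
    eapply Rle_trans; [apply Rabs_triang | lra]. }
  induction 1 as [n m Hnm | n | n k m H1 [W1 IH1] H2 [W2 IH2]].
  - destruct (Hgen n) as [W1 A1], (Hgen m) as [W2 A2].
    exists (Rmax W1 W2); intros d z w Hd Hz Hw.
    destruct (Hnm d Hd) as (g & g' & Hg & Hg' & Hc).
    pose proof (Rmax_l W1 W2); pose proof (Rmax_r W1 W2).
    assert (E : forall j u, G u -> G (tr (- (j * v)) (tr (j * v) u))).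
    { intros j u Hu. now rewrite tr_tr, Z.add_opp_diag_r, tr_0. }
    apply chain_trans with (tr (n * v) g).
    + generalize (A1 d z (tr (n * v) g) Hd Hz (E _ _ Hg)); apply chain_mono; [lra|]; intros u [U1 U2].
      split; [assumption | lra].
    + pose proof (A2 d (tr (m * v) g') w Hd (E _ _ Hg') Hw) as C2.
      apply chain_step with (tr (m * v) g'); [|assumption|].
      * pose proof (A1 d z (tr (n * v) g) Hd Hz (E _ _ Hg)) as C1.
        destruct (chain_right _ _ _ _ C1); split; [assumption | lra].
      * revert C2; apply chain_mono; [lra|]; intros u [U1 U2]; split; [assumption | lra].
  - apply Hgen.
  - exists (Rmax W1 W2); intros d z w Hd Hz Hw.
    pose proof (Rmax_l W1 W2); pose proof (Rmax_r W1 W2).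
    assert (Hk : exists g, G (tr (- (k * v)) g)).
    { assert (Hg0 : G (tr (- (n * v)) z)) by assumption.
      exists (tr (k * v) (tr (- (n * v)) z)). now rewrite (tr_tr (- (k * v))), Z.add_opp_diag_r, tr_0. }
    destruct Hk as [g Hg].
    apply chain_trans with g.
    + generalize (IH1 d z g Hd Hz Hg); apply chain_mono; [lra|]; intros u [U1 U2]; split; [assumption|lra].
    + generalize (IH2 d g w Hd Hg Hw); apply chain_mono; [lra|]; intros u [U1 U2]; split; [assumption|lra].
Qed.

(** One chain in [C] at one fixed scale yields a path of indices from 0 to 1, hence chains at every
    scale with the same bound; translation by [n * v] gives the other [n]. *)
Lemma consecutive_chain : (exists g, G g) -> exists W, 0 <= W /\ forall d n z w, 0 < d ->
  G (tr (- (n * v)) z) -> G (tr (- ((n + 1) * v)) w) ->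
  chain d (fun u => C u /\ Rabs (fst u - IZR (n * v)) <= W) z w.
Proof.
  intros [g Hg].
  destruct adjacent_of_close as (e0 & He0 & Had).
  assert (Hg1 : C g) by (apply HCG; exists 0%Z; now rewrite tr_0).
  assert (Hg2 : C (tr (1 * v) g)) by now apply generated_tr.
  destruct (chain_index e0 g (tr (1 * v) g) Had (HCchain e0 _ _ He0 Hg1 Hg2) 0%Z) as (m & Hm & Hpath).
  { now rewrite tr_0. }
  (* The path ends at some [m] whose translate contains [tr (1 * v) g]. So does the translate with
     index 1, hence [m] and 1 are adjacent. *)
  assert (Hpath1 : clos_refl_trans Z adjacent 0%Z 1%Z).
  { apply rt_trans with m; [assumption|]. apply rt_step; intros e He.
    exists (tr (- (m * v)) (tr (1 * v) g)), g; repeat split; try assumption;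
      rewrite (tr_tr (m * v)), Z.add_opp_diag_l, tr_0; now apply (close_refl e (tr (1 * v) g)). }
  destruct (path_chain _ _ Hpath1) as [W HW].
  exists (Rabs W); split; [apply Rabs_pos|]; intros d n z w Hd Hz Hw.
  assert (E : forall u, tr (n * v) (tr (- (n * v)) u) = u).
  { intros u. now rewrite tr_tr, Z.add_opp_diag_l, tr_0. }
  rewrite <- (E z), <- (E w).
  assert (Hc : chain d (fun u => C u /\ Rabs (fst u) <= W) (tr (- (n * v)) z) (tr (- (n * v)) w)).
  { apply HW; [assumption | now rewrite tr_0 |].
    rewrite tr_tr. now replace (- (n * v) + - (1 * v))%Z with (- ((n + 1) * v))%Z by ring. }
  revert Hc; apply chain_map.
  - intros u [U1 U2]; split; [now apply generated_tr|]. simpl.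
    replace (fst u + IZR (n * v) - IZR (n * v)) with (fst u) by ring.
    pose proof (Rle_abs W); lra.
  - intros u u' _ _; apply close_tr.
Qed.

Lemma indices_chain : (exists g, G g) -> exists W, 0 <= W /\ forall d (j : nat) n z w, 0 < d ->
  G (tr (- (n * v)) z) -> G (tr (- ((n + Z.of_nat j) * v)) w) ->
  chain d (fun u => C u /\ Rabs (fst u - IZR (n * v)) <= W + INR j * Rabs (IZR v)) z w.
Proof.
  intros Hg; destruct (consecutive_chain Hg) as (W & HW & Hc).
  exists (Rmax W B).
  pose proof (Rmax_l W B); pose proof (Rmax_r W B). pose proof (Rabs_pos (IZR v)).
  split; [lra|].
  intros d; induction j as [|j IH]; intros n z w Hd Hz Hw.
  - rewrite Z.add_0_r in Hw. generalize (generator_chain d n z w Hd Hz Hw).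
    apply chain_mono; [lra|]; intros u [U1 U2]; split; [assumption | simpl; lra].
  - destruct Hg as [g Hg].
    assert (Hg1 : G (tr (- ((n + 1) * v)) (tr ((n + 1) * v) g))).
    { now rewrite tr_tr, Z.add_opp_diag_r, tr_0. }
    pose proof (pos_INR j). rewrite S_INR.
    apply chain_trans with (tr ((n + 1) * v) g).
    + generalize (Hc d n z _ Hd Hz Hg1); apply chain_mono; [lra|]; intros u [U1 U2].
      split; [assumption | nra].
    + assert (Hw' : G (tr (- ((n + 1 + Z.of_nat j) * v)) w)).
      { now replace (n + 1 + Z.of_nat j)%Z with (n + Z.of_nat (S j))%Z by lia. }
      generalize (IH (n + 1)%Z _ w Hd Hg1 Hw'); apply chain_mono; [lra|]; intros u [U1 U2].
      split; [assumption|].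
      replace (fst u - IZR (n * v)) with ((fst u - IZR ((n + 1) * v)) + IZR v)
        by (rewrite !mult_IZR, plus_IZR; ring).
      eapply Rle_trans; [apply Rabs_triang | lra].
Qed.

Lemma generated_narrow : (exists g, G g) -> regular H c ->
  exists M, (2 <= M)%nat /\ forall d, 0 < d -> narrow H M d c.
Proof.
  intros Hg Hreg.
  (* [C] may be a proper part of the level. It is dense there, since it contains chains from far
     left to far right and these pass near every point of a regular level. *)
  assert (Hdense : forall p r, H p = c -> 0 < r -> exists u, C u /\ close r p u).
  { intros p r Hp Hr.
    destruct (regular_level_crossing H c p r HH Hreg Hp Hr) as (d & Hd & A).
    destruct (A d Hd (Rle_refl d)) as [X HX].
    destruct Hg as [g Hg].
    assert (Hg1 : C g) by (apply HCG; exists 0%Z; now rewrite tr_0).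
    destruct (exists_nat_above (Rabs X + Rabs (fst g))) as [N HN].
    assert (HvN : forall s : Z, (s = 1 \/ s = -1)%Z -> (s * v > 0)%Z ->
      X <= fst (tr (s * Z.of_nat N * v) g) /\ fst (tr (- s * Z.of_nat N * v) g) <= - X).
    { intros s Hs Hsv. simpl.
      replace (s * Z.of_nat N * v)%Z with (Z.of_nat N * (s * v))%Z by ring.
      replace (- s * Z.of_nat N * v)%Z with (- (Z.of_nat N * (s * v)))%Z by ring.
      rewrite opp_IZR, mult_IZR, <- INR_IZR_INZ.
      assert (1 <= IZR (s * v)) by (apply IZR_le; lia).
      pose proof (Rle_abs X); pose proof (Rle_abs (fst g)); pose proof (Rle_abs (- fst g)).
      rewrite Rabs_Ropp in *. pose proof (pos_INR N). split; nra. }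
    assert (Hs : exists s : Z, (s = 1 \/ s = -1)%Z /\ (s * v > 0)%Z).
    { destruct (Z_lt_le_dec 0 v); [exists 1%Z | exists (-1)%Z]; lia. }
    destruct Hs as (s & Hs & Hsv). destruct (HvN s Hs Hsv) as [X1 X2].
    apply (HX C (tr (- s * Z.of_nat N * v) g) (tr (s * Z.of_nat N * v) g)); try assumption.
    generalize (HCchain d _ _ Hd (generated_tr (- s * Z.of_nat N) _ Hg1) (generated_tr (s * Z.of_nat N) _ Hg1)).
    apply chain_mono; [lra|]; intros u Hu; split; [assumption|].
    rewrite (HCc _ Hu), Rminus_diag, Rabs_R0; assumption. }
  destruct (indices_chain Hg) as (W & HW & Hidx).
  assert (HB0 : 0 <= B).
  { destruct Hg as [g Hg']; specialize (HGB g Hg'); pose proof (Rabs_pos (fst g)); lra. }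
  (* The index gap of two points of [C] costs [2 B + 3] and the offset from the translate of [G]
     costs [B]; replacing [z] and [w] by nearby points of [C] costs at most 2 more. *)
  destruct (exists_nat_above (W + 3 * B + 6)) as [M HM].
  assert (HM1 : (2 <= M)%nat) by (apply INR_le; simpl; lra).
  exists M; split; [assumption|].
  (* [G] has width at most [2 B], which bounds the difference of the indices of two close points. *)
  assert (Hwide : forall d n m z w, 0 < d -> G (tr (- (n * v)) z) -> G (tr (- (m * v)) w) ->
    (n <= m)%Z -> Rabs (fst w - fst z) <= 3 ->
    chain d (fun u => C u /\ Rabs (fst u - fst z) <= W + 3 * B + 3) z w).
  { intros d n m z w Hd Hz Hw Hnm Hzw.
    replace m with (n + Z.of_nat (Z.to_nat (m - n)))%Z in Hw by lia.
    assert (Hj : INR (Z.to_nat (m - n)) * Rabs (IZR v) <= 2 * B + 3).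
    { pose proof (HGB _ Hz) as Bz; pose proof (HGB _ Hw) as Bw; simpl in Bz, Bw.
      rewrite INR_IZR_INZ, Z2Nat.id in * by lia.
      rewrite <- (Rabs_pos_eq (IZR (m - n))), <- Rabs_mult by (apply IZR_le; lia).
      replace (n + (m - n))%Z with m in Bw by lia.
      replace (IZR (m - n) * IZR v) with (((fst z + IZR (- (n * v))) - (fst w + IZR (- (m * v)))) + (fst w - fst z)).
      - eapply Rle_trans; [apply Rabs_triang|].
        pose proof (Rabs_triang (fst z + IZR (- (n * v))) (- (fst w + IZR (- (m * v))))).
        rewrite Rabs_Ropp in *. unfold Rminus in *; lra.
      - rewrite !opp_IZR, !mult_IZR, minus_IZR; ring. }
    generalize (Hidx d _ n z w Hd Hz Hw); apply chain_mono; [lra|].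
    intros u [U1 U2]; split; [assumption|].
    pose proof (HGB _ Hz) as Bz; simpl in Bz. rewrite opp_IZR in Bz.
    replace (fst u - fst z) with ((fst u - IZR (n * v)) - (fst z + - IZR (n * v))) by ring.
    unfold Rminus at 1. eapply Rle_trans; [apply Rabs_triang|]. rewrite Rabs_Ropp. lra. }
  intros d Hd z w Hz Hw Hzw.
  set (r := Rmin d 1).
  assert (Hr : 0 < r /\ r <= d /\ r <= 1) by (split; [apply Rmin_glb_lt; lra | split; [apply Rmin_l | apply Rmin_r]]).
  destruct (Hdense z r Hz) as (z1 & Cz1 & Hz1); [tauto|].
  destruct (Hdense w r Hw) as (w1 & Cw1 & Hw1); [tauto|].
  assert (Hz1' : Rabs (fst z1 - fst z) < 1) by (destruct Hz1; lra).
  assert (Hw1' : Rabs (fst w1 - fst w) < 1) by (destruct Hw1; lra).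
  assert (Hzw1 : Rabs (fst w1 - fst z1) <= 3).
  { replace (fst w1 - fst z1) with ((fst w1 - fst w) + ((fst w - fst z) - (fst z1 - fst z))) by ring.
    eapply Rle_trans; [apply Rabs_triang|].
    pose proof (Rabs_triang (fst w - fst z) (- (fst z1 - fst z))). rewrite Rabs_Ropp in *.
    unfold Rminus in *; lra. }
  assert (Hc : chain d (fun u => C u /\ Rabs (fst u - fst z) < INR M) z1 w1).
  { destruct (proj1 (HCG z1) Cz1) as [n Hn]; destruct (proj1 (HCG w1) Cw1) as [m Hm].
    destruct (Z_le_gt_dec n m) as [Hnm | Hnm].
    - generalize (Hwide d n m z1 w1 Hd Hn Hm Hnm Hzw1); apply chain_mono; [lra|].
      intros u [U1 U2]; split; [assumption|].
      replace (fst u - fst z) with ((fst u - fst z1) + (fst z1 - fst z)) by ring.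
      eapply Rle_lt_trans; [apply Rabs_triang | lra].
    - apply chain_sym.
      assert (Hwz : Rabs (fst z1 - fst w1) <= 3) by now rewrite Rabs_minus_sym.
      generalize (Hwide d m n w1 z1 Hd Hm Hn ltac:(lia) Hwz); apply chain_mono; [lra|].
      intros u [U1 U2]; split; [assumption|].
      replace (fst u - fst z) with ((fst u - fst w1) + ((fst w1 - fst w) + (fst w - fst z))) by ring.
      eapply Rle_lt_trans; [apply Rabs_triang|].
      pose proof (Rabs_triang (fst w1 - fst w) (fst w - fst z)); lra. }
  pose proof (le_INR _ _ HM1) as HM2; simpl in HM2.
  apply chain_step with z1.
  - rewrite Hz, !Rminus_diag, Rabs_R0; lra.
  - apply close_mono with r; tauto.
  - apply chain_trans with w1.
    + revert Hc; apply chain_mono; [lra|]; intros u [U1 U2]; split; [|assumption].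
      rewrite (HCc _ U1), Rminus_diag, Rabs_R0; assumption.
    + apply chain_step with w.
      * destruct (chain_right _ _ _ _ Hc) as [U1 U2]; split; [|assumption].
        rewrite (HCc _ U1), Rminus_diag, Rabs_R0; assumption.
      * apply close_sym, close_mono with r; tauto.
      * apply chain_refl; split; [rewrite Hw, Rminus_diag, Rabs_R0; assumption | lra].
Qed.
End Generated.
End Narrow.

(** * Deviation inside a fibre *)

Definition commutes_int (g : R * R -> R * R) : Prop :=
  forall z k l, g (fst z + IZR k, snd z + IZR l) = (fst (g z) + IZR k, snd (g z) + IZR l).

Lemma commutes_tr g k z : commutes_int g -> g (tr k z) = tr k (g z).
Proof.
  intros Hg. pose proof (Hg z k 0%Z) as E. rewrite !Rplus_0_r in E. exact E.
Qed.

Lemma cont_map_uniform g : cont_map g -> commutes_int g -> forall e, 0 < e ->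
  exists d, 0 < d /\ forall z w, close d z w -> close e (g z) (g w).
Proof.
  intros Hg Hc e He.
  destruct (equivariant_uniform (fun z => fst (g z)) (cont_map_fst g Hg)) with (e := e)
    as (d1 & Hd1 & A1); [|assumption|].
  { intros k l; exists (IZR k); intros z; now rewrite Hc. }
  destruct (equivariant_uniform (fun z => snd (g z)) (cont_map_snd g Hg)) with (e := e)
    as (d2 & Hd2 & A2); [|assumption|].
  { intros k l; exists (IZR l); intros z; now rewrite Hc. }
  exists (Rmin d1 d2); split; [now apply Rmin_glb_lt|]; intros z w Hzw; split.
  - apply A1; eapply close_mono; [apply Rmin_l | exact Hzw].
  - apply A2; eapply close_mono; [apply Rmin_r | exact Hzw].
Qed.

Section Deviation.
Variables (H : R * R -> R) (HH : height H).
Variables (g gi : R * R -> R * R) (s : R).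
Hypotheses (Hg : cont_map g) (Hgi : cont_map gi) (Hgc : commutes_int g) (Hgic : commutes_int gi)
  (Hgig : forall z, gi (g z) = z) (Hgs : forall z, H (g z) = H z + s).

(** Narrow chains between successive translates of [z] are concatenated in the direction [sg]; each
    of them reaches back by less than [M]. *)
Lemma extend M d c z (sg : Z) : (sg = 1 \/ sg = -1)%Z -> narrow H M d c -> 0 < d -> H z = c ->
  forall n : nat, chain d (fun u => Rabs (H u - c) < d /\ - INR M < IZR sg * (fst u - fst z))
    z (tr (sg * Z.of_nat n) z).
Proof.
  intros Hsg Hn Hd Hz. induction n as [|n IH].
  - rewrite Z.mul_0_r, tr_0. pose proof (Hn z z Hz Hz) as C.
    rewrite Rminus_diag, Rabs_R0 in C. specialize (C ltac:(lra)).
    revert C; apply chain_mono; [lra|]; intros u [U1 U2]; apply Rabs_def2 in U2.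
    split; [assumption | destruct Hsg as [-> | ->]; lra].
  - apply chain_trans with (tr (sg * Z.of_nat n) z); [assumption|].
    replace (sg * Z.of_nat (S n))%Z with (sg + sg * Z.of_nat n)%Z by lia. rewrite <- tr_tr.
    assert (C : chain d (fun u => Rabs (H u - c) < d /\ Rabs (fst u - fst (tr (sg * Z.of_nat n) z)) < INR M)
      (tr (sg * Z.of_nat n) z) (tr (sg * Z.of_nat n) (tr sg z))).
    { apply (narrow_translate H HH M d c z (tr sg z) Hn Hz).
      - rewrite height_tr; assumption.
      - simpl. replace (fst z + IZR sg - fst z) with (IZR sg) by ring.
        destruct Hsg as [-> | ->]; apply Rabs_le; lra. }
    revert C; apply chain_mono; [lra|]; intros u [U1 U2]; split; [assumption|].
    simpl in U2; rewrite mult_IZR, <- INR_IZR_INZ in U2. pose proof (pos_INR n).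
    apply Rabs_def2 in U2; destruct Hsg as [-> | ->]; lra.
Qed.

(* If [g z] and [g w] were far apart, the image under [g] of a short chain from [z] to [w] could be
   prolonged by narrow chains to the far left and the far right. By [regular_level_crossing] that
   image comes close to a point [p] of the level and to its translate by [2 M + 3], so the short
   chain contains two points at distance almost [2 M + 3]. *)
Lemma fibre_deviation_le M c z w :
  (forall d, 0 < d -> narrow H M d c) -> (forall d, 0 < d -> narrow H M d (c + s)) ->
  regular H (c + s) -> H z = c -> H w = c -> Rabs (fst w - fst z) <= 1 ->
  fst (g w) - fst (g z) <= 4 * INR M + 8.
Proof.
  intros Hn Hn' Hreg Hz Hw Hzw. apply Rnot_lt_le; intros Hfar.
  set (a := fst (g z)) in *; set (b := fst (g w)) in *.
  pose proof (pos_INR M) as HM.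
  set (k := (2 * Z.of_nat M + 3)%Z).
  assert (Hk : IZR k = 2 * INR M + 3).
  { unfold k; rewrite plus_IZR, mult_IZR, <- INR_IZR_INZ; ring. }
  (* The offset 2 keeps the box of radius at most 1 about [p] beyond the reach [a + M] of the left
     prolongation; [4 M + 8] keeps the box about the translate of [p] by [k] short of the reach
     [b - M] of the right one. *)
  destruct (last_crossing H HH (a + INR M + 2) (c + s)) as (y & Hy & _).
  set (p := (a + INR M + 2, y)) in *.
  assert (Hp' : H (tr k p) = c + s) by (rewrite height_tr; assumption).
  destruct (cont_map_uniform gi Hgi Hgic 1) as (r0 & Hr0 & Hr0g); [lra|].
  set (r := Rmin r0 1).
  assert (Hr : 0 < r /\ r <= r0 /\ r <= 1) by (split; [apply Rmin_glb_lt; lra | split; [apply Rmin_l | apply Rmin_r]]).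
  destruct (regular_level_crossing H (c + s) p r HH Hreg Hy) as (d1 & Hd1 & A1); [tauto|].
  destruct (regular_level_crossing H (c + s) (tr k p) r HH Hreg Hp') as (d2 & Hd2 & A2); [tauto|].
  set (d := Rmin d1 d2).
  assert (Hd : 0 < d /\ d <= d1 /\ d <= d2) by (split; [apply Rmin_glb_lt; lra | split; [apply Rmin_l | apply Rmin_r]]).
  destruct (A1 d) as [X1 B1]; [tauto | tauto |].
  destruct (A2 d) as [X2 B2]; [tauto | tauto |].
  destruct (cont_map_uniform g Hg Hgc d) as (dg0 & Hdg0 & Hdg); [tauto|].
  set (dg := Rmin dg0 d).
  assert (Hdgd : 0 < dg /\ dg <= dg0 /\ dg <= d) by (split; [apply Rmin_glb_lt; tauto | split; [apply Rmin_l | apply Rmin_r]]).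
  set (P := fun u => fst u < a + INR M \/ b - INR M < fst u \/
    exists v, u = g v /\ Rabs (fst v - fst z) < INR M).
  destruct (exists_nat_above (Rabs X1 + Rabs X2 + Rabs a + Rabs b)) as [n Hnn].
  assert (Hchain : chain d (fun u => P u /\ Rabs (H u - (c + s)) < d)
            (tr (-1 * Z.of_nat n) (g z)) (tr (1 * Z.of_nat n) (g w))).
  { apply chain_trans with (g z); [|apply chain_trans with (g w)].
    - apply chain_sym.
      generalize (extend M d (c + s) (g z) (-1) ltac:(lia) (Hn' d ltac:(tauto)) ltac:(tauto) ltac:(now rewrite Hgs, Hz) n).
      apply chain_mono; [lra|]; intros u [U1 U2]; split; [left; unfold a; lra | assumption].
    - generalize (Hn dg ltac:(tauto) z w Hz Hw Hzw). apply chain_map.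
      + intros u [U1 U2]; split; [right; right; now exists u|].
        rewrite Hgs. replace (H u + s - (c + s)) with (H u - c) by ring. lra.
      + intros u v _ _ Huv. apply Hdg. apply close_mono with dg; tauto.
    - generalize (extend M d (c + s) (g w) 1 ltac:(lia) (Hn' d ltac:(tauto)) ltac:(tauto) ltac:(now rewrite Hgs, Hw) n).
      apply chain_mono; [lra|]; intros u [U1 U2]; split; [right; left; unfold b; lra | assumption]. }
  pose proof (Rle_abs X1); pose proof (Rle_abs X2).
  pose proof (Rle_abs a); pose proof (Rle_abs (- b)); rewrite Rabs_Ropp in *.
  pose proof (Rabs_pos X1); pose proof (Rabs_pos X2); pose proof (Rabs_pos a); pose proof (Rabs_pos b).
  assert (Hleft : fst (tr (-1 * Z.of_nat n) (g z)) = a - INR n).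
  { cbn [fst tr]. rewrite mult_IZR, <- INR_IZR_INZ; fold a; ring. }
  assert (Hright : fst (tr (1 * Z.of_nat n) (g w)) = b + INR n).
  { cbn [fst tr]. rewrite mult_IZR, <- INR_IZR_INZ; fold b; ring. }
  destruct (B1 P _ _ Hchain) as (u1 & P1 & C1); [rewrite Hleft; lra | rewrite Hright; lra |].
  destruct (B2 P _ _ Hchain) as (u2 & P2 & C2); [rewrite Hleft; lra | rewrite Hright; lra |].
  assert (F1 : Rabs (fst u1 - (a + INR M + 2)) < 1) by (destruct C1 as [C1 _]; simpl in C1; lra).
  assert (F2 : Rabs (fst u2 - (a + INR M + 2 + IZR k)) < 1) by (destruct C2 as [C2 _]; simpl in C2; lra).
  apply Rabs_def2 in F1, F2.
  destruct P1 as [P1 | [P1 | (v1 & -> & V1)]]; [lra | lra |].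
  destruct P2 as [P2 | [P2 | (v2 & -> & V2)]]; [lra | lra |].
  assert (G1 : close 1 (gi p) v1).
  { rewrite <- (Hgig v1). apply Hr0g. apply close_mono with r; tauto. }
  assert (G2 : close 1 (tr k (gi p)) v2).
  { rewrite <- (Hgig v2), <- (commutes_tr gi k p Hgic). apply Hr0g. apply close_mono with r; tauto. }
  destruct G1 as [G1 _], G2 as [G2 _]; simpl in G2.
  apply Rabs_def2 in G1, G2, V1, V2. lra.
Qed.

Lemma fibre_deviation M c z w :
  (forall d, 0 < d -> narrow H M d c) -> (forall d, 0 < d -> narrow H M d (c + s)) ->
  regular H (c + s) -> H z = c -> H w = c -> Rabs (fst w - fst z) <= 1 ->
  Rabs (fst (g w) - fst (g z)) <= 4 * INR M + 8.
Proof.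
  intros Hn Hn' Hreg Hz Hw Hzw. apply Rabs_le; split.
  - assert (Hwz : Rabs (fst z - fst w) <= 1) by now rewrite Rabs_minus_sym.
    pose proof (fibre_deviation_le M c w z Hn Hn' Hreg Hw Hz Hwz); lra.
  - now apply fibre_deviation_le with c.
Qed.
End Deviation.

(** * Extremal drifts of a cocycle *)

Section Drift.
Variables (T : R * R -> R * R) (D : nat -> R * R -> R) (K : R).
Hypotheses (HD0 : forall z, D O z = 0)
  (HDadd : forall n m z, D (n + m)%nat z = D n z + D m (Nat.iter n T z))
  (HDK : forall z, Rabs (D 1%nat z) <= K).

Lemma drift_bound n z : Rabs (D n z) <= INR n * K.
Proof.
  induction n as [|n IH]; [simpl; rewrite HD0, Rabs_R0; lra|].
  rewrite S_INR. replace (S n) with (n + 1)%nat by lia. rewrite HDadd.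
  eapply Rle_trans; [apply Rabs_triang|]. specialize (HDK (Nat.iter n T z)); lra.
Qed.

Lemma drift_K_pos : 0 <= K.
Proof. pose proof (HDK (0, 0)); pose proof (Rabs_pos (D 1%nat (0, 0))); lra. Qed.

Lemma drift_multiple n b : (forall z, D n z <= b) -> forall q z, D (q * n)%nat z <= INR q * b.
Proof.
  intros Hb; induction q as [|q IH]; intros z.
  - simpl; rewrite HD0; lra.
  - replace (S q * n)%nat with (n + q * n)%nat by lia. rewrite HDadd, S_INR.
    specialize (Hb z); specialize (IH (Nat.iter n T z)); lra.
Qed.

(** [beta] is the infimum of the slopes that bound [D] up to a constant, with signs reversed to use
    a supremum. If [D n] stayed below [n * (beta - e)] everywhere for a single [n], division of an
    arbitrary time by [n] would give a smaller admissible slope. *)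
Lemma maximal_drift : exists beta,
  (forall e, 0 < e -> exists C, forall n z, D n z <= INR n * (beta + e) + C) /\
  (forall e n, 0 < e -> (1 <= n)%nat -> exists z, INR n * (beta - e) <= D n z).
Proof.
  set (E := fun b => exists C, forall n z, D n z <= INR n * (- b) + C).
  destruct (completeness E) as [s [Hub Hlub]].
  - exists (K + 1); intros b (C & HC). apply Rnot_lt_le; intros Hlt.
    destruct (exists_nat_above C) as [n Hn].
    specialize (HC n (0, 0)). pose proof (drift_bound n (0, 0)) as Hd.
    pose proof (Rle_abs (- D n (0, 0))); rewrite Rabs_Ropp in *. pose proof (pos_INR n). nra.
  - exists (- K), 0; intros n z. pose proof (drift_bound n z).
    pose proof (Rle_abs (D n z)). lra.
  - exists (- s); split.
    + intros e He. assert (Hx : exists b, E b /\ s - e < b).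
      { apply NNPP; intros Hn. assert (s <= s - e); [|lra]. apply Hlub; intros b Hb.
        apply Rnot_lt_le; intros Hlt; apply Hn; eauto. }
      destruct Hx as (b & (C & HC) & Hb). exists C; intros n z.
      eapply Rle_trans; [apply HC|]. pose proof (pos_INR n). nra.
    + intros e n He Hn. apply NNPP; intros Hno.
      assert (Hb : forall z, D n z <= INR n * (- s - e)).
      { intros z; apply Rnot_lt_le; intros Hlt; apply Hno; exists z; lra. }
      assert (HE : E (s + e)); [|specialize (Hub _ HE); lra].
      exists (INR n * (K + Rabs (s + e))); intros m z.
      pose proof (Nat.div_mod m n ltac:(lia)) as Hm.
      assert (Hr : (m mod n <= n)%nat) by (pose proof (Nat.mod_upper_bound m n); lia).
      set (q := (m / n)%nat) in *. set (r := (m mod n)%nat) in *.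
      rewrite Hm, Nat.mul_comm, HDadd, plus_INR, mult_INR.
      pose proof (drift_multiple n _ Hb q z) as B1.
      pose proof (drift_bound r (Nat.iter (q * n) T z)) as B2.
      pose proof (Rle_abs (D r (Nat.iter (q * n) T z))).
      pose proof drift_K_pos. apply le_INR in Hr. pose proof (pos_INR r).
      pose proof (Rle_abs (s + e)); pose proof (Rabs_pos (s + e)). nra.
Qed.

(** In the sum of the drifts over time [N] along the orbit, each unit step is counted [N] times,
    except near the two ends; the error bound does not depend on [n]. *)
Lemma sum_of_drifts N n z : Rabs (sum_f_R0 (fun j => D N (Nat.iter j T z)) n - INR N * D (S n) z)
  <= 2 * INR N * INR N * K.
Proof.
  pose proof drift_K_pos as HK0.
  induction N as [|N IH].
  - simpl. rewrite (sum_eq _ (fun _ => 0)) by (intros; apply HD0).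
    rewrite sum_eq_R0 by auto. replace (0 - 0 * D (S n) z) with 0 by ring. rewrite Rabs_R0; lra.
  - assert (E : sum_f_R0 (fun j => D (S N) (Nat.iter j T z)) n =
      sum_f_R0 (fun j => D N (Nat.iter j T z)) n + (D (S n) z + D N (Nat.iter (S n) T z) - D N z)).
    { rewrite (sum_eq _ (fun j => D N (Nat.iter j T z) + D 1%nat (Nat.iter (N + j) T z))).
      - rewrite sum_plus. f_equal.
        assert (Hs : forall k, sum_f_R0 (fun j => D 1%nat (Nat.iter (N + j) T z)) k = D (S k) (Nat.iter N T z)).
        { induction k as [|k IHk]; [simpl; now rewrite Nat.add_0_r|].
          rewrite tech5, IHk. replace (S (S k)) with (S k + 1)%nat by lia. rewrite HDadd.
          rewrite <- Nat.iter_add. now replace (S k + N)%nat with (N + S k)%nat by lia. }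
        rewrite Hs. pose proof (HDadd N (S n) z) as A1. pose proof (HDadd (S n) N z) as A2.
        rewrite Nat.add_comm in A2. lra.
      - intros j _. replace (S N) with (N + 1)%nat at 1 by lia. rewrite HDadd, <- Nat.iter_add. reflexivity. }
    rewrite E, S_INR.
    replace (_ - _) with ((sum_f_R0 (fun j => D N (Nat.iter j T z)) n - INR N * D (S n) z) +
      (D N (Nat.iter (S n) T z) - D N z)) by ring.
    eapply Rle_trans; [apply Rabs_triang|].
    pose proof (Rabs_triang (D N (Nat.iter (S n) T z)) (- D N z)). rewrite Rabs_Ropp in *.
    pose proof (drift_bound N z); pose proof (drift_bound N (Nat.iter (S n) T z)).
    pose proof (pos_INR N). unfold Rminus in *. nra.
Qed.

Definition indicator (P : Prop) : R := if excluded_middle_informative P then 1 else 0.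

Lemma indicator_true (P : Prop) : P -> indicator P = 1.
Proof. intros HP; unfold indicator; destruct (excluded_middle_informative P); tauto. Qed.

Lemma indicator_false (P : Prop) : ~ P -> indicator P = 0.
Proof. intros HP; unfold indicator; destruct (excluded_middle_informative P); tauto. Qed.

Definition visits (V : R -> Prop) (rho xi : R) (n : nat) : R :=
  sum_f_R0 (fun j => indicator (V (xi + INR j * rho))) n.

(** The starting point may depend on [n], because an orbit segment that realises the maximal drift
    is chosen for its length. *)
Definition rarely_visited (rho : R) (V : nat -> R -> Prop) : Prop :=
  forall kappa, 0 < kappa -> exists N0, forall N, (N0 <= N)%nat -> exists C, forall n,
    exists xi, visits (V N) rho xi n <= kappa * INR n + C.

(* An orbit segment realising the maximal drift can only rarely visit fibres on which the drift
   over time [N] is definitely smaller. *)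
Lemma slow_fibres_rarely_visited (H : R * R -> R) rho beta theta : 0 < theta ->
  (forall z, H (T z) = H z + rho) ->
  (forall e, 0 < e -> exists C, forall n z, D n z <= INR n * (beta + e) + C) ->
  (forall e n, 0 < e -> (1 <= n)%nat -> exists z, INR n * (beta - e) <= D n z) ->
  rarely_visited rho (fun N c => forall z, H z = c -> D N z < INR N * (beta - theta)).
Proof.
  intros Hth HT Hup Hlow kappa Hka.
  (* The upper estimate on [D N] loses [2 e] per unit of time, one [e] of it absorbing [C0] for [N]
     large, and the lower estimate along the orbit loses [e]: together [3 e = kappa * theta]. *)
  set (e := kappa * theta / 3).
  assert (He : 0 < e) by (unfold e; nra).
  destruct (Hup e He) as [C0 HC0].
  destruct (exists_nat_above (Rabs C0 / e)) as [N0 HN0].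
  exists (S N0); intros N HN.
  assert (HNC : Rabs C0 <= INR N * e).
  { apply Rmult_le_reg_r with (/ e); [now apply Rinv_0_lt_compat|].
    rewrite Rmult_assoc, Rinv_r, Rmult_1_r by lra. apply le_INR in HN. rewrite S_INR in HN.
    unfold Rdiv in HN0; lra. }
  assert (HN1 : 1 <= INR N) by (apply (le_INR 1 N); lia).
  assert (HD2 : forall z, D N z <= INR N * (beta + 2 * e)).
  { intros z; specialize (HC0 N z); pose proof (Rle_abs C0); lra. }
  set (V := fun c => forall z, H z = c -> D N z < INR N * (beta - theta)).
  exists (kappa + 2 * INR N * K / theta); intros n.
  destruct (Hlow e (S n) He ltac:(lia)) as [z Hz].
  exists (H z).
  assert (HTn : forall j, H (Nat.iter j T z) = H z + INR j * rho).
  { induction j as [|j IH]; [simpl; ring|]. rewrite S_INR. cbn [Nat.iter nat_rect]. fold (Nat.iter j T z).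
    rewrite HT, IH; ring. }
  assert (Hpt : forall j, D N (Nat.iter j T z) <=
    INR N * (beta + 2 * e) - INR N * theta * indicator (V (H z + INR j * rho))).
  { intros j. destruct (classic (V (H z + INR j * rho))) as [HV | HV].
    - rewrite indicator_true by assumption. specialize (HV _ (HTn j)). nra.
    - rewrite indicator_false by assumption. specialize (HD2 (Nat.iter j T z)). lra. }
  pose proof (sum_Rle _ _ n (fun j _ => Hpt j)) as Hsum.
  rewrite minus_sum, sum_cte in Hsum.
  assert (Hs : sum_f_R0 (fun j => INR N * theta * indicator (V (H z + INR j * rho))) n =
    INR N * theta * visits V rho (H z) n).
  { unfold visits. rewrite scal_sum. apply sum_eq; intros; ring. }
  rewrite Hs in Hsum.
  pose proof (sum_of_drifts N n z) as Hd.
  pose proof (Rle_abs (- (sum_f_R0 (fun j => D N (Nat.iter j T z)) n - INR N * D (S n) z))).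
  rewrite Rabs_Ropp in *.
  rewrite S_INR in Hz, Hsum. pose proof (pos_INR n).
  assert (Hv : INR N * theta * visits V rho (H z) n <=
    INR N * ((INR n + 1) * (3 * e) + 2 * INR N * K)).
  { assert (INR N * ((INR n + 1) * (beta - e)) <= INR N * D (S n) z) by (apply Rmult_le_compat_l; lra).
    nra. }
  rewrite Rmult_assoc in Hv. apply Rmult_le_reg_l in Hv; [|lra].
  apply Rmult_le_reg_l with theta; [assumption|].
  replace (theta * (kappa * INR n + (kappa + 2 * INR N * K / theta))) with
    ((INR n + 1) * (kappa * theta) + 2 * INR N * K) by (field; lra).
  unfold e in Hv. lra.
Qed.
End Drift.

(** * Lebesgue measure on the circle *)

(** [m A] stands for the Lebesgue measure of the trace of [A] on [[0, 1)], so it is rotation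
    invariant on 1-periodic sets. [cm_null] is the link with the outer measure [OM_le]. *)
Record circle_measure (Mb : (R -> Prop) -> Prop) (m : (R -> Prop) -> R) : Prop := {
  cm_open : forall A, R_open A -> Mb A;
  cm_compl : forall A, Mb A -> Mb (fun x => ~ A x);
  cm_union : forall A : nat -> R -> Prop, (forall n, Mb (A n)) -> Mb (fun x => exists n, A n x);
  cm_shift : forall A s, Mb A -> Mb (fun x => A (x + s));
  cm_ge0 : forall A, 0 <= m A;
  cm_full : m (fun _ => True) = 1;
  cm_add : forall A B, Mb A -> Mb B -> (forall x, ~ (A x /\ B x)) ->
    m (fun x => A x \/ B x) = m A + m B;
  cm_invariant : forall A s, Mb A -> (forall x, A (x + 1) <-> A x) ->
    m (fun x => A (x + s)) = m A;
  cm_lim : forall (A : nat -> R -> Prop) k, (forall n, Mb (A n)) ->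
    (forall n x, A n x -> A (S n) x) ->
    k < m (fun x => exists n, A n x) -> exists n, k < m (A n);
  cm_countable : forall u : nat -> R, m (fun x => exists n, x = u n) = 0;
  cm_null : forall A, Mb A -> m A = 0 -> OM_le (fun x => 0 <= x < 1 /\ A x) 0 }.

Module LebesgueCircle.
Import all_boot all_order all_algebra.
Import all_classical all_reals all_analysis measurable_realfun.
Import Rstruct Rstruct_topology.
Import Order.TTheory GRing.Theory Num.Theory.
Import numFieldNormedType.Exports.
Local Open Scope classical_set_scope.
Local Open Scope ring_scope.

Section Circle.
Context {R : realType}.
Implicit Types (A B : set R) (s t : R).
Notation leb := (@lebesgue_measure R).
Notation mR := (measurableTypeR R).

Definition shift (s : R) : mR -> mR := fun x => x + s.

Lemma measurable_shift s : measurable_fun setT (shift s).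
Proof. by apply: measurable_funD. Qed.


(** The push-forward under the translation agrees with Lebesgue measure on half-open intervals,
    hence everywhere by uniqueness. *)
Lemma lebesgue_shift s (A : set mR) : measurable A -> leb (shift s @^-1` A) = leb A.
Proof.
move=> mA; apply: esym.
pose m := measure_function_pushforward__canonical__measure_function_Measure leb (measurable_shift s).
apply: (@lebesgue_measure_unique R m) => [X|]; last exact: mA.
rewrite /m /=; case/ocitvP => [->|[[a b] /= ab ->]].
  by rewrite /pushforward preimage_set0 !measure0.
rewrite /pushforward.
have -> : shift s @^-1` `]a, b] = `]a - s, b - s]%classic.
  apply/seteqP; split => x /=; rewrite !in_itv/= /shift ltrBlDr lerBrDr //.
rewrite !lebesgue_measure_itv /= !lte_fin ab ltrD2r ab.
by rewrite -!EFinB; congr (_%:E); rewrite opprB addrA subrK.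
Qed.

Definition fund : set mR := `[0, 1[%classic.
Definition circ (A : set mR) : R := fine (leb (A `&` fund)).

Lemma measurable_fund : measurable fund.
Proof. exact: measurable_itv. Qed.

Lemma leb_fund : leb fund = 1%:E.
Proof. by rewrite lebesgue_measure_itv/= lte01 oppr0 adde0. Qed.

Lemma circ_E (A : set mR) : measurable A -> leb (A `&` fund) = (circ A)%:E.
Proof.
move=> mA; rewrite /circ fineK// ge0_fin_numE ?measure_ge0//.
apply: le_lt_trans (_ : leb fund < +oo)%E; last by rewrite leb_fund ltry.
apply: le_measure; rewrite ?inE; [|exact: measurable_fund|exact: subIsetr].
by apply: measurableI => //; exact: measurable_fund.
Qed.

Lemma circ_ge0 (A : set mR) : 0 <= circ A.
Proof. exact/fine_ge0/measure_ge0. Qed.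

Lemma circ_setT : circ setT = 1.
Proof. by rewrite /circ setTI leb_fund. Qed.

Lemma circU (A B : set mR) : measurable A -> measurable B ->
  A `&` B `<=` set0 -> circ (A `|` B) = circ A + circ B.
Proof.
move=> mA mB AB0.
have mf := measurable_fund.
apply: EFin_inj; rewrite EFinD -!circ_E//; last exact: measurableU.
rewrite setIUl measureU//; [exact: measurableI|exact: measurableI|].
by apply/seteqP; split => // x [[Ax _] [Bx _]]; apply: (AB0 x).
Qed.

Lemma circ_mono_lim (A : (set mR)^nat) (k : R) :
  (forall n, measurable (A n)) -> (forall n, A n `<=` A n.+1) ->
  k < circ (\bigcup_n A n) -> exists n, k < circ (A n).
Proof.
move=> mA sA kA.
have mU : measurable (\bigcup_n A n) by exact: bigcupT_measurable.
have cv : (leb \o (fun n => A n `&` fund)) @ \oo --> leb (\bigcup_n A n `&` fund).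
  rewrite setI_bigcupl; apply: nondecreasing_cvg_mu.
  - by move=> i; apply: measurableI => //; exact: measurable_fund.
  - by rewrite -setI_bigcupl; apply: measurableI => //; exact: measurable_fund.
  - by apply/nondecreasing_seqP => n; apply/subsetPset; apply: setSI.
apply/not_existsP => H.
have : (leb (\bigcup_n A n `&` fund) <= k%:E)%E.
  apply: (cvge_to_le cv).
  by apply: nearW => n /=; rewrite circ_E// lee_fin leNgt; apply/negP/H.
by rewrite circ_E// lee_fin leNgt kA.
Qed.

Definition window (s : R) : set mR := `[s, s + 1[%classic.

Lemma measurable_window s : measurable (window s).
Proof. exact: measurable_itv. Qed.

(** For an offset in [[0, 1)] the window is cut at 1 and the part beyond 1 is moved back by a unit;
    integer shifts reduce every [s] to this case. *)
Lemma leb_window (A : set mR) (s : R) : measurable A ->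
  (forall x, A (x + 1) <-> A x) -> leb (A `&` window s) = leb (A `&` fund).
Proof.
move=> mA pA.
have unit_shift a b : leb (A `&` `[a + 1, b + 1[) = leb (A `&` `[a, b[).
  rewrite -(lebesgue_shift 1); last by apply: measurableI => //; exact: measurable_itv.
  congr (leb _); apply/seteqP; split => x /=; rewrite /shift !in_itv/= lerD2r ltrD2r.
    by move=> [/pA].
  by move=> [/pA].
have step t : leb (A `&` window (t + 1)) = leb (A `&` window t) by exact: unit_shift.
have stepn n t : leb (A `&` window (t + n%:R)) = leb (A `&` window t).
  elim: n t => [|n IH] t; first by rewrite mulr0n addr0.
  by rewrite -natr1 addrA step IH.
have small r : 0 <= r < 1 -> leb (A `&` window r) = leb (A `&` fund).
  move=> /andP[r0 r1].
  have mI a b : measurable (A `&` `[a, b[ : set mR).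
    by apply: measurableI => //; exact: measurable_itv.
  have cut a b c : a <= b -> b <= c ->
      leb (A `&` `[a, c[) = (leb (A `&` `[a, b[) + leb (A `&` `[b, c[))%E.
    move=> ab bc.
    have dis : (A `&` `[a, b[) `&` (A `&` `[b, c[) = set0.
      apply/seteqP; split => // x [[_ xab] [_ xbc]] /=.
      move: xab xbc; rewrite /= !in_itv/= => /andP[_ xb] /andP[bx _].
      by move: (lt_le_trans xb bx); rewrite ltxx.
    rewrite -(measureU _ (mI a b) (mI b c) dis).
    congr (leb _); apply/seteqP; split => x /=; rewrite !in_itv/=.
      move=> [Ax /andP[ax xc]]; have [xb|bx] := ltP x b.
        by left; rewrite ax.
      by right; rewrite xc.
    by move=> [|] [Ax /andP[h1 h2]]; rewrite ?h1 ?h2 ?(lt_le_trans h2 bc) ?(le_trans ab h1).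
  rewrite /window (cut r 1 (r + 1)) ?(ltW r1)// ?lerDr//.
  have -> : leb (A `&` `[1, r + 1[) = leb (A `&` `[0, r[).
    by rewrite -(unit_shift 0 r) add0r.
  by rewrite addeC /fund (cut 0 r 1) ?(ltW r1).
have pos t : 0 <= t -> leb (A `&` window t) = leb (A `&` fund).
  move=> t0; have /andP[h1 h2] := Num.Theory.truncn_itv t0.
  rewrite -(small (t - (Num.truncn t)%:R)); last first.
    by rewrite subr_ge0 h1 ltrBlDr addrC natr1.
  by rewrite -[in LHS](subrK (Num.truncn t)%:R t) stepn.
have [s0|/ltW s0] := leP 0 s; first exact: pos.
rewrite -(stepn (Num.bound (- s)) s) pos// -lerBlDl sub0r.
by apply/ltW/archi_boundP; rewrite oppr_ge0.
Qed.

Lemma circ_shift (A : set mR) (s : R) : measurable A ->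
  (forall x, A (x + 1) <-> A x) -> circ (shift s @^-1` A) = circ A.
Proof.
move=> mA pA; rewrite /circ -(leb_window A s mA pA).
rewrite -(lebesgue_shift s _ (measurableI _ _ mA (measurable_window s))).
congr (fine (leb _)); apply/seteqP; split => x /=; rewrite /shift /fund /window /= !in_itv/=.
  by move=> [Ax /andP[h1 h2]]; split=> //; rewrite lerDr h1 [x + s]addrC ltrD2l.
by rewrite lerDr [X in _ < X]addrC ltrD2r.
Qed.

Lemma circ_countable (u : nat -> R) : circ [set x | exists n, x = u n] = 0.
Proof.
have -> : [set x | exists n, x = u n] = range u.
  by apply/seteqP; split => x [n] /=; [exists n|exists n].
rewrite /circ (_ : leb _ = 0%E)//.
apply: countable_lebesgue_measure0.
apply: (sub_countable (B := [set: nat])); last exact: countableP.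
by apply: card_le_trans (card_image_le _ _); apply: subset_card_le; apply: subIsetl.
Qed.

End Circle.

Local Notation R := Rdefinitions.R.

Lemma open_of_R_open (A : R -> Prop) : Defs.R_open A -> open (A : set R).
Proof.
move=> oA; rewrite openE => x /oA [e [/RltP e0 H]].
apply/nbhs_ballP; exists e => //= y; rewrite /ball /= => xy.
by apply: H; rewrite RabsE RminusE distrC; apply/RltP.
Qed.

Lemma OM_le_of_circ0 (A : set (measurableTypeR R)) : measurable A -> circ A = 0 ->
  OM_le (fun x => (0 <= x < 1)%coqR /\ A x) 0%coqR.
Proof.
move=> mA A0 eps /RltP eps0.
pose l := @wlength R idfun.
have E0 : lebesgue_measure (A `&` fund) = 0%E by rewrite circ_E// A0.
have : (l^* (A `&` fund))%mu = 0%E by exact: E0.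
rewrite outer_measure_open_itv_cover => inf0.
have : ereal_inf [set (\sum_(k <oo) l (F k))%E | F in open_itv_cover (A `&` fund)] \is a fin_num.
  by rewrite inf0.
move=> /lb_ereal_inf_adherent-/(_ _ eps0)[_/= [F [Fitv AF] <-]].
rewrite inf0 add0e => Fe.
have [ab Fab] := choice Fitv.
(* An empty interval of the cover may have its endpoints in the wrong order; the maximum makes it
   degenerate, as [OM_le] asks for [a n <= b n]. *)
exists (fun n => (ab n).1), (fun n => Num.max (ab n).1 (ab n).2); split.
  by move=> n; apply/RleP; rewrite le_max lexx.
split.
  move=> x [[/RleP x0 /RltP x1] Ax].
  have [|n _] := AF x; first by split=> //; rewrite /fund /= in_itv/= x0.
  rewrite Fab /= in_itv /= => /andP[h1 h2]; exists n; split; apply/RltP => //.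
  by rewrite lt_max h2 orbT.
move=> N; rewrite sum_f_R0E RplusE add0r; apply/RleP.
have le_l n : (((Num.max (ab n).1 (ab n).2 - (ab n).1)%R)%:E <= l (F n))%E.
  rewrite Fab /l wlength_itv /= lte_fin; case: ltP => h.
    by rewrite -EFinB lee_fin.
  by rewrite subrr.
rewrite -lee_fin -sumEFin.
apply: le_trans (ltW Fe).
have l0 k : (0 <= k)%N -> xpredT k -> (0 <= l (F k))%E.
  by move=> _ _; apply: le_trans (le_l k); rewrite lee_fin subr_ge0 le_max lexx.
apply: (@le_trans _ _ (\sum_(0 <= k < N.+1) l (F k))%E); last exact: nneseries_lim_ge.
by apply: lee_sum => i _; exact: le_l.
Qed.
Lemma circle_measure_exists : exists Mb m, circle_measure Mb m.
Proof.
exists (fun A : R -> Prop => measurable (A : set (measurableTypeR R))), (@circ R); split.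
- by move=> A /open_of_R_open; exact: open_measurable.
- by move=> A mA; exact: measurableC.
- move=> A mA.
  have -> : (fun x => exists n, A n x) = \bigcup_n A n :> set R.
    by apply/seteqP; split => x [n]; exists n.
  exact: bigcupT_measurable.
- by move=> A s mA; rewrite -[X in measurable X]setTI; exact: measurable_shift.
- by move=> A; apply/RleP; exact: circ_ge0.
- exact: circ_setT.
- by move=> A B mA mB AB0; apply: circU => // x /AB0.
- by move=> A s mA pA; exact: circ_shift.
- move=> A k mA sA /RltP kA.
  have UE : \bigcup_n A n = (fun x => exists n, A n x) :> set R.
    by apply/seteqP; split => x [n]; exists n.
  have [|n /RltP kn] := circ_mono_lim A k mA sA; first by rewrite UE.
  by exists n.
- exact: circ_countable.
- exact: OM_le_of_circ0.
Qed.
End LebesgueCircle.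

(** * Recurrence for an irrational rotation *)

Lemma irrational_not_int rho q : irrational rho -> (1 <= q)%nat -> ~ is_int (INR q * rho).
Proof.
  intros Hirr Hq [k Hk]. apply (Hirr k (Z.of_nat q)); [lia|].
  rewrite <- INR_IZR_INZ. apply (le_INR 1) in Hq; simpl in Hq. rewrite <- Hk; field; lra.
Qed.

Lemma Rabs_sign t : exists sg : Z, (sg = 1 \/ sg = -1)%Z /\ Rabs (IZR sg) = 1 /\ t = IZR sg * Rabs t.
Proof.
  destruct (Rle_or_lt 0 t) as [Ht | Ht].
  - exists 1%Z; rewrite Rabs_R1, (Rabs_pos_eq t) by assumption. split; [now left | split; ring].
  - exists (-1)%Z; rewrite (Rabs_left t), (Rabs_left (-1)) by lra. split; [now right | split; ring].
Qed.

(** A return at distance [d < 1] has a multiple that returns within [d / 2], and irrationality keeps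
    all distances positive; so the distance can be halved repeatedly. *)
Lemma small_return rho e : irrational rho -> 0 < e ->
  exists (q : nat) (l : Z), (1 <= q)%nat /\ 0 < Rabs (INR q * rho - IZR l) < e.
Proof.
  intros Hirr He.
  assert (A : forall n : nat, exists (q : nat) (l : Z), (1 <= q)%nat /\
    0 < Rabs (INR q * rho - IZR l) /\ Rabs (INR q * rho - IZR l) * 2 ^ n < 1).
  { induction n as [|n (q & l & Hq & H1 & H2)].
    - exists 1%nat, (Int_part rho). destruct (base_fp rho) as [B1 B2]. unfold frac_part in *. simpl.
      rewrite !Rmult_1_l, Rmult_1_r.
      assert (N : rho - IZR (Int_part rho) <> 0).
      { intros E. apply (irrational_not_int rho 1 Hirr (le_n _)). exists (Int_part rho); simpl; lra. }
      split; [lia|]; split; [now apply Rabs_pos_lt|]. apply Rabs_def1; lra.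
    - set (t := INR q * rho - IZR l) in *. set (d := Rabs t) in *.
      assert (Hpow : 1 <= 2 ^ n) by (apply pow_R1_Rle; lra).
      assert (Hd1 : d < 1) by nra.
      (* [m d - 1] and [1 - (m - 1) d] add up to [d], so one of them is at most [d / 2]. *)
      destruct (archimed (/ d)) as [U1 U2]. set (m := Z.to_nat (up (/ d))) in *.
      assert (Hinv : 1 < / d) by (rewrite <- Rinv_1; apply Rinv_lt_contravar; lra).
      assert (Hm : IZR (up (/ d)) = INR m).
      { unfold m; rewrite INR_IZR_INZ, Z2Nat.id; [reflexivity|]. apply le_IZR; lra. }
      rewrite Hm in U1, U2.
      assert (Hmd : 0 <= INR m * d - 1 <= d).
      { assert (E : / d * d = 1) by (field; lra). split; nra. }
      assert (Hm2 : (2 <= m)%nat) by (apply (INR_lt 1) ; simpl; lra).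
      destruct (Rabs_sign t) as (sg & Hsg & Hsg1 & Ht). fold d in Ht.
      assert (Hgen : forall j : nat, (1 <= j)%nat -> Rabs (INR j * d - 1) <= d / 2 ->
        exists (q : nat) (l : Z), (1 <= q)%nat /\
        0 < Rabs (INR q * rho - IZR l) /\ Rabs (INR q * rho - IZR l) * 2 ^ S n < 1).
      { intros j Hj Hjd. exists (j * q)%nat, (Z.of_nat j * l + sg)%Z.
        assert (Hjq : (1 <= j * q)%nat) by nia.
        assert (E : INR (j * q) * rho - IZR (Z.of_nat j * l + sg) = IZR sg * (INR j * d - 1)).
        { rewrite mult_INR, plus_IZR, mult_IZR, <- INR_IZR_INZ.
          replace (INR j * INR q * rho) with (INR j * (t + IZR l)) by (unfold t; ring).
          rewrite Ht; ring. }
        split; [assumption|]; split.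
        - apply Rabs_pos_lt. intros E0. apply (irrational_not_int rho (j * q) Hirr Hjq).
          exists (Z.of_nat j * l + sg)%Z; lra.
        - rewrite E, Rabs_mult, Hsg1. simpl; nra. }
      destruct (Rle_or_lt (INR m * d - 1) (d / 2)) as [Hs | Hs].
      + apply (Hgen m); [lia|]. rewrite Rabs_pos_eq; lra.
      + apply (Hgen (m - 1)%nat); [lia|]. rewrite minus_INR by lia. simpl (INR 1). apply Rabs_le; lra. }
  destruct (Pow_x_infinity 2) with (b := / e) as [n Hn]; [rewrite Rabs_pos_eq; lra|].
  destruct (A n) as (q & l & Hq & H1 & H2). exists q, l; repeat split; try assumption.
  specialize (Hn n (le_n _)). rewrite Rabs_pos_eq in Hn by (apply pow_le; lra).
  assert (Hp : / e * e = 1) by (field; lra).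
  apply Rnot_le_lt; intros Hle.
  assert (0 < / e) by now apply Rinv_0_lt_compat.
  assert (e * / e <= e * 2 ^ n) by (apply Rmult_le_compat_l; lra).
  assert (e * 2 ^ n <= Rabs (INR q * rho - IZR l) * 2 ^ n) by (apply Rmult_le_compat_r; lra).
  lra.
Qed.

(** The multiples of one small return form a net of mesh below [e], and a fixed number of them goes
    once round the circle from any starting point. *)
Lemma uniform_density rho e : irrational rho -> 0 < e ->
  exists K : nat, forall x y, exists (k : nat) (l : Z), (k <= K)%nat /\
    Rabs (x + INR k * rho - y - IZR l) < e.
Proof.
  intros Hirr He. destruct (small_return rho e Hirr He) as (q & l & Hq & H1 & H2).
  set (t := INR q * rho - IZR l) in *. set (d := Rabs t) in *.
  destruct (exists_nat_above (/ d)) as [m Hm].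
  assert (Hmd : 1 < INR m * d) by (assert (E : / d * d = 1) by (field; lra); nra).
  exists (m * q)%nat; intros x y.
  destruct (Rabs_sign t) as (sg & Hsg & Hsg1 & Ht). fold d in Ht.
  (* The way to the target is measured in the direction of the small return and reduced modulo 1, so
     that a nonnegative number of steps covers it. *)
  destruct (exists_int_below (IZR sg * (y - x))) as [k0 Hk0].
  set (g := IZR sg * (y - x) + IZR k0) in *.
  assert (Hj : exists j : nat, (j <= m)%nat /\ 0 <= g - INR j * d < d).
  { assert (Hind : forall n : nat, g < INR n * d -> exists j : nat, (j < n)%nat /\ 0 <= g - INR j * d < d).
    { induction n as [|n IH]; intros Hn; [simpl in Hn; lra|].
      destruct (Rlt_le_dec g (INR n * d)) as [Hlt | Hge].
      - destruct (IH Hlt) as (j & Hj & Hjd). exists j; split; [lia | assumption].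
      - exists n; split; [lia|]. rewrite S_INR in Hn; lra. }
    destruct (Hind m) as (j & Hj & Hjd); [lra|]. exists j; split; [lia | assumption]. }
  destruct Hj as (j & Hjm & Hjd).
  exists (j * q)%nat, (Z.of_nat j * l + sg * k0)%Z; split; [nia|].
  replace (x + INR (j * q) * rho - y - IZR (Z.of_nat j * l + sg * k0)) with (- IZR sg * (g - INR j * d)).
  - rewrite Rabs_mult, Rabs_Ropp, Hsg1, Rabs_pos_eq; lra.
  - rewrite plus_IZR, !mult_IZR, <- INR_IZR_INZ, mult_INR.
    replace (INR j * INR q * rho) with (INR j * (t + IZR l)) by (unfold t; ring). rewrite Ht.
    unfold g. destruct Hsg as [-> | ->]; ring.
Qed.

Definition periodic (A : R -> Prop) : Prop := forall (k : Z) x, A (x + IZR k) <-> A x.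

Section CircleMeasure.
Variables (Mb : (R -> Prop) -> Prop) (m : (R -> Prop) -> R) (cm : circle_measure Mb m).

Lemma set_ext (A B : R -> Prop) : (forall x, A x <-> B x) -> A = B.
Proof.
  intros HAB; apply functional_extensionality; intros x; apply propositional_extensionality, HAB.
Qed.

Lemma Mb_full : Mb (fun _ => True).
Proof. apply (cm_open _ _ cm); intros x _; exists 1; split; [lra | auto]. Qed.

Lemma Mb_empty : Mb (fun _ => False).
Proof.
  replace (fun _ : R => False) with (fun _ : R => ~ True) by (apply set_ext; tauto).
  apply (cm_compl _ _ cm), Mb_full.
Qed.

Lemma Mb_or A B : Mb A -> Mb B -> Mb (fun x => A x \/ B x).
Proof.
  intros HA HB.
  replace (fun x => A x \/ B x) with (fun x => exists n : nat, (match n with O => A | _ => B end) x).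
  - apply (cm_union _ _ cm). now intros [|n].
  - apply set_ext; intros x; split.
    + intros [[|n] Hn]; auto.
    + intros [Hx | Hx]; [now exists O | now exists 1%nat].
Qed.

Lemma Mb_and A B : Mb A -> Mb B -> Mb (fun x => A x /\ B x).
Proof.
  intros HA HB.
  replace (fun x => A x /\ B x) with (fun x => ~ (~ A x \/ ~ B x)) by (apply set_ext; intros; tauto).
  apply (cm_compl _ _ cm), Mb_or; now apply (cm_compl _ _ cm).
Qed.

Lemma Mb_inter (A : nat -> R -> Prop) : (forall n, Mb (A n)) -> Mb (fun x => forall n, A n x).
Proof.
  intros HA.
  replace (fun x => forall n, A n x) with (fun x => ~ (exists n, ~ A n x)).
  - apply (cm_compl _ _ cm), (cm_union _ _ cm). intros n; now apply (cm_compl _ _ cm).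
  - apply set_ext; intros x; split; [intros Hx n; apply NNPP; eauto | intros Hx (n & Hn); auto].
Qed.

Lemma Mb_point a : Mb (fun x => x = a).
Proof.
  replace (fun x => x = a) with (fun x => ~ (x <> a)) by (apply set_ext; intros; tauto).
  apply (cm_compl _ _ cm), (cm_open _ _ cm). intros x Hx. exists (Rabs (x - a)).
  split; [apply Rabs_pos_lt; lra|]; intros y Hy E; subst y.
  rewrite Rabs_minus_sym in Hy; lra.
Qed.

Lemma m_empty : m (fun _ => False) = 0.
Proof.
  pose proof (cm_add _ _ cm _ _ Mb_empty Mb_empty ltac:(tauto)) as E.
  cbv beta in E. replace (fun _ : R => False \/ False) with (fun _ : R => False) in E by (apply set_ext; tauto). lra.
Qed.

Lemma m_split A B : Mb A -> Mb B -> m A = m (fun x => A x /\ B x) + m (fun x => A x /\ ~ B x).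
Proof.
  intros HA HB. rewrite <- (cm_add _ _ cm).
  - f_equal; apply set_ext; intros; tauto.
  - now apply Mb_and.
  - apply Mb_and; [assumption | now apply (cm_compl _ _ cm)].
  - intros; tauto.
Qed.

Lemma m_mono A B : Mb A -> Mb B -> (forall x, A x -> B x) -> m A <= m B.
Proof.
  intros HA HB HAB. rewrite (m_split B A HB HA).
  replace (fun x => B x /\ A x) with A by (apply set_ext; intros x; specialize (HAB x); tauto).
  pose proof (cm_ge0 _ _ cm (fun x => B x /\ ~ A x)); lra.
Qed.

Lemma m_or_le A B : Mb A -> Mb B -> m (fun x => A x \/ B x) <= m A + m B.
Proof.
  intros HA HB. rewrite (m_split (fun x => A x \/ B x) A) by auto using Mb_or.
  replace (fun x => (A x \/ B x) /\ A x) with A by (apply set_ext; intros; tauto).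
  apply Rplus_le_compat_l. apply m_mono; [| assumption | intros; tauto].
  apply Mb_and; [now apply Mb_or | now apply (cm_compl _ _ cm)].
Qed.

(** The integral of the multiplicity function over [S], handled without integrals: [S] is split
    along the last set of the family, and on the part inside it the bound for the others drops by
    1. *)
Lemma multiplicity_bound (A : nat -> R -> Prop) : (forall j, Mb (A j)) ->
  forall n S L, Mb S -> (forall x, S x -> sum_f_R0 (fun j => indicator (A j x)) n <= L) ->
  sum_f_R0 (fun j => m (fun x => A j x /\ S x)) n <= L * m S.
Proof.
  intros HA.
  assert (Hempty : forall S, Mb S -> (forall x, ~ S x) -> m S = 0).
  { intros S HS HS0. rewrite <- m_empty. f_equal; apply set_ext; intros x; specialize (HS0 x); tauto. }
  (* The splitting may produce an empty piece with a negative [L]. *)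
  assert (Hpos : forall S L, Mb S -> (forall x, S x -> 0 <= L) -> 0 <= L * m S).
  { intros S L HS HL. destruct (classic (exists x, S x)) as [[x Hx] | Hno].
    - apply Rmult_le_pos; [now apply (HL x) | apply (cm_ge0 _ _ cm)].
    - rewrite (Hempty S HS); [lra | intros x Hx; eauto]. }
  assert (Hstep : forall j S L, Mb S ->
    m (fun x => A j x /\ S x) + ((L - 1) * m (fun x => S x /\ A j x) + L * m (fun x => S x /\ ~ A j x)) = L * m S).
  { intros j S L HS. rewrite (m_split S (A j) HS (HA j)).
    replace (fun x => A j x /\ S x) with (fun x => S x /\ A j x) by (apply set_ext; intros; tauto). ring. }
  induction n as [|n IH]; intros S L HS HL.
  - simpl. rewrite <- (Hstep O S L HS).
    assert (M1 : Mb (fun x => S x /\ A O x)) by now apply Mb_and.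
    assert (M2 : Mb (fun x => S x /\ ~ A O x)) by (apply Mb_and; [|apply (cm_compl _ _ cm)]; auto).
    pose proof (Hpos _ (L - 1) M1) as P1. pose proof (Hpos _ L M2) as P2.
    assert (Q1 : 0 <= (L - 1) * m (fun x => S x /\ A O x)).
    { apply P1; intros x [Hx HAx]; specialize (HL x Hx); simpl in HL; rewrite indicator_true in HL; auto; lra. }
    assert (Q2 : 0 <= L * m (fun x => S x /\ ~ A O x)).
    { apply P2; intros x [Hx HAx]; specialize (HL x Hx); simpl in HL; rewrite indicator_false in HL; auto; lra. }
    lra.
  - rewrite tech5, <- (Hstep (Datatypes.S n) S L HS).
    assert (M1 : Mb (fun x => S x /\ A (Datatypes.S n) x)) by now apply Mb_and.
    assert (M2 : Mb (fun x => S x /\ ~ A (Datatypes.S n) x)) by (apply Mb_and; [|apply (cm_compl _ _ cm)]; auto).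
    assert (I1 := IH _ (L - 1) M1). assert (I2 := IH _ L M2).
    assert (Q1 : sum_f_R0 (fun j => m (fun x => A j x /\ S x /\ A (Datatypes.S n) x)) n <=
      (L - 1) * m (fun x => S x /\ A (Datatypes.S n) x)).
    { apply I1; intros x [Hx HAx]; specialize (HL x Hx); rewrite tech5, (indicator_true (A (Datatypes.S n) x)) in HL; auto; lra. }
    assert (Q2 : sum_f_R0 (fun j => m (fun x => A j x /\ S x /\ ~ A (Datatypes.S n) x)) n <=
      L * m (fun x => S x /\ ~ A (Datatypes.S n) x)).
    { apply I2; intros x [Hx HAx]; specialize (HL x Hx); rewrite tech5, (indicator_false (A (Datatypes.S n) x)) in HL; auto; lra. }
    assert (E : sum_f_R0 (fun j => m (fun x => A j x /\ S x)) n =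
      sum_f_R0 (fun j => m (fun x => A j x /\ S x /\ A (Datatypes.S n) x)) n +
      sum_f_R0 (fun j => m (fun x => A j x /\ S x /\ ~ A (Datatypes.S n) x)) n).
    { rewrite <- sum_plus. apply sum_eq; intros j _.
      rewrite (m_split (fun x => A j x /\ S x) (A (Datatypes.S n))) by auto using Mb_and.
      f_equal; f_equal; apply set_ext; intros; tauto. }
    lra.
Qed.

Lemma periodic_one A : periodic A -> forall x, A (x + 1) <-> A x.
Proof. intros HA x; exact (HA 1%Z x). Qed.

(* Weyl equidistribution in disguise: by density of the rotation orbits, rare visits along one
   orbit imply rare visits to a slightly smaller closed set along every orbit. *)
Lemma rarely_visited_small rho V kappa C : irrational rho -> R_open V -> periodic V ->
  (forall n, exists xi, visits V rho xi n <= kappa * INR n + C) -> m V <= kappa.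
Proof.
  intros Hirr HV HVp Hvis. apply Rnot_lt_le; intros Hlt.
  (* Closed sets increasing to the open set [V], so one of them still has measure above [kappa]. *)
  set (core := fun (j : nat) x => forall y, Rabs (y - x) < / INR (S j) -> V y).
  assert (Hinv : forall j, 0 < / INR (S j)) by (intros j; apply Rinv_0_lt_compat, lt_0_INR; lia).
  assert (Hcore : forall j, Mb (core j)).
  { intros j. replace (core j) with (fun x => ~ ~ core j x) by (apply set_ext; intros; tauto).
    apply (cm_compl _ _ cm), (cm_open _ _ cm). intros x Hx.
    unfold core in Hx. apply not_all_ex_not in Hx as [y Hy]. apply imply_to_and in Hy as [Hy HVy].
    exists (/ INR (S j) - Rabs (y - x)); split; [lra|]; intros x' Hx' Hcx'. apply HVy, Hcx'.
    replace (y - x') with ((y - x) + - (x' - x)) by ring.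
    eapply Rle_lt_trans; [apply Rabs_triang|]. rewrite Rabs_Ropp. lra. }
  destruct (cm_lim _ _ cm core kappa Hcore) as [j Hj].
  - intros j x Hx y Hy. apply Hx. eapply Rlt_trans; [exact Hy|].
    apply Rinv_lt_contravar; [|apply lt_INR; lia]. apply Rmult_lt_0_compat; apply lt_0_INR; lia.
  - replace (fun x => exists n, core n x) with V; [assumption|].
    apply set_ext; intros x; split.
    + intros Hx; destruct (HV x Hx) as (e & He & A).
      destruct (exists_nat_above (/ e)) as [n Hn]. exists n; intros y Hy; apply A.
      eapply Rlt_trans; [exact Hy|]. rewrite <- (Rinv_inv e).
      apply Rinv_lt_contravar; [|rewrite S_INR; lra].
      apply Rmult_lt_0_compat; [now apply Rinv_0_lt_compat | apply lt_0_INR; lia].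
    + intros [n Hx]. apply Hx. rewrite Rminus_diag, Rabs_R0; apply Hinv.
  - assert (Hcp : periodic (core j)).
    { intros k x; unfold core; split; intros Hx y Hy.
      - apply (HVp k), Hx. now replace (y + IZR k - (x + IZR k)) with (y - x) by ring.
      - replace y with ((y - IZR k) + IZR k) by ring. apply HVp, Hx.
        now replace (y - IZR k - x) with (y - (x + IZR k)) by ring. }
    destruct (uniform_density rho (/ INR (S j)) Hirr (Hinv j)) as [K HK].
    (* After at most [K] steps the orbit of [xi] is within [/ INR (S j)] of [x] modulo 1 and then
       shadows its orbit; each visit of the latter to the core is a visit of the former to [V]. *)
    assert (Hcount : forall n x, sum_f_R0 (fun i => indicator (core j (x + INR i * rho))) n <=
      kappa * INR (K + n) + C).
    { intros n x. destruct (Hvis (K + n)%nat) as [xi Hxi].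
      destruct (HK xi x) as (k & l & Hk & Hkl).
      eapply Rle_trans; [|exact Hxi]. unfold visits.
      assert (Hind : forall P : Prop, 0 <= indicator P) by
        (intros P; unfold indicator; destruct (excluded_middle_informative P); lra).
      assert (Hle : forall n, sum_f_R0 (fun i => indicator (core j (x + INR i * rho))) n <=
        sum_f_R0 (fun i => indicator (V (xi + INR i * rho))) (k + n)).
      { assert (Hterm : forall i, indicator (core j (x + INR i * rho)) <= indicator (V (xi + INR (k + i) * rho))).
        { intros i. destruct (classic (core j (x + INR i * rho))) as [Hc | Hc].
          - rewrite (indicator_true (V _)); [rewrite indicator_true; [lra | assumption]|].
            replace (xi + INR (k + i) * rho) with ((xi + INR (k + i) * rho - IZR l) + IZR l) by ring.
            apply HVp, Hc. rewrite plus_INR.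
            now replace (xi + (INR k + INR i) * rho - IZR l - (x + INR i * rho)) with (xi + INR k * rho - x - IZR l) by ring.
          - rewrite indicator_false by assumption. apply Hind. }
        induction n0 as [|p IH].
        - rewrite Nat.add_0_r. eapply Rle_trans; [exact (Hterm O)|]. rewrite Nat.add_0_r.
          destruct k as [|k]; [simpl; lra|]. rewrite tech5.
          assert (0 <= sum_f_R0 (fun i => indicator (V (xi + INR i * rho))) k) by (apply cond_pos_sum; intros; apply Hind).
          lra.
        - replace (k + S p)%nat with (S (k + p)) by lia. rewrite !tech5.
          specialize (Hterm (S p)). replace (k + S p)%nat with (S (k + p)) in Hterm by lia. lra. }
      eapply Rle_trans; [apply Hle|].
      assert (Hmono : forall a b, (a <= b)%nat -> sum_f_R0 (fun i => indicator (V (xi + INR i * rho))) a <=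
        sum_f_R0 (fun i => indicator (V (xi + INR i * rho))) b).
      { intros a b Hab; induction Hab as [|b Hab IH]; [lra|]. rewrite tech5.
        specialize (Hind (V (xi + INR (S b) * rho))); lra. }
      apply Hmono; lia. }
    (* The uniform count is averaged over the circle; letting [n] grow contradicts
       [kappa < m (core j)]. *)
    assert (Hmeas : forall n, INR (S n) * m (core j) <= kappa * INR (K + n) + C).
    { intros n.
      pose proof (multiplicity_bound (fun i x => core j (x + INR i * rho))
        (fun i => cm_shift _ _ cm _ _ (Hcore j)) n (fun _ => True) (kappa * INR (K + n) + C) Mb_full
        (fun x _ => Hcount n x)) as B.
      rewrite (cm_full _ _ cm), Rmult_1_r in B.
      rewrite (sum_eq _ (fun _ => m (core j))) in B; [rewrite sum_cte in B; lra|].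
      intros i _. rewrite <- (cm_invariant _ _ cm (core j) (INR i * rho) (Hcore j) (periodic_one _ Hcp)).
      f_equal; apply set_ext; intros; tauto. }
    pose proof (Hmeas O) as H0. 
    destruct (exists_nat_above ((kappa * INR K + C) / (m (core j) - kappa))) as [n Hn].
    specialize (Hmeas n). rewrite plus_INR, S_INR in Hmeas.
    apply (Rmult_lt_compat_r (m (core j) - kappa)) in Hn; [|lra].
    unfold Rdiv in Hn. rewrite Rmult_assoc, Rinv_l, Rmult_1_r in Hn by lra.
    pose proof (cm_ge0 _ _ cm (core j)). nra.
Qed.

(** Poincare recurrence with a lower bound that does not depend on [N0]. Only rotations by multiples
    of [N0 + 1] steps are compared, so any two of them differ by at least [N0] steps. *)
Lemma recurrent_times rho E : Mb E -> periodic E -> 0 < m E ->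
  exists e0, 0 < e0 /\ forall N0, exists N, (N0 <= N)%nat /\ e0 < m (fun x => E x /\ E (x + INR N * rho)).
Proof.
  intros HE HEp Hpos.
  destruct (exists_nat_above (2 / m E)) as [J HJ].
  assert (HJ' : 2 < INR J * m E).
  { apply (Rmult_lt_compat_r (m E)) in HJ; [|assumption]. unfold Rdiv in HJ.
    rewrite Rmult_assoc, Rinv_l in HJ; lra. }
  assert (HJ0 : 0 < INR (S J)) by (apply lt_0_INR; lia).
  (* With this value the [J + 1] disjoint parts lose at most [m E / 2] altogether, and [J * m E > 2]
     leaves a total above 1. *)
  set (e0 := m E / (2 * INR (S J) * INR (S J))).
  assert (He0 : 0 < e0) by (apply Rdiv_lt_0_compat; nra).
  exists e0; split; [assumption|]; intros N0.
  apply NNPP; intros Hno.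
  set (q := S N0).
  set (A := fun (j : nat) x => E (x + INR j * (INR q * rho))).
  assert (HA : forall j, Mb (A j)) by (intros j; now apply (cm_shift _ _ cm)).
  assert (HmA : forall j, m (A j) = m E) by (intros j; apply (cm_invariant _ _ cm); auto using periodic_one).
  assert (Hpair : forall i j, (i < j)%nat -> m (fun x => A i x /\ A j x) <= e0).
  { intros i j Hij. apply Rnot_lt_le; intros Hlt. apply Hno.
    exists ((j - i) * q)%nat; split; [unfold q; nia|].
    pose (P := fun x => E x /\ E (x + INR ((j - i) * q) * rho)).
    assert (HPM : Mb P) by (apply Mb_and; [assumption | now apply (cm_shift _ _ cm)]).
    assert (HPp : periodic P).
    { intros k x; unfold P. rewrite (HEp k x).
      replace (x + IZR k + INR ((j - i) * q) * rho) with (x + INR ((j - i) * q) * rho + IZR k) by ring.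
      now rewrite (HEp k (x + INR ((j - i) * q) * rho)). }
    fold P. rewrite <- (cm_invariant _ _ cm P (INR i * (INR q * rho)) HPM (periodic_one _ HPp)).
    replace (fun x => P (x + INR i * (INR q * rho))) with (fun x => A i x /\ A j x); [assumption|].
    apply set_ext; intros x; unfold P, A.
    replace (x + INR i * (INR q * rho) + INR ((j - i) * q) * rho) with (x + INR j * (INR q * rho)); [tauto|].
    rewrite mult_INR, minus_INR by lia; ring. }
  (* The sets [A n] minus [A 0, ..., A (n - 1)] are disjoint; if all pairs [A i, A j] overlapped
     in measure at most [e0], their total measure would exceed [1]. *)
  set (U := fun (n j : nat) x => exists i, (i < n)%nat /\ A i x /\ A j x).
  assert (HU : forall n j, (n <= j)%nat -> Mb (U n j) /\ m (U n j) <= INR n * e0).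
  { intros n j Hnj; induction n as [|n IH].
    - assert (E0 : U O j = (fun _ => False)).
      { apply set_ext; intros x; split; [intros (i & Hi & _); lia | tauto]. }
      rewrite E0; split; [apply Mb_empty | rewrite m_empty; simpl; lra].
    - destruct IH as [I1 I2]; [lia|].
      assert (E1 : U (S n) j = (fun x => U n j x \/ (A n x /\ A j x))).
      { apply set_ext; intros x; split.
        - intros (i & Hi & Hx). destruct (Nat.eq_dec i n) as [-> | Hin]; [now right|].
          left; exists i; split; [lia | assumption].
        - intros [(i & Hi & Hx) | Hx]; [exists i; split; [lia | assumption] | exists n; split; [lia | assumption]]. }
      assert (Mn : Mb (fun x => A n x /\ A j x)) by now apply Mb_and.
      rewrite E1; split; [now apply Mb_or|].
      eapply Rle_trans; [now apply m_or_le|]. specialize (Hpair n j ltac:(lia)). rewrite S_INR; lra. }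
  set (D := fun (n : nat) x => A n x /\ ~ U n n x).
  assert (HD : forall n, Mb (D n) /\ m E - INR n * e0 <= m (D n)).
  { intros n. destruct (HU n n (le_n _)) as [U1 U2]. split.
    - apply Mb_and; [apply HA | now apply (cm_compl _ _ cm)].
    - pose proof (m_split (A n) (U n n) (HA n) U1) as E1. rewrite HmA in E1.
      change (fun x => A n x /\ ~ U n n x) with (D n) in E1.
      assert (m (fun x => A n x /\ U n n x) <= m (U n n)); [|lra].
      apply m_mono; [now apply Mb_and | assumption | tauto]. }
  assert (Hdis : forall n, sum_f_R0 (fun j => m (D j)) n <= 1).
  { intros n.
    pose proof (multiplicity_bound D (fun j => proj1 (HD j)) n (fun _ => True) 1 Mb_full) as B.
    rewrite (cm_full _ _ cm), Rmult_1_r in B.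
    rewrite (sum_eq _ (fun j => m (fun x => D j x /\ True))); [apply B|].
    - intros x _. clear B.
      assert (Hex : forall n, sum_f_R0 (fun j => indicator (D j x)) n <= 1 /\
        (forall j, (n < j)%nat -> D j x -> sum_f_R0 (fun j => indicator (D j x)) n = 0)).
      { induction n0 as [|p [I1 I2]].
        - simpl. split.
          + unfold indicator; destruct (excluded_middle_informative (D O x)); lra.
          + intros j Hj [Aj Uj]. apply indicator_false; intros [A0 _]. apply Uj; exists O; auto.
        - rewrite tech5. split.
          + destruct (classic (D (S p) x)) as [Hd | Hd].
            * rewrite (I2 (S p)) by (lia || assumption). rewrite indicator_true by assumption; lra.
            * rewrite (indicator_false (D (S p) x)) by assumption; lra.
          + intros j Hj Hdj. rewrite (I2 j) by (lia || assumption).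
            rewrite indicator_false; [lra|]. intros [Ap _]. destruct Hdj as [Aj Uj].
            apply Uj; exists (S p); auto. }
      apply Hex.
    - intros j _; f_equal; apply set_ext; intros; tauto. }
  specialize (Hdis J).
  assert (Hlow : sum_f_R0 (fun _ => m E - INR (S J) * e0) J <= sum_f_R0 (fun j => m (D j)) J).
  { apply sum_Rle; intros j Hj. destruct (HD j) as [_ Dj].
    assert (INR j <= INR (S J)) by (apply le_INR; lia). nra. }
  rewrite sum_cte in Hlow.
  assert (E1 : INR (S J) * e0 = m E / (2 * INR (S J))) by (unfold e0; field; lra).
  assert (E2 : (m E - INR (S J) * e0) * INR (S J) = m E * INR (S J) - m E / 2).
  { rewrite E1; field; lra. }
  rewrite E2, S_INR in Hlow. nra.
Qed.
End CircleMeasure.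

(* The sets [fun x => forall k, Good M k x] are G_delta, hence measurable; [u] enumerates the
   exceptional levels. *)
Lemma simultaneous_recurrence rho (Good : nat -> nat -> R -> Prop) (u : nat -> R)
  (V1 V2 : nat -> R -> Prop) (Omega : R -> Prop) :
  irrational rho ->
  (forall M k, R_open (Good M k)) -> (forall M k, periodic (Good M k)) ->
  (forall M k x, Good M k x -> Good (S M) k x) ->
  (forall N, R_open (V1 N)) -> (forall N, periodic (V1 N)) -> rarely_visited rho V1 ->
  (forall N, R_open (V2 N)) -> (forall N, periodic (V2 N)) -> rarely_visited rho V2 ->
  (forall x, Omega x -> 0 <= x < 1) -> ~ OM_le Omega 0 ->
  (forall x, Omega x -> (exists n, x = u n) \/ exists M, forall k, Good M k x) ->
  exists M, forall N0, exists N c, (N0 <= N)%nat /\ (forall k, Good M k c) /\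
    (forall k, Good M k (c + INR N * rho)) /\ ~ V1 N c /\ ~ V2 N c /\
    (forall n, c + INR N * rho <> u n).
Proof.
  intros Hirr HGo HGp HGm HV1 HV1p HV1r HV2 HV2p HV2r HO HOnull HOG.
  destruct LebesgueCircle.circle_measure_exists as (Mb & m & cm).
  set (E := fun (M : nat) x => forall k, Good M k x).
  assert (HE : forall M, Mb (E M)) by (intros M; apply (Mb_inter _ _ cm); intros k; now apply (cm_open _ _ cm)).
  assert (HEp : forall M, periodic (E M)).
  { intros M j x; split; intros Hx k; specialize (Hx k); now apply (HGp M k j). }
  assert (Hu : forall s, Mb (fun x => exists n, x + s = u n)).
  { intros s. apply (cm_union _ _ cm (fun n x => x + s = u n)). intros n.
    apply (cm_shift _ _ cm (fun x => x = u n)), (Mb_point _ _ cm). }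
  assert (Hum : forall s, m (fun x => exists n, x + s = u n) = 0).
  { intros s. rewrite <- (cm_countable _ _ cm (fun n => u n - s)). f_equal.
    apply set_ext; intros x; split; intros [n Hn]; exists n; lra. }
  (* Otherwise the increasing union of the [E M], together with the exceptional levels, would be a
     null set containing [Omega]. *)
  assert (HM : exists M, 0 < m (E M)).
  { apply NNPP; intros Hno.
    set (W := fun x => (exists n, x + 0 = u n) \/ exists M, E M x).
    assert (HUE : Mb (fun x => exists M, E M x)) by now apply (cm_union _ _ cm).
    assert (HW : Mb W) by (apply (Mb_or _ _ cm); auto).
    assert (Hm0 : m W <= 0).
    { eapply Rle_trans; [now apply (m_or_le _ _ cm)|]. rewrite Hum.
      apply Rnot_lt_le; intros Hlt. destruct (cm_lim _ _ cm E 0 HE) as [M Hpos]; [| lra | eauto].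
      intros M x Hx k; now apply HGm. }
    pose proof (cm_ge0 _ _ cm W).
    assert (HWnull := cm_null _ _ cm W HW ltac:(lra)). apply HOnull.
    intros e He; destruct (HWnull e He) as (a & b & Hab & Hcov & Hsum).
    exists a, b; repeat split; try assumption. intros x Hx; apply Hcov; split; [now apply HO|].
    destruct (HOG x Hx) as [[n Hn] | HG]; [left; exists n; lra | now right]. }
  destruct HM as [M HM]. exists M; intros N0.
  destruct (recurrent_times Mb m cm rho (E M) (HE M) (HEp M) HM) as (e0 & He0 & Hrec).
  (* Together [V1 N] and [V2 N] will have measure at most [2 * e0 / 3] and the exceptional levels
     none, so they cannot cover a recurrence set of measure above [e0]. *)
  destruct (HV1r (e0 / 3)) as [N1 HN1]; [lra|]. destruct (HV2r (e0 / 3)) as [N2 HN2]; [lra|].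
  destruct (Hrec (N0 + N1 + N2)%nat) as (N & HN & HNm).
  destruct (HN1 N) as [C1 HC1]; [lia|]. destruct (HN2 N) as [C2 HC2]; [lia|].
  pose proof (rarely_visited_small Mb m cm rho (V1 N) (e0 / 3) C1 Hirr (HV1 N) (HV1p N) HC1) as B1.
  pose proof (rarely_visited_small Mb m cm rho (V2 N) (e0 / 3) C2 Hirr (HV2 N) (HV2p N) HC2) as B2.
  apply NNPP; intros Hno.
  assert (Hle : m (fun x => E M x /\ E M (x + INR N * rho)) <=
    m (fun x => (V1 N x \/ V2 N x) \/ exists n, x + INR N * rho = u n)).
  { assert (O1 : Mb (V1 N)) by now apply (cm_open _ _ cm). assert (O2 : Mb (V2 N)) by now apply (cm_open _ _ cm).
    apply (m_mono _ _ cm).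
    - apply (Mb_and _ _ cm); [apply HE | apply (cm_shift _ _ cm), HE].
    - apply (Mb_or _ _ cm); [now apply (Mb_or _ _ cm) | apply Hu].
    - intros x [Hx1 Hx2]. apply NNPP; intros Hx. apply Hno. exists N, x.
      split; [lia|]; split; [exact Hx1|]; split; [exact Hx2|].
      split; [tauto|]; split; [tauto|]. intros n Hn; apply Hx; right; now exists n. }
  assert (O1 : Mb (V1 N)) by now apply (cm_open _ _ cm). assert (O2 : Mb (V2 N)) by now apply (cm_open _ _ cm).
  pose proof (m_or_le Mb m cm _ _ (Mb_or Mb m cm _ _ O1 O2) (Hu (INR N * rho))) as L1.
  pose proof (m_or_le Mb m cm _ _ O1 O2) as L2. rewrite Hum in L1. lra.
Qed.

(** * Local extremal values *)

(** A countable base of the plane. *)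
Definition grid_ball (n : nat) (k l : Z) : R * R -> Prop :=
  close (/ INR (S n)) (IZR k / INR (S n), IZR l / INR (S n)).

Lemma grid_ball_near p r : 0 < r -> exists n k l, grid_ball n k l p /\
  forall q, grid_ball n k l q -> close r p q.
Proof.
  intros Hr. destruct (exists_nat_above (2 / r)) as [n Hn].
  assert (Hn0 : 0 < INR (S n)) by (apply lt_0_INR; lia).
  assert (Hs : 0 < / INR (S n)) by now apply Rinv_0_lt_compat.
  assert (Hsr : / INR (S n) + / INR (S n) <= r).
  { apply Rmult_le_reg_r with (INR (S n)); [assumption|].
    rewrite Rmult_plus_distr_r, Rinv_l by lra. rewrite S_INR in *.
    apply (Rmult_lt_compat_r r) in Hn; [|assumption].
    unfold Rdiv in Hn; rewrite Rmult_assoc, Rinv_l in Hn by lra. nra. }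
  assert (Hgrid : forall x, exists k : Z, Rabs (x - IZR k / INR (S n)) < / INR (S n)).
  { intros x. exists (Int_part (x * INR (S n))).
    destruct (base_fp (x * INR (S n))) as [B1 B2]. unfold frac_part in *.
    replace (x - IZR (Int_part (x * INR (S n))) / INR (S n)) with
      (/ INR (S n) * (x * INR (S n) - IZR (Int_part (x * INR (S n))))) by (field; lra).
    rewrite Rabs_mult, (Rabs_pos_eq (/ INR (S n))), Rabs_pos_eq by lra. nra. }
  destruct (Hgrid (fst p)) as [k Hk]; destruct (Hgrid (snd p)) as [l Hl].
  assert (Hp : grid_ball n k l p) by now split.
  exists n, k, l; split; [assumption|]; intros q Hq.
  apply close_mono with (/ INR (S n) + / INR (S n)); [assumption|].
  eapply close_trans; [apply close_sym, Hp | exact Hq].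
Qed.

(** A local extremal value is the maximum or the minimum of [H] on some box of the countable base,
    hence determined by the box and the kind of extremum. *)
Lemma extremal_values_countable (H : R * R -> R) :
  exists u : nat -> R, forall c, ~ regular H c -> exists n, c = u n.
Proof.
  (* Integer coordinates are coded as differences of naturals; [s = 0] codes a maximum, any other
     [s] a minimum. *)
  set (ext := fun (a : nat * (nat * (nat * (nat * (nat * nat))))) (c : R) =>
    let '(n, (s, (k1, (k2, (l1, l2))))) := a in
    let ball := grid_ball n (Z.of_nat k1 - Z.of_nat k2) (Z.of_nat l1 - Z.of_nat l2) in
    (exists p, ball p /\ H p = c) /\
    (forall q, ball q -> match s with O => H q <= c | _ => c <= H q end)).
  assert (Huniq : forall a c c', ext a c -> ext a c' -> c = c').
  { intros (n & s & k1 & k2 & l1 & l2) c c' [(p & Bp & Hp) A] [(p' & Bp' & Hp') A'].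
    specialize (A _ Bp'); specialize (A' _ Bp). destruct s; lra. }
  set (dec := fun n : nat => let (a, n) := Cantor.of_nat n in let (b, n) := Cantor.of_nat n in
    let (c, n) := Cantor.of_nat n in let (d, n) := Cantor.of_nat n in
    (a, (b, (c, (d, Cantor.of_nat n))))).
  assert (Hdec : forall a, exists n, dec n = a).
  { intros (a & b & c & d & e).
    exists (Cantor.to_nat (a, Cantor.to_nat (b, Cantor.to_nat (c, Cantor.to_nat (d, Cantor.to_nat e))))).
    unfold dec; now rewrite !Cantor.cancel_of_to. }
  destruct (choice (fun n c => (exists c', ext (dec n) c') -> ext (dec n) c)) as [u Hu].
  { intros n. destruct (classic (exists c', ext (dec n) c')) as [[c' Hc'] | Hno].
    - now exists c'.
    (* A default value for codes whose box has no extremum of the given kind. *)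
    - exists 0; intros Hx; contradiction. }
  exists u; intros c Hc.
  assert (Hx : exists a, ext a c).
  { apply NNPP; intros Hno; apply Hc; intros p Hp r Hr.
    destruct (grid_ball_near p r Hr) as (n & k & l & Bp & Bq).
    set (code := fun s : nat => (n, (s, (Z.to_nat k, (Z.to_nat (- k), (Z.to_nat l, Z.to_nat (- l))))))).
    assert (E : forall j, (Z.of_nat (Z.to_nat j) - Z.of_nat (Z.to_nat (- j)))%Z = j) by lia.
    split.
    - apply NNPP; intros Hn; apply Hno. exists (code O); simpl; rewrite !E.
      split; [now exists p|]; intros q Hq. apply Rnot_lt_le; intros Hlt. apply Hn; exists q; auto.
    - apply NNPP; intros Hn; apply Hno. exists (code 1%nat); simpl; rewrite !E.
      split; [now exists p|]; intros q Hq. apply Rnot_lt_le; intros Hlt. apply Hn; exists q; auto. }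
  destruct Hx as [a Ha]; destruct (Hdec a) as [n Hn]. exists n. subst a.
  apply (Huniq (dec n)); [assumption|]. apply Hu; eauto.
Qed.

(** * The straightened system *)

Section Straight.
Variables (H : R * R -> R) (F Fi : R * R -> R * R) (rho : R) (Omega : R -> Prop).
Hypotheses (HH : height H) (HF : cont_map F) (HFi : cont_map Fi)
  (HFc : commutes_int F) (HFic : commutes_int Fi) (HFiF : forall z, Fi (F z) = z)
  (HHF : forall z, H (F z) = H z + rho).

Lemma iter_cont g n : cont_map g -> cont_map (Nat.iter n g).
Proof.
  intros Hg; induction n as [|n IH]; intros z e He.
  - exists e; split; [assumption | auto].
  - destruct (Hg (Nat.iter n g z) e He) as (d & Hd & A). destruct (IH z d Hd) as (d' & Hd' & B).
    exists d'; split; [assumption|]; intros w Hw; simpl; auto.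
Qed.

Lemma iter_commutes g n : commutes_int g -> commutes_int (Nat.iter n g).
Proof.
  intros Hg; induction n as [|n IH]; intros z k l; simpl; [reflexivity|]. now rewrite IH, Hg.
Qed.

Lemma iter_inverse n z : Nat.iter n Fi (Nat.iter n F z) = z.
Proof.
  induction n as [|n IH]; [reflexivity|].
  rewrite Nat.iter_succ_r; simpl. now rewrite HFiF.
Qed.

Lemma iter_height n z : H (Nat.iter n F z) = H z + INR n * rho.
Proof.
  induction n as [|n IH]; [simpl; ring|]. rewrite S_INR; simpl. rewrite HHF, IH; ring.
Qed.

Definition displacement (n : nat) (z : R * R) : R := fst (Nat.iter n F z) - fst z.

Lemma displacement_cont n : cont_fun (displacement n).
Proof.
  intros z e He. destruct (iter_cont F n HF z (e / 2)) as (d & Hd & A); [lra|].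
  exists (Rmin d (e / 2)); split; [apply Rmin_glb_lt; lra|]; intros w Hw.
  destruct (A w (close_mono _ _ _ _ (Rmin_l _ _) Hw)) as [A1 _].
  destruct (close_mono _ _ _ _ (Rmin_r _ _) Hw) as [A2 _].
  unfold displacement; apply Rabs_def2 in A1, A2; apply Rabs_def1; lra.
Qed.

Lemma displacement_periodic n : zperiodic (displacement n).
Proof.
  intros z k l; unfold displacement. rewrite (iter_commutes F n HFc); simpl; ring.
Qed.

Lemma displacement_add n m z :
  displacement (n + m) z = displacement n z + displacement m (Nat.iter n F z).
Proof.
  unfold displacement. rewrite Nat.add_comm, Nat.iter_add; ring.
Qed.

(** A level is compact modulo horizontal translations, and the strict inequality persists near each
    of its points. *)
Lemma slow_levels_open p b : cont_fun p -> zperiodic p -> R_open (fun c => forall z, H z = c -> p z < b).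
Proof.
  intros Hp Hper c Hc. destruct (level_strip H HH c) as [Y HY].
  destruct (box_uniform 0 1 (- Y) Y (fun z e => forall c', Rabs (c' - c) < e -> H z = c' -> p z < b))
    as (e & He & A).
  - intros z e e' Hee A c' Hc'; apply A; lra.
  - intros z _. destruct (classic (H z = c)) as [Hz | Hz].
    + destruct (Hp z (b - p z)) as (d & Hd & A); [specialize (Hc z Hz); lra|].
      exists d; split; [assumption|]; intros w Hw c' _ _. specialize (A w Hw); apply Rabs_def2 in A; lra.
    + destruct (level_avoided H HH c z Hz) as (d & Hd & A).
      exists d; split; [assumption|]; intros w Hw c' Hc' E; exfalso; now apply (A w c').
  - exists (Rmin e 1); split; [apply Rmin_glb_lt; lra|]; intros c' Hc' z Hz.
    pose proof (Rmin_l e 1); pose proof (Rmin_r e 1).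
    destruct (exists_int_below (fst z)) as [k Hk].
    specialize (Hper z k 0%Z). rewrite Rplus_0_r in Hper. rewrite <- Hper.
    apply (A (tr k z)) with c'.
    + assert (Hz1 : Rabs (H z - c) < 1) by (rewrite Hz; lra).
      specialize (HY z Hz1). split; simpl; lra.
    + lra.
    + now rewrite height_tr.
Qed.

Lemma slow_levels_periodic p b : zperiodic p -> periodic (fun c => forall z, H z = c -> p z < b).
Proof.
  intros Hper.
  assert (A : forall k c, (forall z, H z = c -> p z < b) -> forall z, H z = c + IZR k -> p z < b).
  { intros k c Hc z Hz. rewrite <- (Hper z 0%Z (- k)%Z). apply Hc.
    rewrite (height_up H HH), opp_IZR, Rplus_0_r. destruct z; simpl in *; lra. }
  intros k c; split; [|apply A]. intros Hc z Hz. apply (A (- k)%Z (c + IZR k) Hc).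
  rewrite opp_IZR; lra.
Qed.

(** The shift by two builds in the condition [2 <= M] of [narrow_open] for all indices. *)
Lemma narrow_family_open M k : R_open (narrow H (S (S M)) (/ INR (S k))).
Proof. apply narrow_open; [assumption | lia | apply Rinv_0_lt_compat, lt_0_INR; lia]. Qed.

Lemma narrow_family_all M c : (forall k, narrow H M (/ INR (S k)) c) -> forall d, 0 < d -> narrow H M d c.
Proof.
  intros Hk d Hd. destruct (exists_nat_above (/ d)) as [k Hkd].
  apply (narrow_mono H M M (/ INR (S k))); auto.
  rewrite <- (Rinv_inv d). apply Rinv_le_contravar; [now apply Rinv_0_lt_compat | rewrite S_INR; lra].
Qed.

Theorem straight_rotation : irrational rho ->
  (forall c, Omega c -> 0 <= c < 1) -> ~ OM_le Omega 0 ->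
  (forall c, Omega c -> regular H c -> exists M, (2 <= M)%nat /\ forall d, 0 < d -> narrow H M d c) ->
  exists beta, forall e, 0 < e -> exists C, forall n z,
    Rabs (displacement n z - INR n * beta) <= INR n * e + C.
Proof.
  intros Hirr HO HOnull HOnarrow.
  destruct (zperiodic_bounded _ (displacement_cont 1) (displacement_periodic 1)) as [K HK].
  assert (D0 : forall z, displacement 0 z = 0) by (intros z; unfold displacement; simpl; ring).
  destruct (maximal_drift F displacement K D0 displacement_add HK) as (beta & Up & Low).
  (* The maximal drift [beta'] of the negated cocycle is minus the minimal drift, so
     [beta + beta' <= 0] says that the two extremal drifts coincide. *)
  set (D' := fun n z => - displacement n z).
  assert (D0' : forall z, D' O z = 0) by (intros z; unfold D'; rewrite D0; ring).
  assert (Dadd' : forall n m z, D' (n + m)%nat z = D' n z + D' m (Nat.iter n F z)).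
  { intros n m z; unfold D'; rewrite displacement_add; ring. }
  assert (HK' : forall z, Rabs (D' 1%nat z) <= K) by (intros z; unfold D'; rewrite Rabs_Ropp; apply HK).
  destruct (maximal_drift F D' K D0' Dadd' HK') as (beta' & Up' & Low').
  assert (Hsum : beta + beta' <= 0).
  { apply Rnot_lt_le; intros Hpos.
    (* A quarter of the gap: after losing [theta] at both ends, [2 * theta] remains. *)
    set (theta := (beta + beta') / 4).
    assert (Hth : 0 < theta) by (unfold theta; lra).
    pose proof (slow_fibres_rarely_visited F displacement K D0 displacement_add HK H rho beta theta Hth HHF Up Low) as V1.
    pose proof (slow_fibres_rarely_visited F D' K D0' Dadd' HK' H rho beta' theta Hth HHF Up' Low') as V2.
    assert (Cont' : forall N, cont_fun (D' N)).
    { intros N z e He. destruct (displacement_cont N z e He) as (d & Hd & A).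
      exists d; split; [assumption|]; intros w Hw. unfold D'.
      replace (- displacement N w - - displacement N z) with (- (displacement N w - displacement N z)) by ring.
      rewrite Rabs_Ropp; auto. }
    assert (Per' : forall N, zperiodic (D' N)).
    { intros N z k l; unfold D'; now rewrite displacement_periodic. }
    destruct (extremal_values_countable H) as [u Hu].
    destruct (simultaneous_recurrence rho (fun M k => narrow H (S (S M)) (/ INR (S k))) u
      (fun N c => forall z, H z = c -> displacement N z < INR N * (beta - theta))
      (fun N c => forall z, H z = c -> D' N z < INR N * (beta' - theta)) Omega Hirr) as [M HM]; auto.
    - intros M k; apply narrow_family_open.
    - intros M k j x; now apply narrow_period.
    - intros M k x; apply narrow_mono; auto; lra.
    - intros N; apply slow_levels_open; [apply displacement_cont | apply displacement_periodic].
    - intros N; apply slow_levels_periodic, displacement_periodic.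
    - intros N; now apply slow_levels_open.
    - intros N; now apply slow_levels_periodic.
    - intros c Hc. destruct (classic (regular H c)) as [Hreg | Hreg]; [right | left; now apply Hu].
      destruct (HOnarrow c Hc Hreg) as (M & HM & A). exists (M - 2)%nat; intros k.
      replace (S (S (M - 2))) with M by lia. apply A, Rinv_0_lt_compat, lt_0_INR; lia.
    (* [fibre_deviation] allows [4 M + 8], and moving [w] by an integer next to [z] costs 1 more. *)
    - destruct (exists_nat_above ((4 * INR (S (S M)) + 9) / (2 * theta))) as [N0 HN0].
      destruct (HM N0) as (N & c & HN & G1 & G2 & W1 & W2 & Hreg).
      assert (Hreg' : regular H (c + INR N * rho)).
      { apply NNPP; intros Hn; destruct (Hu _ Hn) as [n Hn']; now apply (Hreg n). }
      apply not_all_ex_not in W1 as [z W1]. apply imply_to_and in W1 as [Hz W1].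
      apply not_all_ex_not in W2 as [w W2]. apply imply_to_and in W2 as [Hw W2].
      apply Rnot_lt_le in W1, W2. unfold D' in W2.
      destruct (exists_int_below (fst w - fst z)) as [k Hk].
      assert (Hdev := fibre_deviation H HH (Nat.iter N F) (Nat.iter N Fi) (INR N * rho)
        (iter_cont F N HF) (iter_cont Fi N HFi) (iter_commutes F N HFc) (iter_commutes Fi N HFic)
        (iter_inverse N) (iter_height N) (S (S M)) c z (tr k w)
        (narrow_family_all _ _ G1) (narrow_family_all _ _ G2) Hreg' Hz).
      rewrite height_tr in Hdev by assumption. specialize (Hdev Hw).
      rewrite (commutes_tr _ k w (iter_commutes F N HFc)) in Hdev. simpl fst in Hdev.
      assert (Hkw : Rabs (fst w + IZR k - fst z) <= 1) by (apply Rabs_le; lra).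
      specialize (Hdev Hkw).
      assert (Hbound : displacement N z - displacement N w <= 4 * INR (S (S M)) + 9).
      { unfold displacement. pose proof (Rle_abs (- (fst (Nat.iter N F w) + IZR k - fst (Nat.iter N F z)))) as Ha.
        rewrite Rabs_Ropp in Ha. lra. }
      apply le_INR in HN.
      apply (Rmult_lt_compat_r (2 * theta)) in HN0; [|lra].
      unfold Rdiv in HN0; rewrite Rmult_assoc, Rinv_l, Rmult_1_r in HN0 by lra.
      assert (INR N * (2 * theta) <= displacement N z - displacement N w).
      { replace (2 * theta) with ((beta - theta) + (beta' - theta)) by (unfold theta; field). lra. }
      nra. }
  exists beta; intros e He.
  destruct (Up e He) as [C HC]; destruct (Up' e He) as [C' HC'].
  exists (Rabs C + Rabs C'); intros n z. specialize (HC n z); specialize (HC' n z). unfold D' in HC'.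
  pose proof (Rle_abs C); pose proof (Rle_abs C'); pose proof (Rabs_pos C); pose proof (Rabs_pos C').
  pose proof (pos_INR n). apply Rabs_le; split; nra.
Qed.
End Straight.

(** * Continuity of plane maps *)

Lemma cont_map_id : cont_map (fun z => z).
Proof. intros z e He; exists e; auto. Qed.

Lemma cont_map_comp g g' : cont_map g -> cont_map g' -> cont_map (fun z => g' (g z)).
Proof.
  intros Hg Hg' z e He. destruct (Hg' (g z) e He) as (d & Hd & A).
  destruct (Hg z d Hd) as (d' & Hd' & B). exists d'; auto.
Qed.

Lemma cont_fun_comp g p : cont_map g -> cont_fun p -> cont_fun (fun z => p (g z)).
Proof.
  intros Hg Hp z e He. destruct (Hp (g z) e He) as (d & Hd & A).
  destruct (Hg z d Hd) as (d' & Hd' & B). exists d'; auto.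
Qed.

Lemma cont_fun_lincomb a b p q : cont_fun p -> cont_fun q -> cont_fun (fun z => a * p z + b * q z).
Proof.
  intros Hp Hq z e He.
  set (M := Rabs a + Rabs b + 1).
  assert (HM : 0 < M) by (unfold M; pose proof (Rabs_pos a); pose proof (Rabs_pos b); lra).
  assert (HeM : 0 < e / M) by now apply Rdiv_lt_0_compat.
  destruct (Hp z (e / M) HeM) as (d1 & Hd1 & A1); destruct (Hq z (e / M) HeM) as (d2 & Hd2 & A2).
  exists (Rmin d1 d2); split; [now apply Rmin_glb_lt|]; intros w Hw.
  specialize (A1 w (close_mono _ _ _ _ (Rmin_l _ _) Hw)).
  specialize (A2 w (close_mono _ _ _ _ (Rmin_r _ _) Hw)).
  replace (a * p w + b * q w - (a * p z + b * q z)) with (a * (p w - p z) + b * (q w - q z)) by ring.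
  eapply Rle_lt_trans; [apply Rabs_triang|]. rewrite !Rabs_mult.
  assert (E : M * (e / M) = e) by (field; lra).
  pose proof (Rabs_pos a); pose proof (Rabs_pos b). unfold M at 1 in E. nra.
Qed.

Lemma cont_fun_minus p q : cont_fun p -> cont_fun q -> cont_fun (fun z => p z - q z).
Proof.
  intros Hp Hq z e He. destruct (cont_fun_lincomb 1 (-1) p q Hp Hq z e He) as (d & Hd & A).
  exists d; split; [assumption|]; intros w Hw; specialize (A w Hw).
  now replace (p w - q w - (p z - q z)) with (1 * p w + -1 * q w - (1 * p z + -1 * q z)) by ring.
Qed.

Lemma cont_fun_fst : cont_fun fst.
Proof. exact (cont_map_fst _ cont_map_id). Qed.

Lemma cont_fun_snd : cont_fun snd.
Proof. exact (cont_map_snd _ cont_map_id). Qed.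

Lemma cont_fun_const c : cont_fun (fun _ => c).
Proof. intros z e He; exists 1; split; [lra|]; intros; now rewrite Rminus_diag, Rabs_R0. Qed.

Lemma cont_map_pair p q : cont_fun p -> cont_fun q -> cont_map (fun z => (p z, q z)).
Proof.
  intros Hp Hq z e He. destruct (Hp z e He) as (d1 & Hd1 & A1); destruct (Hq z e He) as (d2 & Hd2 & A2).
  exists (Rmin d1 d2); split; [now apply Rmin_glb_lt|]; intros w Hw; split; simpl.
  - apply A1; eapply close_mono; [apply Rmin_l | exact Hw].
  - apply A2; eapply close_mono; [apply Rmin_r | exact Hw].
Qed.

Lemma cont_map_vadd g w : cont_map g -> cont_map (fun z => vadd (g z) w).
Proof.
  intros Hg z e He; destruct (Hg z e He) as (d & Hd & A); exists d; split; [assumption|].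
  intros u Hu; destruct (A u Hu) as [A1 A2]; split; simpl.
  - now replace (fst (g u) + fst w - (fst (g z) + fst w)) with (fst (g u) - fst (g z)) by ring.
  - now replace (snd (g u) + snd w - (snd (g z) + snd w)) with (snd (g u) - snd (g z)) by ring.
Qed.

Lemma vadd_assoc a b c : vadd (vadd a b) c = vadd a (vadd b c).
Proof. unfold vadd; simpl; f_equal; ring. Qed.

Lemma vadd_comm a b : vadd a b = vadd b a.
Proof. unfold vadd; f_equal; ring. Qed.

Lemma vadd_vsub a b : vadd b (vsub a b) = a.
Proof. destruct a; unfold vadd, vsub; simpl; f_equal; ring. Qed.

Lemma vsub_vadd a b : vsub (vadd a b) a = b.
Proof. destruct b; unfold vadd, vsub; simpl; f_equal; ring. Qed.

Lemma vadd_cancel a b c : vadd a b = vadd a c -> b = c.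
Proof. intros E; rewrite <- (vsub_vadd a b), <- (vsub_vadd a c), E; reflexivity. Qed.

Lemma int_vec_IZR v : int_vec v -> exists k l : Z, v = (IZR k, IZR l).
Proof. destruct v as [a b]; intros [[k Hk] [l Hl]]; exists k, l; simpl in *; now subst. Qed.

Lemma piT_vadd z v : int_vec v -> piT (vadd z v) = piT z.
Proof. intros Hv; apply piT_eq. now rewrite vsub_vadd. Qed.

Lemma piT_eq_vadd z w : piT z = piT w -> exists v, int_vec v /\ z = vadd w v.
Proof.
  intros E%piT_eq; exists (vsub z w); split; [assumption | now rewrite vadd_vsub].
Qed.

(** * Lifts of torus maps *)

Lemma lift_unique g g' : cont_map g -> cont_map g' -> (forall z, piT (g z) = piT (g' z)) ->
  exists v, int_vec v /\ forall z, g z = vadd (g' z) v.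
Proof.
  intros Hg Hg' E.
  assert (Hi : forall z, int_vec (vsub (g z) (g' z))) by (intros z; now apply piT_eq).
  exists (vsub (g (0, 0)) (g' (0, 0))); split; [apply Hi|].
  intros z. rewrite <- (vadd_vsub (g z) (g' z)). f_equal. unfold vsub; f_equal.
  - apply (int_valued_constant2 (fun z => fst (g z) - fst (g' z))).
    + apply cont_fun_minus; now apply cont_map_fst.
    + intros w; now destruct (Hi w).
  - apply (int_valued_constant2 (fun z => snd (g z) - snd (g' z))).
    + apply cont_fun_minus; now apply cont_map_snd.
    + intros w; now destruct (Hi w).
Qed.

Lemma lift_translate f g : cont_map g -> (forall z, piT (g z) = f (piT z)) ->
  forall v, int_vec v -> exists v', int_vec v' /\ forall z, g (vadd z v) = vadd (g z) v'.
Proof.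
  intros Hg E v Hv. apply (lift_unique (fun z => g (vadd z v)) g); try assumption.
  - apply (cont_map_comp (fun z => vadd z v) g); [apply cont_map_vadd, cont_map_id | assumption].
  - intros z; now rewrite !E, piT_vadd.
Qed.

Lemma lift_inverse f fi g : continuous (X := T2_top) (Y := T2_top) fi ->
  (forall x, fi (f x) = x) -> (forall x, f (fi x) = x) ->
  cont_map g -> (forall z, piT (g z) = f (piT z)) ->
  exists gi, cont_map gi /\ (forall z, piT (gi z) = fi (piT z)) /\
    (forall z, gi (g z) = z) /\ forall z, g (gi z) = z.
Proof.
  intros Hfi E1 E2 Hg E.
  destruct (lift_torus (fun z => fi (piT z))) as (g' & Hg' & E').
  { exact (continuous_comp (X := R2_top) (Y := T2_top) (Z := T2_top) piT fi continuous_piT Hfi). }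
  destruct (lift_unique (fun z => g' (g z)) (fun z => z)) as (v & Hv & Ev).
  { now apply cont_map_comp. } { apply cont_map_id. } { intros z; now rewrite E', E, E1. }
  set (v' := (- fst v, - snd v)).
  assert (Hv' : int_vec v') by (destruct Hv; split; simpl; now apply is_int_opp).
  assert (Evv : forall z, vadd (vadd z v) v' = z).
  { intros [a b]; unfold vadd, v'; simpl; f_equal; ring. }
  set (gi := fun z => vadd (g' z) v').
  assert (Hgi : cont_map gi) by now apply cont_map_vadd.
  assert (Egi : forall z, piT (gi z) = fi (piT z)) by (intros z; unfold gi; now rewrite piT_vadd).
  assert (Eig : forall z, gi (g z) = z) by (intros z; unfold gi; now rewrite Ev, Evv).
  exists gi; repeat split; try assumption.
  destruct (lift_unique (fun z => g (gi z)) (fun z => z)) as (w & Hw & Ew).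
  { now apply cont_map_comp. } { apply cont_map_id. } { intros z; now rewrite E, Egi, E2. }
  assert (Hw0 : w = (0, 0)).
  { pose proof (Ew (g (0, 0))) as A. rewrite Eig in A.
    apply (vadd_cancel (g (0, 0))). rewrite <- A. unfold vadd; simpl. destruct (g (0, 0)); f_equal; simpl; ring. }
  intros z; rewrite Ew, Hw0. destruct z; unfold vadd; simpl; f_equal; ring.
Qed.

(** A retraction of the line onto the time interval: a homotopy, extended constantly in time,
    becomes a map on the plane to which [lift_torus] applies. *)
Definition clamp (t : R) : R := Rmax 0 (Rmin 1 t).

Lemma clamp_in t : 0 <= clamp t <= 1.
Proof.
  unfold clamp; split; [apply Rmax_l|]. apply Rmax_lub; [lra | apply Rmin_l].
Qed.

Lemma clamp_lipschitz s t : Rabs (clamp s - clamp t) <= Rabs (s - t).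
Proof.
  unfold clamp, Rmax, Rmin. destruct (Rle_dec 1 s), (Rle_dec 1 t);
    repeat match goal with |- context [Rle_dec ?a ?b] => destruct (Rle_dec a b) end;
    unfold Rabs; repeat destruct Rcase_abs; lra.
Qed.

Lemma clamp_0 : clamp 0 = 0.
Proof. unfold clamp; rewrite Rmin_right, Rmax_left; lra. Qed.

Lemma clamp_1 : clamp 1 = 1.
Proof. unfold clamp; rewrite Rmin_left, Rmax_right; lra. Qed.

Definition clampI (t : R) : pt I01 := exist _ (clamp t) (clamp_in t).

(* Along the homotopy, the increment of a lift over a fixed closed loop is an integer vector
   depending continuously on time, hence constant. *)
Lemma lift_commutes f F : homotopic (X := T2_top) (Y := T2_top) f (fun x => x) ->
  cont_map F -> (forall z, piT (F z) = f (piT z)) ->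
  forall z v, int_vec v -> F (vadd z v) = vadd (F z) v.
Proof.
  intros (Hm & HHm & Hends) HF EF z v Hv.
  assert (Hf : forall x, Hm (clampI 0, x) = f x) by (intros x; apply Hends; apply clamp_0).
  assert (Hid : forall x, Hm (clampI 1, x) = x) by (intros x; apply Hends; apply clamp_1).
  set (path := fun s => vadd z (s * fst v, s * snd v)).
  set (q := fun ts : R * R => Hm (clampI (fst ts), piT (path (snd ts)))).
  assert (Hpath : cont_map (fun ts : R * R => path (snd ts))).
  { unfold path, vadd; simpl. apply cont_map_pair.
    - intros u e He. destruct (cont_fun_lincomb (fst v) 0 snd snd cont_fun_snd cont_fun_snd u e He) as (d & Hd & A).
      exists d; split; [assumption|]; intros w Hw; specialize (A w Hw).
      now replace (_ - _) with (fst v * snd w + 0 * snd w - (fst v * snd u + 0 * snd u)) by ring.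
    - intros u e He. destruct (cont_fun_lincomb (snd v) 0 snd snd cont_fun_snd cont_fun_snd u e He) as (d & Hd & A).
      exists d; split; [assumption|]; intros w Hw; specialize (A w Hw).
      now replace (_ - _) with (snd v * snd w + 0 * snd w - (snd v * snd u + 0 * snd u)) by ring. }
  assert (Hq : continuous (X := R2_top) (Y := T2_top) q).
  { intros V HV u Hu.
    destruct (HHm V HV _ Hu) as (U1 & U2 & (U1' & O1 & E1) & O2 & M1 & M2 & HUV). simpl in M1, M2.
    apply E1 in M1. destruct (O1 _ M1) as (e1 & He1 & B1). destruct (O2 _ M2) as (e2 & He2 & B2).
    destruct (Hpath u e2 He2) as (d & Hd & A).
    exists (Rmin e1 d); split; [now apply Rmin_glb_lt|]; intros w W1 W2.
    pose proof (Rmin_l e1 d); pose proof (Rmin_r e1 d).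
    apply HUV.
    - apply E1; simpl. apply B1; simpl. eapply Rle_lt_trans; [apply clamp_lipschitz | lra].
    - destruct (A w) as [A1 A2]; [split; lra|]. now apply B2. }
  destruct (lift_torus q Hq) as (G & HG & EG).
  set (up := fun ts : R * R => vadd ts (0, 1)).
  assert (Hup : cont_map up) by apply cont_map_vadd, cont_map_id.
  destruct (lift_unique (fun ts => G (up ts)) G) as (v1 & Hv1 & E1).
  { now apply cont_map_comp. } { assumption. }
  { intros ts; rewrite !EG; unfold q, up, path, vadd; simpl. rewrite Rplus_0_r. f_equal; f_equal.
    apply piT_eq; unfold vsub; simpl.
    destruct Hv as [V1 V2]; split; simpl.
    - now replace (_ - _) with (fst v) by ring.
    - now replace (_ - _) with (snd v) by ring. }
  assert (Hslice : forall t, cont_map (fun ts : R * R => G (t, snd ts))).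
  { intros t. apply (cont_map_comp (fun ts : R * R => (t, snd ts)) G); [|assumption].
    apply cont_map_pair; [apply cont_fun_const | apply cont_fun_snd]. }
  (* [G] has increment [v1] over the loop at every time, and any other lift of a slice differs from
     it by an integer vector. Time 1, the identity, shows [v1 = v]; time 0 gives the claim for
     [F]. *)
  assert (Hend : forall t g, cont_map g -> (forall ts : R * R, piT (G (t, snd ts)) = piT (g (path (snd ts)))) ->
    g (vadd z v) = vadd (g z) v1).
  { intros t g Hg Eg.
    destruct (lift_unique (fun ts => g (path (snd ts))) (fun ts => G (t, snd ts))) as (w & Hw & Ew).
    { apply (cont_map_comp (fun ts : R * R => path (snd ts)) g); assumption. } { apply Hslice. }
    { intros ts; now rewrite Eg. }
    pose proof (Ew (t, 1)) as W1; pose proof (Ew (t, 0)) as W0; simpl in W1, W0.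
    assert (P1 : path 1 = vadd z v) by (unfold path; destruct v; simpl; now rewrite !Rmult_1_l).
    assert (P0 : path 0 = z) by (unfold path, vadd; destruct z; simpl; f_equal; ring).
    rewrite P1 in W1; rewrite P0 in W0. rewrite W1, W0.
    specialize (E1 (t, 0)). replace (up (t, 0)) with (t, 1) in E1 by (unfold up, vadd; simpl; f_equal; ring).
    rewrite E1, !vadd_assoc. f_equal; apply vadd_comm. }
  assert (Hv1v : v = v1).
  { apply (vadd_cancel z). apply (Hend 1 (fun u => u)); [apply cont_map_id|].
    intros ts; rewrite EG; unfold q; simpl. now rewrite Hid. }
  rewrite Hv1v at 2. apply (Hend 0 F HF).
  intros ts; rewrite EG, EF; unfold q; simpl. now rewrite Hf.
Qed.

Lemma commutes_int_vadd g : (forall z v, int_vec v -> g (vadd z v) = vadd (g z) v) -> commutes_int g.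
Proof.
  intros Hg z k l. apply (Hg z (IZR k, IZR l)). split; apply is_int_IZR.
Qed.

(** * Connectedness *)

(** An induction principle for a connected subset of the torus, stated upstairs: a lattice-invariant
    property that propagates over distances below [d] is relatively clopen. *)
Lemma connected_fibre (A : T2 -> Prop) (S : R * R -> Prop) d : connected_set T2_top A -> 0 < d ->
  (forall z v, int_vec v -> S z -> S (vadd z v)) ->
  (forall z w, A (piT z) -> A (piT w) -> close d z w -> S z -> S w) ->
  forall z w, A (piT z) -> A (piT w) -> S z -> S w.
Proof.
  intros HA Hd Hinv Hclose z w Az Aw Sz.
  pose (W := fun (B : R * R -> Prop) (x : pt (subspace T2_top A)) =>
    exists u, piT u = proj1_sig x /\ B u).
  assert (Hopen : forall B : R * R -> Prop,
    (forall u u', A (piT u) -> A (piT u') -> close d u u' -> B u -> B u') ->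
    is_open (subspace T2_top A) (W B)).
  { intros B HB. exists (fun x => exists u u', A (piT u) /\ B u /\ close d u u' /\ piT u' = x). split.
    - intros u0 (u & u' & Au & Bu & Huu & E).
      apply eq_sym, piT_eq_vadd in E as (n & Hn & En).
      destruct (close_slack _ _ _ Huu) as (e & He & Hsl).
      exists e; split; [assumption|]; intros u1 H1 H2.
      exists u, (vsub u1 n); split; [assumption|]; split; [assumption|]; split.
      + apply Hsl. rewrite En in H1, H2. unfold vadd in H1, H2; simpl in H1, H2. split; simpl.
        * now replace (fst u1 - fst n - fst u') with (fst u1 - (fst u' + fst n)) by ring.
        * now replace (snd u1 - snd n - snd u') with (snd u1 - (snd u' + snd n)) by ring.
      + rewrite <- (piT_vadd (vsub u1 n) n Hn), vadd_comm, vadd_vsub. reflexivity.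
    - intros [x Ax]; unfold W; simpl; split.
      + intros (u & Eu & Bu). exists u, u; repeat split; try assumption; try (rewrite Rminus_diag, Rabs_R0; assumption).
        now rewrite Eu.
      + intros (u & u' & Au & Bu & Huu & E). exists u'; split; [assumption|].
        apply (HB u); try assumption. now rewrite E. }
  assert (Hall : (forall x, W S x) \/ (forall x, W (fun u => ~ S u) x)).
  { apply HA.
    - now apply Hopen.
    - apply Hopen. intros u u' Au Au' Huu Su Su'. apply Su.
      apply (Hclose u' u); try assumption. now apply close_sym.
    - intros [x Ax]; unfold W; simpl. destruct (piT_surj x) as [u Eu].
      destruct (classic (S u)); [left | right]; exists u; auto.
    - intros [x Ax] [(u & Eu & Su) (u' & Eu' & Su')]. simpl in Eu, Eu'. apply Su'.
      destruct (piT_eq_vadd u' u) as (n & Hn & En); [congruence|]. rewrite En; now apply Hinv. }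
  destruct Hall as [Hall | Hall].
  - destruct (Hall (exist _ (piT w) Aw)) as (u & Eu & Su). simpl in Eu.
    destruct (piT_eq_vadd w u) as (n & Hn & En); [congruence|]. rewrite En; now apply Hinv.
  - destruct (Hall (exist _ (piT z) Az)) as (u & Eu & Su). simpl in Eu. exfalso; apply Su.
    destruct (piT_eq_vadd u z) as (n & Hn & En); [congruence|]. rewrite En; now apply Hinv.
Qed.

(** Being reachable by [d]-chains in the image is a relatively clopen condition on [S]. *)
Lemma connected_image_chain (S : R * R -> Prop) g d z w : connected_set R2_top S -> cont_map g ->
  0 < d -> S z -> S w -> chain d (fun u => exists v, S v /\ u = g v) (g z) (g w).
Proof.
  intros HS Hg Hd Sz Sw.
  set (P := fun u => exists v, S v /\ u = g v).
  pose (W := fun (B : R * R -> Prop) (x : pt (subspace R2_top S)) => B (proj1_sig x)).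
  assert (Hopen : forall B : R * R -> Prop,
    (forall u u', S u -> S u' -> close d (g u) (g u') -> B u -> B u') ->
    is_open (subspace R2_top S) (W B)).
  { intros B HB. exists (fun u' => exists u, S u /\ B u /\ close d (g u) (g u')). split.
    - intros u0 (u & Su & Bu & Hc). destruct (close_slack _ _ _ Hc) as (e & He & Hsl).
      destruct (Hg u0 e He) as (r & Hr & A). exists r; split; [assumption|].
      intros u1 H1 H2. exists u; split; [assumption|]; split; [assumption|]. now apply Hsl, A.
    - intros [x Sx]; unfold W; simpl; split.
      + intros Bx. exists x; repeat split; try assumption; rewrite Rminus_diag, Rabs_R0; assumption.
      + intros (u & Su & Bu & C); now apply (HB u). }
  destruct (HS (W (fun u => chain d P (g z) (g u))) (W (fun u => ~ chain d P (g z) (g u)))) as [Hall | Hall].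
  - apply Hopen. intros u u' Su Su' C Hc. apply chain_trans with (g u); [assumption|].
    apply chain_step with (g u'); [now exists u | assumption | apply chain_refl; now exists u'].
  - apply Hopen. intros u u' Su Su' C Hc Hc'. apply Hc. apply chain_trans with (g u'); [assumption|].
    apply chain_step with (g u); [now exists u' | now apply close_sym | apply chain_refl; now exists u].
  - intros x; unfold W; tauto.
  - intros x; unfold W; tauto.
  - exact (Hall (exist _ w Sw)).
  - exfalso. apply (Hall (exist _ z Sz)). simpl. apply chain_refl; now exists z.
Qed.

Lemma compact_image_bounded (S : R * R -> Prop) g : compact_set R2_top S -> cont_map g ->
  exists B, forall z, S z -> Rabs (fst (g z)) <= B.
Proof.
  intros HS Hg.
  destruct (HS nat (fun n x => Rabs (fst (g (proj1_sig x))) < INR n)) as [l Hl].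
  - intros n. exists (fun z => Rabs (fst (g z)) < INR n); split; [|reflexivity].
    intros z Hz. destruct (cont_map_fst g Hg z (INR n - Rabs (fst (g z)))) as (d & Hd & A); [lra|].
    exists d; split; [assumption|]; intros w W1 W2. specialize (A w (conj W1 W2)).
    pose proof (Rabs_triang_inv (fst (g w)) (fst (g z))); lra.
  - intros x. apply exists_nat_above.
  - assert (Hmax : exists B, forall n, List.In n l -> INR n <= B).
    { clear Hl; induction l as [|n l [B HB]]; [exists 0; intros n []|].
      exists (Rmax B (INR n)); intros k [<- | Hk]; [apply Rmax_r|].
      eapply Rle_trans; [now apply HB | apply Rmax_l]. }
    destruct Hmax as [B HB]; exists B; intros z Sz.
    destruct (Hl (exist _ z Sz)) as (n & Hn & Hzn). simpl in Hzn. specialize (HB n Hn); lra.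
Qed.

(** * Rotation sets *)

Lemma quotient_limit (X : nat -> R) (n : nat -> nat) (v : R) :
  (forall i, (n i < n (S i))%nat) ->
  (forall e, 0 < e -> exists C, forall i, Rabs (X i - INR (n i) * v) <= INR (n i) * e + C) ->
  Un_cv (fun i => X i / INR (n i)) v.
Proof.
  intros Hn HX e He.
  assert (Hin : forall i, (i <= n i)%nat).
  { induction i as [|i IH]; [lia|]. specialize (Hn i); lia. }
  destruct (HX (e / 2)) as [C HC]; [lra|].
  destruct (exists_nat_above (2 * Rabs C / e + 1)) as [N HN].
  exists N; intros i Hi. unfold Rdist.
  assert (HNi : INR N <= INR (n i)) by (apply le_INR; specialize (Hin i); lia).
  assert (HC2 : 0 <= 2 * Rabs C / e).
  { apply Rmult_le_pos; [pose proof (Rabs_pos C); lra | left; now apply Rinv_0_lt_compat]. }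
  assert (Hni : 0 < INR (n i)) by lra.
  specialize (HC i).
  replace (X i / INR (n i) - v) with ((X i - INR (n i) * v) * / INR (n i)) by (field; lra).
  rewrite Rabs_mult, (Rabs_pos_eq (/ INR (n i))) by (left; now apply Rinv_0_lt_compat).
  apply Rmult_lt_reg_r with (INR (n i)); [assumption|].
  rewrite Rmult_assoc, Rinv_l, Rmult_1_r by lra.
  assert (HCn : 2 * Rabs C < INR (n i) * e).
  { replace (2 * Rabs C) with (2 * Rabs C / e * e) by (field; lra).
    apply Rmult_lt_compat_r; lra. }
  pose proof (Rle_abs C). lra.
Qed.

Lemma rotation_set_point F v :
  (forall e, 0 < e -> exists C, forall n z,
     Rabs (fst (Nat.iter n F z) - fst z - INR n * fst v) <= INR n * e + C /\
     Rabs (snd (Nat.iter n F z) - snd z - INR n * snd v) <= INR n * e + C) ->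
  forall w, rotation_set F w <-> w = v.
Proof.
  intros HF.
  assert (Hlim : forall z n, (forall i, (n i < n (S i))%nat) ->
    Un_cv (fun i => (fst (Nat.iter (n i) F (z i)) - fst (z i)) / INR (n i)) (fst v) /\
    Un_cv (fun i => (snd (Nat.iter (n i) F (z i)) - snd (z i)) / INR (n i)) (snd v)).
  { intros z n Hn; split.
    - apply (quotient_limit (fun i => fst (Nat.iter (n i) F (z i)) - fst (z i))); [assumption|].
      intros e He; destruct (HF e He) as [C HC]; exists C; intros i; now destruct (HC (n i) (z i)).
    - apply (quotient_limit (fun i => snd (Nat.iter (n i) F (z i)) - snd (z i))); [assumption|].
      intros e He; destruct (HF e He) as [C HC]; exists C; intros i; now destruct (HC (n i) (z i)). }
  intros w; split.
  - intros (z & n & Hn & L1 & L2). destruct (Hlim z n Hn) as [M1 M2].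
    destruct w as [w1 w2], v as [v1 v2]; simpl in *.
    f_equal; eapply UL_sequence; eassumption.
  - intros ->. exists (fun _ => (0, 0)), (fun i => i); split; [intros; lia|].
    apply (Hlim (fun _ => (0, 0)) (fun i => i)); intros; lia.
Qed.

(** * Straightening the height function *)

(** The matrix with columns [(p, q)] and [(r, s)]; for determinant one its inverse is
    [lin s (- q) (- r) p]. *)
Definition lin (p q r s : Z) (z : R * R) : R * R :=
  (IZR p * fst z + IZR r * snd z, IZR q * fst z + IZR s * snd z).

Lemma lin_cont p q r s : cont_map (lin p q r s).
Proof.
  apply cont_map_pair; apply cont_fun_lincomb; auto using cont_fun_fst, cont_fun_snd.
Qed.

Lemma lin_vadd p q r s z w : lin p q r s (vadd z w) = vadd (lin p q r s z) (lin p q r s w).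
Proof. unfold lin, vadd; simpl; f_equal; ring. Qed.

Lemma lin_int p q r s v : int_vec v -> int_vec (lin p q r s v).
Proof.
  intros (k & l & ->)%int_vec_IZR. split; unfold lin; cbn [fst snd];
    rewrite <- !mult_IZR, <- plus_IZR; apply is_int_IZR.
Qed.

Lemma lin_inverse p q r s z : (p * s - q * r = 1)%Z ->
  lin s (- q) (- r) p (lin p q r s z) = z.
Proof.
  intros Hdet. assert (E : IZR p * IZR s - IZR q * IZR r = 1).
  { rewrite <- !mult_IZR, <- minus_IZR, Hdet; reflexivity. }
  destruct z as [x y]; unfold lin; cbn [fst snd]; rewrite !opp_IZR. f_equal.
  - transitivity ((IZR p * IZR s - IZR q * IZR r) * x); [ring | rewrite E; ring].
  - transitivity ((IZR p * IZR s - IZR q * IZR r) * y); [ring | rewrite E; ring].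
Qed.

Lemma close_lin p q r s d : 0 < d -> exists d', 0 < d' /\ forall z w, close d' z w ->
  close d (lin p q r s z) (lin p q r s w).
Proof.
  intros Hd.
  set (M := Rabs (IZR p) + Rabs (IZR q) + Rabs (IZR r) + Rabs (IZR s) + 1).
  pose proof (Rabs_pos (IZR p)); pose proof (Rabs_pos (IZR q));
    pose proof (Rabs_pos (IZR r)); pose proof (Rabs_pos (IZR s)).
  assert (HM : 0 < M) by (unfold M; lra).
  assert (HdM : 0 < d / M) by now apply Rdiv_lt_0_compat.
  assert (E : M * (d / M) = d) by (field; lra). unfold M at 1 in E.
  exists (d / M); split; [assumption|]; intros z w [C1 C2].
  split; simpl.
  - replace (_ - _) with (IZR p * (fst w - fst z) + IZR r * (snd w - snd z)) by ring.
    eapply Rle_lt_trans; [apply Rabs_triang|]. rewrite !Rabs_mult. nra.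
  - replace (_ - _) with (IZR q * (fst w - fst z) + IZR s * (snd w - snd z)) by ring.
    eapply Rle_lt_trans; [apply Rabs_triang|]. rewrite !Rabs_mult. nra.
Qed.

Lemma Z_multiple_increment (p : R * R -> R) v s : (forall z, p (vadd z v) = p z + s) ->
  forall (k : Z) z, p (vadd z (IZR k * fst v, IZR k * snd v)) = p z + IZR k * s.
Proof.
  intros Hp.
  assert (Hn : forall (n : nat) z, p (vadd z (INR n * fst v, INR n * snd v)) = p z + INR n * s).
  { induction n as [|n IH]; intros z.
    - simpl. rewrite !Rmult_0_l, Rplus_0_r. f_equal. destruct z; unfold vadd; simpl; f_equal; ring.
    - rewrite S_INR. replace (vadd z _) with (vadd (vadd z (INR n * fst v, INR n * snd v)) v)
        by (unfold vadd; simpl; f_equal; ring).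
      rewrite Hp, IH; ring. }
  intros k z. destruct (Z_le_gt_dec 0 k) as [Hk | Hk].
  - rewrite <- (Z2Nat.id k), <- INR_IZR_INZ by assumption; apply Hn.
  - assert (E : IZR k = - INR (Z.to_nat (- k))).
    { rewrite INR_IZR_INZ, Z2Nat.id, opp_IZR by lia; ring. }
    rewrite E. set (n := Z.to_nat (- k)).
    pose proof (Hn n (vadd z (- INR n * fst v, - INR n * snd v))) as A.
    replace (vadd (vadd z (- INR n * fst v, - INR n * snd v)) (INR n * fst v, INR n * snd v)) with z in A
      by (destruct z; unfold vadd; simpl; f_equal; ring).
    lra.
Qed.

Section Reduction.
Variables (h : T2 -> S1) (Ht : R * R -> R).
Hypotheses (HHt : cont_fun Ht) (EHt : forall z, piS (Ht z) = h (piT z)).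

Lemma height_increment v : int_vec v -> exists k : Z, forall z, Ht (vadd z v) = Ht z + IZR k.
Proof.
  intros Hv.
  assert (Hi : forall z, is_int (Ht (vadd z v) - Ht z)).
  { intros z; apply piS_eq. now rewrite !EHt, piT_vadd. }
  destruct (Hi (0, 0)) as [k Hk]. exists k; intros z. rewrite <- Hk.
  rewrite (int_valued_constant2 (fun z => Ht (vadd z v) - Ht z)) with (w := z).
  - ring.
  - apply cont_fun_minus; [|assumption].
    apply (cont_fun_comp (fun z => vadd z v)); [apply cont_map_vadd, cont_map_id | assumption].
  - assumption.
Qed.

Lemma height_periods : exists a b : Z, forall z k l,
  Ht (vadd z (IZR k, IZR l)) = Ht z + IZR (k * a + l * b).
Proof.
  destruct (height_increment (1, 0)) as [a Ha]; [split; apply is_int_IZR|].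
  destruct (height_increment (0, 1)) as [b Hb]; [split; apply is_int_IZR|].
  exists a, b; intros z k l.
  pose proof (Z_multiple_increment Ht (1, 0) (IZR a) Ha k z) as A.
  pose proof (Z_multiple_increment Ht (0, 1) (IZR b) Hb l (vadd z (IZR k, 0))) as B.
  simpl in A, B. rewrite !Rmult_1_r, !Rmult_0_r in A. rewrite !Rmult_1_r, !Rmult_0_r, A in B.
  replace (vadd z (IZR k, IZR l)) with (vadd (vadd z (IZR k, 0)) (0, IZR l))
    by (unfold vadd; simpl; f_equal; ring).
  rewrite B, plus_IZR, !mult_IZR; ring.
Qed.

Lemma height_step_small : exists d, 0 < d /\ forall z w, close d z w -> Rabs (Ht w - Ht z) < 1.
Proof.
  destruct height_periods as (a & b & Hab).
  apply equivariant_uniform; [assumption | | lra].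
  intros k l; exists (IZR (k * a + l * b)); intros z; apply Hab.
Qed.

Lemma same_level c z w d : (forall z w, close d z w -> Rabs (Ht w - Ht z) < 1) ->
  h (piT z) = piS c -> h (piT w) = piS c -> close d z w -> Ht z = Ht w.
Proof.
  intros Hd Hz Hw Hzw. rewrite <- EHt in Hz, Hw. apply piS_eq in Hz, Hw.
  apply is_int_eq.
  - replace (Ht z - Ht w) with ((Ht z - c) - (Ht w - c)) by ring. now apply is_int_minus.
  - rewrite Rabs_minus_sym; auto.
Qed.

Hypothesis (Hconn : forall xi, connected_set T2_top (fun x => h x = xi)).

Section Basis.
Variables (a b p q r s : Z).
Hypotheses (Hab : forall z k l, Ht (vadd z (IZR k, IZR l)) = Ht z + IZR (k * a + l * b))
  (Hdet : (p * s - q * r = 1)%Z) (Hpq : (p * a + q * b = 0)%Z).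

(* If the period of [Ht] along the second basis vector were [g >= 2], the levels congruent to
   [Ht (0, 0)] modulo [g] would be a proper clopen part of a fibre. *)
Lemma primitive_period g : (1 <= g)%Z -> (r * a + s * b = g)%Z -> g = 1%Z.
Proof.
  intros Hg Hrs. destruct (Z.eq_dec g 1) as [|Hg1]; [assumption | exfalso].
  assert (Hg2 : 2 <= IZR g) by (apply (IZR_le 2); lia).
  assert (Hmult : forall k l, exists j, (k * a + l * b = g * j)%Z).
  { intros k l. exists (p * l - q * k)%Z.
    (* in the basis [(p, q)], [(r, s)] the vector [(k, l)] has second coordinate [p l - q k] *)
    transitivity ((s * k - r * l) * (p * a + q * b) + (p * l - q * k) * (r * a + s * b))%Z.
    - transitivity ((p * s - q * r) * (k * a + l * b))%Z; [rewrite Hdet; ring | ring].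
    - rewrite Hpq, Hrs; ring. }
  set (w := fun t => scale t (IZR r, IZR s)).
  (* The intermediate value theorem along the second basis vector yields a point of the fibre
     through the origin whose level differs by 1, which is not a multiple of [g]. *)
  assert (Hw : exists t, Ht (w t) = Ht (0, 0) + 1).
  { assert (Hc : continuity (fun t => Ht (w t) - (Ht (0, 0) + 1))).
    { intros t e He. simpl. unfold Rdist.
      destruct (HHt (w t) e He) as (d & Hd & A).
      destruct (scale_continuous (IZR r, IZR s) d Hd) as (e' & He' & Hs).
      exists e'; split; [assumption|]; intros t' [_ Ht'].
      replace (_ - _) with (Ht (w t') - Ht (w t)) by ring. now apply A, Hs. }
    assert (H1 : Ht (w 1) = Ht (0, 0) + IZR g).
    { unfold w; rewrite scale_1, <- Hrs, <- Hab. f_equal; unfold vadd; simpl; f_equal; ring. }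
    assert (H0 : w 0 = (0, 0)) by apply scale_0.
    destruct (IVT (fun t => Ht (w t) - (Ht (0, 0) + 1)) 0 1 Hc) as (t & _ & Et); [lra | rewrite H0; lra | rewrite H1; lra |].
    exists t; lra. }
  destruct Hw as [t Hwt].
  destruct height_step_small as (d & Hd & Hsmall).
  assert (Hin : exists k : Z, Ht (w t) = Ht (0, 0) + IZR (g * k)).
  { apply (connected_fibre (fun x => h x = piS (Ht (0, 0))) (fun z => exists k : Z, Ht z = Ht (0, 0) + IZR (g * k)) d)
      with (z := (0, 0)).
    - apply Hconn.
    - assumption.
    - intros z v (k & l & ->)%int_vec_IZR [j Hj]. destruct (Hmult k l) as [i Hi].
      exists (j + i)%Z. rewrite Hab, Hi, Hj, Z.mul_add_distr_l, !plus_IZR; ring.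
    - intros z u Hz Hu Hzu [k Hk]. exists k. rewrite <- Hk. symmetry.
      now apply (same_level (Ht (0, 0)) z u d).
    - now rewrite EHt.
    - rewrite <- EHt, Hwt. apply piS_eq. exists 1%Z; ring.
    - exists 0%Z. rewrite Z.mul_0_r; ring. }
  destruct Hin as [k Hk]. rewrite Hwt in Hk.
  assert (E : 1%Z = (g * k)%Z) by (apply eq_IZR; lra).
  assert (k = 0 \/ k <= -1 \/ 1 <= k)%Z by lia. nia.
Qed.

(** For [height_fibre], [connected_fibre] is applied to reachability from [z] along the level modulo
    the lattice. The chain ends at a lattice translate of [w], and equality of levels annihilates
    its second coordinate. *)
Lemma straight_height : (r * a + s * b = 1)%Z -> height (fun u => Ht (lin p q r s u)).
Proof.
  intros Hrs. split.
  - apply (cont_fun_comp (lin p q r s)); [apply lin_cont | assumption].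
  - intros x y. replace (lin p q r s (x + 1, y)) with (vadd (lin p q r s (x, y)) (IZR p, IZR q))
      by (unfold lin, vadd; simpl; f_equal; ring).
    rewrite Hab, Hpq; ring.
  - intros x y. replace (lin p q r s (x, y + 1)) with (vadd (lin p q r s (x, y)) (IZR r, IZR s))
      by (unfold lin, vadd; simpl; f_equal; ring).
    rewrite Hab, Hrs; reflexivity.
  - intros d z w Hd Hzw.
    set (Q := lin p q r s) in *. set (Qi := lin s (- q) (- r) p).
    assert (HQi : forall u, Qi (Q u) = u) by (intros u; now apply lin_inverse).
    destruct height_step_small as (d1 & Hd1 & Hsmall).
    destruct (close_lin s (- q) (- r) p d Hd) as (d2 & Hd2 & Hlin). fold Qi in Hlin.
    assert (HQQi : forall u, Q (Qi u) = u).
    { intros u. pose proof (lin_inverse s (- q) (- r) p u ltac:(lia)) as E.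
      rewrite !Z.opp_involutive in E. exact E. }
    assert (Hin : exists u, chain d (fun u => Ht (Q u) = Ht (Q z)) z u /\ piT (Q w) = piT (Q u)).
    { apply (connected_fibre (fun x => h x = piS (Ht (Q z)))
        (fun y => exists u, chain d (fun u => Ht (Q u) = Ht (Q z)) z u /\ piT y = piT (Q u)) (Rmin d1 d2))
        with (z := Q z).
      - apply Hconn.
      - now apply Rmin_glb_lt.
      - intros y v Hv (u & Hu & E). exists u; split; [assumption|]. now rewrite piT_vadd.
      - intros y y' Hy Hy' Hyy (u & Hu & E).
        destruct (piT_eq_vadd _ _ E) as (n & Hn & En).
        set (y1 := vsub y' n).
        assert (Ey' : y' = vadd y1 n) by (destruct y'; unfold y1, vadd, vsub; simpl; f_equal; ring).
        assert (Hc : close (Rmin d1 d2) (Q u) y1).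
        { destruct Hyy as [C1 C2]. rewrite En, Ey' in C1, C2. unfold vadd in C1, C2; simpl in C1, C2.
          split; [replace (fst y1 - fst (Q u)) with (fst y1 + fst n - (fst (Q u) + fst n)) by ring
                 |replace (snd y1 - snd (Q u)) with (snd y1 + snd n - (snd (Q u) + snd n)) by ring]; assumption. }
        assert (Hlev : Ht (Q u) = Ht y1).
        { apply (same_level (Ht (Q z)) _ _ d1 Hsmall).
          - now rewrite <- E.
          - now rewrite <- (piT_vadd y1 n Hn), <- Ey'.
          - eapply close_mono; [apply Rmin_l | exact Hc]. }
        pose proof (chain_right _ _ _ _ Hu) as Hul.
        exists (Qi y1); split.
        + apply chain_trans with u; [assumption|].
          apply chain_step with (Qi y1); [assumption | | apply chain_refl; rewrite HQQi; congruence].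
          rewrite <- (HQi u). apply Hlin. eapply close_mono; [apply Rmin_r | exact Hc].
        + now rewrite HQQi, Ey', piT_vadd.
      - now rewrite EHt.
      - rewrite <- EHt. now rewrite Hzw.
      - exists z; split; [now apply chain_refl | reflexivity]. }
    destruct Hin as (u & Hu & E).
    destruct (piT_eq_vadd (Q u) (Q w)) as (n & Hn & En); [now symmetry|].
    assert (Eu : u = vadd w (Qi n)).
    { rewrite <- (HQi u), En. unfold Qi. rewrite lin_vadd. fold Qi. now rewrite HQi. }
    destruct (int_vec_IZR _ (lin_int s (- q) (- r) p n Hn)) as (m & l & Enn). fold Qi in Enn.
    exists m. replace (tr m w) with u; [assumption|].
    pose proof (chain_right _ _ _ _ Hu) as Hul.
    assert (HQn : n = (IZR (p * m + r * l), IZR (q * m + s * l))).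
    { rewrite <- (HQQi n), Enn. unfold Q, lin; simpl. now rewrite !plus_IZR, !mult_IZR. }
    cbv beta in Hul; rewrite En, HQn, Hab, <- Hzw in Hul.
    assert (Hl : l = 0%Z).
    { assert (E0 : IZR ((p * m + r * l) * a + (q * m + s * l) * b) = 0) by lra.
      apply (eq_IZR _ 0) in E0.
      replace ((p * m + r * l) * a + (q * m + s * l) * b)%Z with
        (m * (p * a + q * b) + l * (r * a + s * b))%Z in E0 by ring.
      rewrite Hpq, Hrs in E0. lia. }
    rewrite Eu, Enn, Hl. unfold vadd, tr; simpl. now rewrite Rplus_0_r.
Qed.
End Basis.

(** Compact generation is known for the image under [Phi], so its component and generator are
    carried back by a lift [g] of the inverse [Psi], followed by the change of basis;
    [generated_narrow] then applies to their images. *)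
Lemma generated_level p q r s c : (p * s - q * r = 1)%Z ->
  height (fun u => Ht (lin p q r s u)) ->
  compactly_generated (fun x => h x = piS c) -> regular (fun u => Ht (lin p q r s u)) c ->
  exists M, (2 <= M)%nat /\ forall d, 0 < d -> narrow (fun u => Ht (lin p q r s u)) M d c.
Proof.
  intros Hdet HH (Phi & (HPhi & Psi & HPsi & E1 & E2) & _ & C' & (HCne & HCs & HCconn & _) & G0 & HG0 & HG0c & HG0conn & HCG0) Hreg.
  set (Q := lin p q r s) in *. set (Qi := lin s (- q) (- r) p).
  set (H := fun u => Ht (Q u)) in *.
  assert (HQQi : forall u, Q (Qi u) = u).
  { intros u. pose proof (lin_inverse s (- q) (- r) p u ltac:(lia)) as E.
    rewrite !Z.opp_involutive in E. exact E. }
  destruct (lift_torus (fun z => Psi (piT z))) as (g & Hg & Eg).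
  { exact (continuous_comp (X := R2_top) (Y := T2_top) (Z := T2_top) piT Psi continuous_piT HPsi). }
  destruct (lift_inverse Psi Phi g HPhi E2 E1 Hg Eg) as (gi & _ & _ & Hgi & _).
  set (L := fun z => Qi (g z)).
  assert (HL : cont_map L) by (apply (cont_map_comp g Qi); [assumption | apply lin_cont]).
  destruct HCne as [z0 Cz0].
  assert (Hlevel : forall z, C' z -> is_int (H (L z) - c)).
  { intros z Cz. unfold H, L. rewrite HQQi. apply piS_eq. rewrite EHt, Eg.
    destruct (HCs z Cz) as (x & Hx & Ex). now rewrite <- Ex, E1. }
  destruct (Hlevel z0 Cz0) as [k0 Hk0].
  destruct (height_uniform H HH 1) as (d1 & Hd1 & Hsmall); [lra|].
  assert (Hconst : forall z, C' z -> H (L z) = c + IZR k0).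
  { intros z Cz.
    assert (Hch := connected_image_chain C' L d1 z0 z HCconn HL Hd1 Cz0 Cz).
    assert (Hgen : forall u u', chain d1 (fun u => exists v, C' v /\ u = L v) u u' -> H u = H u').
    { induction 1 as [u Hu | u u1 u2 Hu Hc Hu12 IH]; [reflexivity|]. rewrite <- IH.
      destruct Hu as (v & Cv & ->). destruct (chain_left _ _ _ _ Hu12) as (v1 & Cv1 & ->).
      apply is_int_eq.
      - replace (H (L v) - H (L v1)) with ((H (L v) - c) - (H (L v1) - c)) by ring.
        apply is_int_minus; now apply Hlevel.
      - rewrite Rabs_minus_sym; now apply Hsmall. }
    rewrite <- (Hgen _ _ Hch). lra. }
  (* The carried component lies on a single level, which is congruent to [c] modulo 1; [down] moves
     it to [c] itself. *)
  set (down := fun u : R * R => vadd u (0, - IZR k0)).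
  assert (Hdown : forall u, H (down u) = H u - IZR k0).
  { intros [x y]; unfold down, vadd; simpl. rewrite Rplus_0_r, <- opp_IZR, (height_up H HH), opp_IZR.
    reflexivity. }
  set (Th := fun z => down (L z)).
  assert (HTh : cont_map Th) by now apply cont_map_vadd.
  assert (HThc : forall z, C' z -> H (Th z) = c).
  { intros z Cz; unfold Th; rewrite Hdown, (Hconst z Cz); ring. }
  (* The unit translation upstairs becomes a lattice translation [(v, l)]. Since it preserves the
     level, [l = 0]; since [g] is injective, [v] is not zero. *)
  destruct (lift_translate Psi g Hg Eg (1, 0)) as (v' & Hv' & Etr); [split; apply is_int_IZR|].
  destruct (int_vec_IZR _ (lin_int s (- q) (- r) p v' Hv')) as (v & l & Ev). fold Qi in Ev.
  assert (HTh1 : forall z, Th (vadd z (1, 0)) = vadd (Th z) (IZR v, IZR l)).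
  { intros z; unfold Th, down, L. rewrite Etr. unfold Qi at 1; rewrite lin_vadd. fold Qi. rewrite Ev.
    rewrite !vadd_assoc. f_equal; apply vadd_comm. }
  assert (HC1 : forall n z, C' z -> C' (tr n z)).
  { intros n z Cz. apply HCG0. apply HCG0 in Cz as [m Hm]. exists (m + n)%Z.
    unfold tr; simpl. replace (fst z + IZR n - IZR (m + n)) with (fst z - IZR m); [assumption|].
    rewrite plus_IZR; ring. }
  assert (Hl : l = 0%Z).
  { pose proof (HThc _ (HC1 1%Z z0 Cz0)) as A. pose proof (HThc _ Cz0) as B.
    replace (tr 1 z0) with (vadd z0 (1, 0)) in A by (unfold vadd, tr; simpl; now rewrite Rplus_0_r).
    rewrite HTh1 in A. destruct (Th z0) as [x y]. unfold vadd in A; simpl in A.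
    rewrite (height_up H HH) in A.
    change (H (tr v (x, y)) + IZR l = c) in A. rewrite (height_tr H HH) in A.
    apply eq_IZR; lra. }
  rewrite Hl in HTh1.
  assert (Hv : v <> 0%Z).
  { intros Ev0. rewrite Ev0 in HTh1.
    assert (Eq : forall z, g (vadd z (1, 0)) = g z).
    { intros z. specialize (HTh1 z). unfold Th, down in HTh1.
      assert (El : L (vadd z (1, 0)) = L z).
      { pose proof (f_equal fst HTh1) as A; pose proof (f_equal snd HTh1) as B.
        unfold vadd at 1 3 4 in A; unfold vadd at 1 3 4 in B; cbn [fst snd] in A, B.
        rewrite (surjective_pairing (L (vadd z (1, 0)))), (surjective_pairing (L z)). f_equal; lra. }
      unfold L in El. rewrite <- (HQQi (g z)), <- El. now rewrite HQQi. }
    specialize (Eq (0, 0)). apply (f_equal gi) in Eq. rewrite !Hgi in Eq.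
    unfold vadd in Eq; simpl in Eq. injection Eq as A; lra. }
  assert (HThn : forall n z, Th (tr n z) = tr (n * v) (Th z)).
  { intros n z.
    assert (A1 : forall z, fst (Th (vadd z (1, 0))) = fst (Th z) + IZR v) by (intros u; now rewrite HTh1).
    assert (A2 : forall z, snd (Th (vadd z (1, 0))) = snd (Th z) + 0) by (intros u; now rewrite HTh1).
    pose proof (Z_multiple_increment (fun z => fst (Th z)) (1, 0) (IZR v) A1 n z) as B1.
    pose proof (Z_multiple_increment (fun z => snd (Th z)) (1, 0) 0 A2 n z) as B2.
    cbn [fst snd] in B1, B2. rewrite !Rmult_1_r, !Rmult_0_r in B1. rewrite !Rmult_1_r, !Rmult_0_r in B2.
    replace (tr n z) with (vadd z (IZR n, 0)) by (unfold vadd, tr; simpl; now rewrite Rplus_0_r).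
    unfold tr. rewrite mult_IZR, <- B1. rewrite Rplus_0_r in B2. rewrite <- B2. now destruct (Th (vadd z (IZR n, 0))). }
  destruct (compact_image_bounded G0 Th HG0c HTh) as [B HB].
  assert (HCG0' : forall z, C' z <-> exists n : Z, G0 (tr (- n) z)).
  { intros z; rewrite HCG0. split; intros [n Hn]; exists n; unfold tr in *; rewrite opp_IZR in *; exact Hn. }
  apply (generated_narrow H HH c (fun u => exists z, C' z /\ u = Th z) (fun u => exists z, G0 z /\ u = Th z) v B); try assumption.
  - intros u (z & Cz & ->); now apply HThc.
  - intros d u u' Hd (z & Cz & ->) (z' & Cz' & ->). now apply connected_image_chain.
  - intros d u u' Hd (z & Cz & ->) (z' & Cz' & ->). now apply connected_image_chain.
  - intros u (z & Gz & ->); now apply HB.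
  - intros u; split.
    + intros (z & Cz & ->). apply HCG0' in Cz as [n Hn]. exists n, (tr (- n) z); split; [assumption|].
      now rewrite HThn, Z.mul_opp_l.
    + intros (n & z & Gz & E). exists (tr n z); split; [now apply HC1, HG0|].
      rewrite HThn, <- E, tr_tr, Z.add_opp_diag_l, tr_0. reflexivity.
  - apply HCG0' in Cz0 as [n Hn]. exists (Th (tr (- n) z0)), (tr (- n) z0); auto.
Qed.
End Reduction.

(** * Reduction to the straightened system and return to the original coordinates *)

Theorem theoremB (f : T2 -> T2) (F : R * R -> R * R) (h : T2 -> S1) (rho : R)
  (Omega : S1 -> Prop) :
  (* f ∈ Homeo_0(T^2) *)
  homeomorphism (X := T2_top) (Y := T2_top) f ->
  homotopic (X := T2_top) (Y := T2_top) f (fun x => x) ->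
  (* F is a lift of f *)
  continuous (X := R2_top) (Y := R2_top) F ->
  (forall z, piT (F z) = f (piT z)) ->
  (* h is a semiconjugacy from f to the irrational rotation R_rho *)
  irrational rho ->
  continuous (X := T2_top) (Y := S1_top) h ->
  (forall xi, exists x, h x = xi) ->
  (forall x, h (f x) = rotS rho (h x)) ->
  (* every fibre is an essential annular continuum *)
  (forall xi, essential_annular_continuum (fun x => h x = xi)) ->
  (* positive-measure set of compactly generated fibres *)
  positive_measure_S1 Omega ->
  (forall xi, Omega xi -> compactly_generated (fun x => h x = xi)) ->
  (* unique rotation vector *)
  exists v : R * R, forall w, rotation_set F w <-> w = v.
Proof.
  intros (Hf & fi & Hfi & Efi1 & Efi2) Hhom HF EF Hirr Hh _ Hsemi Hann [_ HOnull] HOcg.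
  apply continuous_cont_map in HF.
  pose proof (lift_commutes f F Hhom HF EF) as Fc.
  destruct (lift_inverse f fi F Hfi Efi1 Efi2 HF EF) as (Fi & HFi & EFi & FiF & FFi).
  assert (Fic : forall z v, int_vec v -> Fi (vadd z v) = vadd (Fi z) v).
  { intros z v Hv. rewrite <- (FiF (vadd (Fi z) v)), Fc, FFi; auto. }
  destruct (lift_circle (fun z => h (piT z))) as (Ht & HHt & EHt).
  { exact (continuous_comp (X := R2_top) (Y := T2_top) (Z := S1_top) piT h continuous_piT Hh). }
  assert (Hconn : forall xi, connected_set T2_top (fun x => h x = xi)).
  { intros xi; apply (Hann xi). }
  assert (Hrot : exists k : Z, forall z, Ht (F z) = Ht z + (rho + IZR k)).
  { assert (Hi : forall z, is_int (Ht (F z) - Ht z - rho)).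
    { intros z. assert (E : piS (Ht (F z)) = piS (proj1_sig (h (piT z)) + rho)).
      { rewrite EHt, EF; apply Hsemi. }
      apply piS_eq in E. rewrite <- EHt in E.
      destruct (is_int_plus _ _ E (proj_piS (Ht z))) as [j Hj]. exists j; lra. }
    destruct (Hi (0, 0)) as [k Hk]. exists k; intros z. rewrite <- Hk.
    rewrite (int_valued_constant2 (fun z => Ht (F z) - Ht z - rho)) with (w := z); [ring | | assumption].
    apply cont_fun_minus; [apply cont_fun_minus; [now apply cont_fun_comp | assumption] | apply cont_fun_const]. }
  destruct Hrot as [k Hrot]. set (rho' := rho + IZR k) in *.
  assert (Hirr' : irrational rho').
  { intros n d Hd E. apply (Hirr (n - k * d)%Z d Hd).
    assert (IZR d <> 0) by (apply not_0_IZR; assumption).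
    rewrite minus_IZR, mult_IZR. apply (Rplus_eq_reg_r (IZR k)). fold rho'. rewrite E. field; assumption. }
  destruct (height_periods h Ht HHt EHt) as (a & b & Hab).
  (* If both periods vanished, [Ht] would be periodic and hence bounded, although it changes by
     [rho'] at each step of [F]. *)
  assert (Hab0 : Z.gcd a b <> 0%Z).
  { intros E. apply Z.gcd_eq_0 in E as [-> ->].
    assert (Hper : zperiodic Ht).
    { intros z i j. specialize (Hab z i j). rewrite !Z.mul_0_r, Rplus_0_r in Hab. exact Hab. }
    destruct (zperiodic_bounded Ht HHt Hper) as [K HK].
    assert (Hn : forall n, Ht (Nat.iter n F (0, 0)) = Ht (0, 0) + INR n * rho').
    { intros n; apply (iter_height Ht F rho' Hrot). }
    assert (Hr0 : 0 < Rabs rho').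
    { apply Rabs_pos_lt; intros E0. apply (Hirr' 0%Z 1%Z); [lia | rewrite E0; lra]. }
    destruct (exists_nat_above (2 * K / Rabs rho')) as [n Hnn].
    apply (Rmult_lt_compat_r (Rabs rho')) in Hnn; [|assumption].
    unfold Rdiv in Hnn; rewrite Rmult_assoc, Rinv_l, Rmult_1_r in Hnn by lra.
    rewrite <- (Rabs_pos_eq (INR n)), <- Rabs_mult in Hnn by apply pos_INR.
    replace (INR n * rho') with (Ht (Nat.iter n F (0, 0)) + - Ht (0, 0)) in Hnn by (rewrite Hn; ring).
    pose proof (Rabs_triang (Ht (Nat.iter n F (0, 0))) (- Ht (0, 0))). rewrite Rabs_Ropp in *.
    pose proof (HK (0, 0)); pose proof (HK (Nat.iter n F (0, 0))). lra. }
  set (g := Z.gcd a b) in *.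
  destruct (Z.gcd_divide_l a b) as [a' Ha']; destruct (Z.gcd_divide_r a b) as [b' Hb']. fold g in Ha', Hb'.
  destruct (Z.gcd_bezout a b g eq_refl) as (r & s & Hrs).
  (* [(b', - a')] spans the kernel of the period homomorphism, and the Bezout vector [(r, s)]
     completes it to a basis of the lattice. *)
  assert (Hdet : (b' * s - (- a') * r = 1)%Z).
  { apply (Z.mul_reg_r _ _ g Hab0).
    transitivity (r * (a' * g) + s * (b' * g))%Z; [ring|].
    now rewrite <- Ha', <- Hb', Z.mul_1_l. }
  assert (Hpq : (b' * a + - a' * b = 0)%Z).
  { transitivity (b' * (a' * g) + - a' * (b' * g))%Z; [now rewrite <- Ha', <- Hb' | ring]. }
  assert (Hg1 : g = 1%Z).
  { apply (primitive_period h Ht HHt EHt Hconn a b b' (- a') r s Hab Hdet Hpq); [|assumption].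
    pose proof (Z.gcd_nonneg a b). fold g in H; lia. }
  rewrite Hg1 in Hrs.
  pose proof (straight_height h Ht HHt EHt Hconn a b b' (- a') r s Hab Hdet Hpq Hrs) as HH.
  set (Q := lin b' (- a') r s) in *. set (Qi := lin s (- - a') (- r) b').
  assert (HQi : forall u, Qi (Q u) = u) by (intros u; now apply lin_inverse).
  assert (HQQi : forall u, Q (Qi u) = u).
  { intros u. pose proof (lin_inverse s (- - a') (- r) b' u ltac:(lia)) as E.
    rewrite !Z.opp_involutive in E. unfold Q, Qi. rewrite !Z.opp_involutive. exact E. }
  set (conj := fun (g : R * R -> R * R) u => Qi (g (Q u))).
  assert (Hconj : forall g, cont_map g -> cont_map (conj g)).
  { intros g0 Hg0. apply (cont_map_comp Q (fun z => Qi (g0 z))); [apply lin_cont|].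
    apply (cont_map_comp g0 Qi); [assumption | apply lin_cont]. }
  assert (Hconjc : forall g, (forall z v, int_vec v -> g (vadd z v) = vadd (g z) v) -> commutes_int (conj g)).
  { intros g0 Hg0. apply commutes_int_vadd. intros z v Hv. unfold conj, Q, Qi.
    rewrite lin_vadd, Hg0, lin_vadd by now apply lin_int. f_equal. apply HQi. }
  destruct (straight_rotation (fun u => Ht (Q u)) (conj F) (conj Fi) rho' (fun t => 0 <= t < 1 /\ Omega (piS t)) HH)
    as [beta Hbeta]; auto.
  - intros z; unfold conj. now rewrite HQQi, FiF, HQi.
  - intros z; unfold conj. rewrite HQQi. apply Hrot.
  - tauto.
  - intros c [_ Hc] Hreg. apply (generated_level h Ht EHt b' (- a') r s c Hdet HH); [|assumption]. now apply HOcg.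
  (* In straightened coordinates the vertical drift is [rho'] with error at most [2 B], since the
     height differs from the second coordinate by at most [B]; [M] below dominates the entries of
     the matrix [Q] that carries the rotation vector back. *)
  - destruct (height_bounded _ HH) as (B & HB & Hbound).
    exists (Q (beta, rho')). apply rotation_set_point. intros e He.
    set (M := Rabs (IZR b') + Rabs (IZR (- a')) + Rabs (IZR r) + Rabs (IZR s) + 1).
    pose proof (Rabs_pos (IZR b')); pose proof (Rabs_pos (IZR (- a')));
      pose proof (Rabs_pos (IZR r)); pose proof (Rabs_pos (IZR s)).
    assert (HM : 0 < M) by (unfold M; lra).
    destruct (Hbeta (e / M)) as [C HC]; [now apply Rdiv_lt_0_compat|].
    exists (M * (Rabs C + 2 * B)). intros n z.
    assert (Hiter : forall n u, Nat.iter n (conj F) u = Qi (Nat.iter n F (Q u))).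
    { induction n0 as [|n0 IH]; intros u; simpl; [now rewrite HQi|]. unfold conj at 1. now rewrite IH, HQQi. }
    set (u := Qi z). set (u' := Nat.iter n (conj F) u).
    assert (Ez : z = Q u) by (unfold u; now rewrite HQQi).
    assert (Ez' : Nat.iter n F z = Q u').
    { unfold u'; now rewrite Hiter, HQQi, <- Ez. }
    set (x := fst u' - fst u - INR n * beta). set (y := snd u' - snd u - INR n * rho').
    assert (Hx : Rabs x <= INR n * (e / M) + Rabs C).
    { specialize (HC n u). unfold displacement in HC. fold u' in HC. fold x in HC. pose proof (Rle_abs C); lra. }
    assert (Hy : Rabs y <= 2 * B).
    { pose proof (Hbound u) as B1; pose proof (Hbound u') as B2.
      assert (E : Ht (Q u') = Ht (Q u) + INR n * rho').
      { rewrite <- Ez', <- Ez. apply (iter_height Ht F rho' Hrot). }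
      replace y with ((Ht (Q u) - snd u) + - (Ht (Q u') - snd u')) by (unfold y; lra).
      eapply Rle_trans; [apply Rabs_triang|]. rewrite Rabs_Ropp. lra. }
    assert (Hcomb : forall s t : R, Rabs s + Rabs t <= M ->
      Rabs (s * x + t * y) <= INR n * e + M * (Rabs C + 2 * B)).
    { intros s0 t0 Hst. eapply Rle_trans; [apply Rabs_triang|]. rewrite !Rabs_mult.
      pose proof (Rabs_pos s0); pose proof (Rabs_pos t0); pose proof (pos_INR n).
      pose proof (Rabs_pos x); pose proof (Rabs_pos y); pose proof (Rabs_pos C).
      assert (E : M * (e / M) = e) by (field; lra).
      assert (HeM : 0 < e / M) by now apply Rdiv_lt_0_compat.
      assert (Hne : 0 <= INR n * (e / M)) by nra.
      assert (T1 : Rabs s0 * Rabs x <= Rabs s0 * (INR n * (e / M) + Rabs C + 2 * B)) by (apply Rmult_le_compat_l; lra).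
      assert (T2 : Rabs t0 * Rabs y <= Rabs t0 * (INR n * (e / M) + Rabs C + 2 * B)) by (apply Rmult_le_compat_l; lra).
      assert (T3 : (Rabs s0 + Rabs t0) * (INR n * (e / M) + Rabs C + 2 * B) <= M * (INR n * (e / M) + Rabs C + 2 * B))
        by (apply Rmult_le_compat_r; lra).
      assert (T4 : M * (INR n * (e / M)) = INR n * e) 
        by (transitivity (INR n * (M * (e / M))); [ring | now rewrite E]). lra. }
    rewrite Ez', Ez. split.
    + replace (fst (Q u') - fst (Q u) - INR n * fst (Q (beta, rho'))) with (IZR b' * x + IZR r * y)
        by (unfold Q, lin, x, y; cbn [fst snd]; ring).
      apply Hcomb; unfold M; lra.
    + replace (snd (Q u') - snd (Q u) - INR n * snd (Q (beta, rho'))) with (IZR (- a') * x + IZR s * y)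
        by (unfold Q, lin, x, y; cbn [fst snd]; ring).
      apply Hcomb; unfold M; lra.
Qed.
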